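(* Let $G$ be a compact abelian group, $\gamma\in\Gamma$, $s\ge0$, and suppose that $\xi\mapsto(1+\gamma(\xi)^2)^{-1}$ belongs to $L^\alpha(G^\wedge,\mu_{G^\wedge})$ for some $\alpha>s$. Put $\alpha^*=\frac{2\alpha}{\alpha-s}$. Assume moreover that \[ \sup_{\xi\in G^\wedge}\frac{|\xi(h)-1|}{(1+\gamma(\xi)^2)^s}\longrightarrow 0\quad\text{as } h\to e, \] i.e. for every $\epsilon>0$ there is an open neighbourhood $U_\epsilon$ of the identity $e$ of $G$ such that $\frac{|\xi(h)-1|}{(1+\gamma(\xi)^2)^s}\le\epsilon$ for all $h\in U_\epsilon$ and all $\xi\in G^\wedge$. Then for every $p$ with $1\le p<\alpha^*$, the embedding $H^s_\gamma(G)\hookrightarrow L^p_{\mu_G}(G)$ is compact: every sequence bounded in $H^s_\gamma(G)$ has a subsequence converging in $L^p_{\mu_G}(G)$.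
   Context: $G$ is a locally compact abelian group with Haar measure $\mu_G$; $G^\wedge$ is its dual group (continuous homomorphisms $G\to\{z\in\mathbb C:|z|=1\}$, a locally compact abelian group under pointwise multiplication) with Haar measure $\mu_{G^\wedge}$ normalized so that the Plancherel theorem and Fourier inversion hold. For $f\in L^1_{\mu_G}(G)$, $\hat f(\xi)=\int_G\overline{\xi(x)}f(x)\,d\mu_G(x)$, extended to $L^2$ by Plancherel. $\Gamma$ is the set of functions $\gamma:G^\wedge\to[0,\infty)$ for which there is a constant $c_\gamma$ with $\gamma(\alpha\beta)\le c_\gamma[\gamma(\alpha)+\gamma(\beta)]$ for all $\alpha,\beta\in G^\wedge$. For $\gamma\in\Gamma$ and real $s\ge0$, $H^s_\gamma(G)$ is the set of $f\in L^2_{\mu_G}(G)$ with $\|f\|_{H^s_\gamma(G)}=\left(\int_{G^\wedge}(1+\gamma(\xi)^2)^s|\hat f(\xi)|^2\,d\mu_{G^\wedge}(\xi)\right)^{1/2}<\infty$. *)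

(* Defs.v *)
From HB Require Import structures.
From mathcomp Require Import all_boot all_order all_algebra.
From mathcomp Require Import all_classical all_reals all_analysis.
From mathcomp Require Import complex.

Set Implicit Arguments.
Unset Strict Implicit.
Unset Printing Implicit Defensive.

Import Order.TTheory GRing.Theory Num.Theory.
Import numFieldNormedType.Exports.
Local Open Scope classical_set_scope.
Local Open Scope ring_scope.

Section PointedAlias.
Variable G : topologicalZmodType.
Definition pointedG : Type := G.
HB.instance Definition _ := Topological.on pointedG.
HB.instance Definition _ := isPointed.Build pointedG (0 : G).
End PointedAlias.

Definition borel (G : topologicalZmodType) :=
  g_sigma_algebraType (@open (pointedG G)).

Section Defs.
Variables (R : realType).

Definition cabs (z : R[i]) : R := Num.sqrt (complex.Re z ^+ 2 + complex.Im z ^+ 2).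

Variable (G : topologicalZmodType).

Definition haar_measure (mu : {measure set (borel G) -> \bar R}) : Prop :=
  [/\ (0 < mu setT)%E,
      (forall K : set G, compact K -> (mu K < +oo)%E),
      (forall A : set (borel G), measurable A ->
         mu A = ereal_inf [set mu U | U in [set U : set G | open U /\ A `<=` U]]),
      (forall U : set G, open U ->
         mu U = ereal_sup [set mu K | K in [set K : set G | compact K /\ K `<=` U]]) &
      (forall (a : G) (A : set (borel G)), measurable A ->
         mu [set a + x | x in A] = mu A)].

Definition is_character (xi : G -> R[i]) : Prop :=
  [/\ forall x y : G, xi (x + y) = xi x * xi y,
      forall x : G, cabs (xi x) = 1,
      continuous (fun x : G => complex.Re (xi x)) &
      continuous (fun x : G => complex.Im (xi x))].

Definition dual : set (G -> R[i]) := [set xi | is_character xi].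

Definition in_Gamma (gamma : (G -> R[i]) -> R) : Prop :=
  (forall xi, dual xi -> 0 <= gamma xi) /\
  exists c : R, forall a b ab, dual a -> dual b -> dual ab ->
    (forall x, ab x = a x * b x) -> gamma ab <= c * (gamma a + gamma b).

Variable (mu : {measure set (borel G) -> \bar R}).

Definition fourier (f : G -> R[i]) (xi : G -> R[i]) : R[i] :=
  complex.Complex
    (Rintegral mu setT (fun x : borel G => complex.Re ((xi x)^* * f x)))
    (Rintegral mu setT (fun x : borel G => complex.Im ((xi x)^* * f x))).

Definition in_Lp (p : R) (f : G -> R[i]) : Prop :=
  [/\ measurable_fun [set: borel G] (fun x : borel G => complex.Re (f x)),
      measurable_fun [set: borel G] (fun x : borel G => complex.Im (f x)) &
      (\int[mu]_(x in [set: borel G]) ((cabs (f x)) `^ p)%:E < +oo)%E].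

(* Haar measure on the discrete dual of a compact group: counting measure
   scaled by 1/mu(G), the normalization for which Plancherel holds. *)
Definition dual_weight : R := (fine (mu setT))^-1.

Definition Hs_norm2 (gamma : (G -> R[i]) -> R) (s : R) (f : G -> R[i]) : \bar R :=
  esum dual (fun xi => (dual_weight * (1 + gamma xi ^+ 2) `^ s
                        * cabs (fourier f xi) ^+ 2)%:E).

Definition in_Hs (gamma : (G -> R[i]) -> R) (s : R) (f : G -> R[i]) : Prop :=
  in_Lp 2 f /\ (Hs_norm2 gamma s f < +oo)%E.

End Defs.

(* Main.v *)
(** Fourier coefficients of a sequence bounded in H^s are bounded, hence converge
    along an ultrafilter; it remains to approximate in L^p, uniformly over a ball
    of H^s, by finitely many frequencies.

    For s > 0 the summability hypothesis makes [1 + gamma^2 <= 2^k] a finite set of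
    O(2^(k alpha)) characters. The dyadic block of f between 2^k and 2^(k+1) has
    squared L^2-norm O(2^(-k s)), hence squared sup-norm O(2^(k (alpha - s))) by
    Cauchy-Schwarz, and interpolating its L^p-norm between these two bounds gives a
    geometric decay exactly when p < 2 alpha / (alpha - s); no Hausdorff-Young
    inequality is needed. For s = 0 the equicontinuity hypothesis forces the dual
    to be finite.

    That the Fourier series of f sums to f is the Peter-Weyl theorem. For a
    continuous self-adjoint k <> 0, the normalized convolution powers k^(2n) / r^n
    converge uniformly to a nonzero convolution idempotent e; an e that does not
    split further generates a one-dimensional ideal, so its translates are multiples
    of e and e / e(0) is a character at which k has a nonzero coefficient. *)

Require Import Defs.
From mathcomp Require Import all_boot all_order all_algebra.
From mathcomp Require Import all_classical all_reals all_analysis.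
From mathcomp Require Import measurable_realfun complex ring lra.
Import Order.TTheory GRing.Theory Num.Theory.
Import numFieldNormedType.Exports.
Local Open Scope classical_set_scope.
Local Open Scope ring_scope.

Set Implicit Arguments.
Unset Strict Implicit.
Unset Printing Implicit Defensive.

(** * Complex-valued functions *)

(** The usual route to Peter-Weyl diagonalizes compact convolution operators on L^2. Here the
    spectral input is a statement about real sequences: for self-adjoint k the even convolution
    powers have at 0 the square norms of the powers of k, Cauchy-Schwarz makes these numbers
    log-convex, and convolution sends pairs of L^2 functions to bounded ones, so that L^2
    convergence of the normalized powers becomes uniform.

    Only uniqueness is taken from Peter-Weyl: an integrable function whose coefficients all vanish
    is zero almost everywhere. For p > 2 a function f of H^s is not known beforehand to lie in L^p;
    its dyadic partial sums are Cauchy there, their limit g has the coefficients of f, and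
    uniqueness gives f = g almost everywhere.

    The limits of the coefficients along the ultrafilter are never identified with the coefficients
    of a function. They only make the extracted subsequence Cauchy in L^p, and its limit comes from
    completeness. *)

Section cabs.
Variable R : realType.
Implicit Types z w : R[i].

Lemma cabsE z : (cabs z)%:C%C = `|z|.
Proof. by rewrite normc_def. Qed.

Lemma cabs_ge0 z : 0 <= cabs z.
Proof. exact: sqrtr_ge0. Qed.

Lemma cabsM z w : cabs (z * w) = cabs z * cabs w.
Proof. by apply: (@complexI R); rewrite rmorphM/= !cabsE normrM. Qed.

Lemma cabsD z w : cabs (z + w) <= cabs z + cabs w.
Proof. by rewrite -lecR rmorphD/= !cabsE ler_normD. Qed.

Lemma cabsN z : cabs (- z) = cabs z.
Proof. by apply: (@complexI R); rewrite !cabsE normrN. Qed.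

Lemma cabsB z w : cabs (z - w) = cabs (w - z).
Proof. by rewrite -cabsN opprB. Qed.

Lemma cabs_conj z : cabs z^* = cabs z.
Proof. by apply: (@complexI R); rewrite !cabsE norm_conjC. Qed.

Lemma cabs0 : cabs (0 : R[i]) = 0.
Proof. by apply: (@complexI R); rewrite !cabsE normr0. Qed.

Lemma cabs1 : cabs (1 : R[i]) = 1.
Proof. by apply: (@complexI R); rewrite !cabsE normr1. Qed.

Lemma cabs_eq0 z : cabs z = 0 -> z = 0.
Proof. by move=> z0; apply/eqP; rewrite -normr_eq0 -cabsE z0. Qed.

Lemma cabsr (x : R) : cabs x%:C%C = `|x|.
Proof. by rewrite /cabs/= expr0n addr0 sqrtr_sqr. Qed.

Lemma sqr_cabs z : cabs z ^+ 2 = complex.Re z ^+ 2 + complex.Im z ^+ 2.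
Proof. by rewrite sqr_sqrtr// addr_ge0// sqr_ge0. Qed.

Lemma sqr_cabsE z : (cabs z ^+ 2)%:C%C = z * z^*.
Proof. by rewrite rmorphXn/= cabsE normCK. Qed.

Lemma normRe_cabs z : `|complex.Re z| <= cabs z.
Proof. by rewrite -sqrtr_sqr ler_wsqrtr// lerDl sqr_ge0. Qed.

Lemma normIm_cabs z : `|complex.Im z| <= cabs z.
Proof. by rewrite -sqrtr_sqr ler_wsqrtr// lerDr sqr_ge0. Qed.

Lemma cabs_ReIm z : cabs z <= `|complex.Re z| + `|complex.Im z|.
Proof.
rewrite -(@ler_pXn2r _ 2) ?nnegrE ?cabs_ge0 ?addr_ge0//.
rewrite sqr_cabs sqrrD !real_normK ?num_real// lerD2r lerDl.
by rewrite mulrn_wge0// mulr_ge0.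
Qed.

Lemma cabs_sum (I : Type) (r : seq I) (P : pred I) (F : I -> R[i]) :
  cabs (\sum_(i <- r | P i) F i) <= \sum_(i <- r | P i) cabs (F i).
Proof.
elim/big_ind2 : _ => [|x x' y y' hx hy|//]; first by rewrite cabs0.
by rewrite (le_trans (cabsD _ _))// lerD.
Qed.

Lemma Re_add z w : @complex.Re R (z + w) = @complex.Re R z + @complex.Re R w.
Proof. by case: z w => [a b] [c d]. Qed.

Lemma Im_add z w : @complex.Im R (z + w) = @complex.Im R z + @complex.Im R w.
Proof. by case: z w => [a b] [c d]. Qed.

Lemma Re_opp z : @complex.Re R (- z) = - @complex.Re R z.
Proof. by case: z. Qed.

Lemma Im_opp z : @complex.Im R (- z) = - @complex.Im R z.
Proof. by case: z. Qed.

Lemma Re_mul z w :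
  @complex.Re R (z * w) = @complex.Re R z * @complex.Re R w - @complex.Im R z * @complex.Im R w.
Proof. by case: z w => [a b] [c d]. Qed.

Lemma Im_mul z w :
  @complex.Im R (z * w) = @complex.Re R z * @complex.Im R w + @complex.Im R z * @complex.Re R w.
Proof. by case: z w => [a b] [c d]. Qed.

Lemma Re_cj z : @complex.Re R z^* = @complex.Re R z.
Proof. by case: z. Qed.

Lemma Im_cj z : @complex.Im R z^* = - @complex.Im R z.
Proof. by case: z. Qed.

Lemma eq_ReIm z w :
  complex.Re z = complex.Re w -> complex.Im z = complex.Im w -> z = w.
Proof. by case: z w => [a b] [c d] /= -> ->. Qed.

End cabs.

Section ccont.
Variables (R : realType) (T : topologicalType).
Implicit Types f g : T -> R[i].

(** Continuity is read on real and imaginary parts, the form in which [is_character] provides it. *)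
Definition ccont f : Prop :=
  continuous (fun x => complex.Re (f x) : R) /\
  continuous (fun x => complex.Im (f x) : R).

Lemma eq_ccont f g : f =1 g -> ccont f -> ccont g.
Proof. by move=> /funext ->. Qed.

Lemma ccont_cst (c : R[i]) : ccont (fun=> c).
Proof. by split=> x; exact: cvg_cst. Qed.

Lemma ccontD f g : ccont f -> ccont g -> ccont (fun x => f x + g x).
Proof.
move=> [rf jf] [rg jg]; split.
  under eq_fun do rewrite Re_add.
  by move=> x; apply: cvgD; [exact: rf|exact: rg].
under eq_fun do rewrite Im_add.
by move=> x; apply: cvgD; [exact: jf|exact: jg].
Qed.

Lemma ccontN f : ccont f -> ccont (fun x => - f x).
Proof.
move=> [rf jf]; split.
  under eq_fun do rewrite Re_opp.
  by move=> x; apply: cvgN; exact: rf.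
under eq_fun do rewrite Im_opp.
by move=> x; apply: cvgN; exact: jf.
Qed.

Lemma ccontB f g : ccont f -> ccont g -> ccont (fun x => f x - g x).
Proof. by move=> cf cg; apply: ccontD => //; exact: ccontN. Qed.

Lemma ccontM f g : ccont f -> ccont g -> ccont (fun x => f x * g x).
Proof.
move=> [rf jf] [rg jg]; split.
  under eq_fun do rewrite Re_mul.
  move=> x; apply: cvgB; apply: cvgM;
    [exact: rf|exact: rg|exact: jf|exact: jg].
under eq_fun do rewrite Im_mul.
move=> x; apply: cvgD; apply: cvgM;
  [exact: rf|exact: jg|exact: jf|exact: rg].
Qed.

Lemma ccontZ c f : ccont f -> ccont (fun x => c * f x).
Proof. by move=> cf; apply: ccontM => //; exact: ccont_cst. Qed.

Lemma ccont_conj f : ccont f -> ccont (fun x => (f x)^*).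
Proof.
move=> [rf jf]; split.
  by under eq_fun do rewrite Re_cj.
under eq_fun do rewrite Im_cj.
by move=> x; apply: cvgN; exact: jf.
Qed.

Lemma ccont_cabs f : ccont f -> continuous (fun x => cabs (f x)).
Proof.
move=> [rf jf] x.
have sqc (h : T -> R) : continuous h -> {for x, continuous (fun y => h y ^+ 2)}.
  move=> ch; apply: (@continuous_comp _ _ _ h (fun t : R => t ^+ 2)).
    exact: ch.
  exact: exprn_continuous.
apply: (@continuous_comp _ _ _
  (fun y => complex.Re (f y) ^+ 2 + complex.Im (f y) ^+ 2) (@Num.sqrt R)).
  by apply: cvgD; [exact: (sqc _ rf)|exact: (sqc _ jf)].
exact: sqrt_continuous.
Qed.

End ccont.

Lemma ccont_comp (R : realType) (T U : topologicalType) (f : U -> R[i])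
  (h : T -> U) : ccont f -> continuous h -> ccont (f \o h).
Proof.
move=> [rf jf] ch; split=> x.
- apply: (@continuous_comp _ _ _ h (fun y => complex.Re (f y))); first exact: ch.
  exact: rf.
- apply: (@continuous_comp _ _ _ h (fun y => complex.Im (f y))); first exact: ch.
  exact: jf.
Qed.

(** * Log-convex submultiplicative sequences *)

Section ratio_limit.
Variable R : realType.

(* With rho j = a (j+1) / a j nondecreasing, a j * rho j ^ (n+1) <= a (j+n+1) <= a j * a n
   yields a n >= r ^ (n+1) for r = sup rho, which keeps the limit away from 0. *)
Lemma logconvex_ratio_limit (a : nat -> R) : (forall n, 0 < a n) ->
  (forall n, a n.+1 ^+ 2 <= a n * a n.+2) ->
  (forall n m, a (n + m).+1 <= a n * a m) ->
  exists r d : R, [/\ 0 < r, 1 <= d & (fun n => a n / r ^+ n.+1) @ \oo --> d].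
Proof.
move=> a0 lc sm.
pose rho n := a n.+1 / a n.
have rho0 n : 0 < rho n by rewrite divr_gt0.
have rhoS n : rho n <= rho n.+1.
  rewrite /rho ler_pdivrMr// mulrAC ler_pdivlMr// -expr2 mulrC [leRHS]mulrC.
  by rewrite [leRHS]mulrC.
have rho_mono n m : (n <= m)%N -> rho n <= rho m.
  by move=> /subnK <-; elim: (m - n)%N => // k IH; rewrite addSn (le_trans IH).
have rho_ub n : rho n <= a 0%N.
  by rewrite /rho ler_pdivrMr// mulrC; have := sm n 0%N; rewrite addn0.
have hs : has_sup (range rho).
  by split; [exists (rho 0%N); exists 0%N|exists (a 0%N) => _ [n _ <-]].
pose r := sup (range rho).
have rho_r n : rho n <= r by apply: sup_upper_bound => //; exists n.
have r0 : 0 < r by rewrite (lt_le_trans (rho0 0%N)).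
have geo j n : a j * rho j ^+ n <= a (j + n)%N.
  elim: n => [|n IH]; first by rewrite expr0 mulr1 addn0.
  rewrite exprSr mulrA addnS.
  have -> : a (j + n).+1 = a (j + n)%N * rho (j + n)%N.
    by rewrite /rho mulrCA mulfV ?mulr1// gt_eqF.
  apply: ler_pM => //; first by rewrite mulr_ge0 ?exprn_ge0// ltW.
  - by rewrite ltW.
  - by rewrite rho_mono// leq_addr.
have arho j n : rho j ^+ n.+1 <= a n.
  rewrite -(ler_pM2l (a0 j)) (le_trans (geo _ _))//.
  by rewrite addnS (le_trans (sm _ _)).
have ar n : r ^+ n.+1 <= a n.
  (* If [a n] fell below [r ^+ n.+1], its root of order n + 1 would lie below the supremum [r],
     hence below some [rho j], contradicting [arho]. *)
  rewrite leNgt; apply/negP => anr.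
  have q0 : 0 <= a n `^ (n.+1%:R^-1) by exact: powR_ge0.
  have aE : a n = (a n `^ (n.+1%:R^-1)) ^+ n.+1.
    by rewrite -powR_mulrn// -powRrM mulVf// powRr1// ltW.
  have : a n `^ (n.+1%:R^-1) < r.
    by move: anr; rewrite {1}aE ltr_pXn2r// nnegrE// ltW.
  move=> /(sup_gt (proj1 hs)) [_ [j _ <-]].
  by rewrite -(ltr_pXn2r (ltn0Sn n)) ?nnegrE// -?aE ?ltNge ?arho// ltW.
(* Successive ratios of [b] are [rho n / r <= 1], so [b] decreases, and it stays above 1 by [ar]. *)
pose b n := a n / r ^+ n.+1.
have rn0 n : 0 < r ^+ n by exact: exprn_gt0.
have b1 n : 1 <= b n by rewrite /b ler_pdivlMr// mul1r.
have bS n : b n.+1 <= b n.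
  have -> : b n.+1 = b n * (rho n / r).
    rewrite /b /rho [r ^+ n.+2]exprS; field.
    by rewrite !gt_eqF// exprn_gt0.
  have q1 : rho n / r <= 1 by rewrite ler_pdivrMr// mul1r.
  by apply: ler_piMr => //; exact: le_trans ler01 (b1 n).
have bm : nonincreasing_seq b by apply/nonincreasing_seqP.
have lb : has_lbound (range b) by exists 1 => _ [n _ <-].
exists r, (inf (range b)); split => //.
  apply: lb_le_inf; first by exists (b 0%N); exists 0%N.
  by move=> _ [n _ <-].
exact: nonincreasing_cvgn.
Qed.

End ratio_limit.

(** * The Haar mean and convolution of continuous functions *)

Section mean.
Variables (R : realType) (G : topologicalZmodType).
Variable mu : {measure set (borel G) -> \bar R}.
Hypothesis Gcompact : compact [set: G].
Hypothesis Ghaar : haar_measure mu.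

Let T := borel G.

Lemma mu_gt0 : (0 < mu setT)%E.
Proof. by case: Ghaar. Qed.

Lemma mu_fin : (mu setT < +oo)%E.
Proof. by case: Ghaar => _ + _ _ _; apply. Qed.

Lemma mu_finE (A : set T) : measurable A -> (mu A < +oo)%E.
Proof.
move=> mA; rewrite (le_lt_trans _ mu_fin)//.
by apply: le_measure => //; rewrite inE.
Qed.

Definition mass : R := fine (mu setT).

Lemma mass_gt0 : 0 < mass.
Proof. by rewrite fine_gt0// mu_gt0 mu_fin. Qed.

Lemma massE : (mass%:E = mu setT)%E.
Proof. by rewrite fineK// ge0_fin_numE// mu_fin. Qed.

Lemma open_borel (U : set G) : open U -> measurable (U : set T).
Proof. by move=> oU; apply: sub_sigma_algebra. Qed.

Lemma continuous_borel (f : G -> R) : continuous f ->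
  measurable_fun [set: T] (f : T -> R).
Proof.
move=> cf; apply: (measurability _ (RGenOpens.measurableE R)) => _ [_ [a [b ->] <-]].
rewrite setTI; apply: open_borel.
by move/continuousP: cf; apply; exact: interval_open.
Qed.

Definition L1 (f : G -> R) : Prop := mu.-integrable [set: T] (EFin \o (f : T -> R)).

Lemma bounded_L1 (f : G -> R) (M : R) : measurable_fun [set: T] (f : T -> R) ->
  (forall x, `|f x| <= M) -> L1 f.
Proof.
move=> mf fM; apply: measurable_bounded_integrable => //; first exact: mu_fin.
exists M; split; first exact: num_real.
by move=> N MN x _; rewrite /= (le_trans (fM x))// ltW.
Qed.

Lemma continuous_bounded (f : G -> R) : continuous f ->
  exists2 M, 0 < M & forall x, `|f x| <= M.
Proof.
move=> cf.
have /compact_bounded [M [_ hM]] : compact (f @` [set: G]).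
  by apply: continuous_compact => //; exact: continuous_subspaceT.
exists (`|M| + 1); first by rewrite ltr_wpDl.
move=> x; apply: hM; first by rewrite ltr_pwDr// ler_norm.
by exists x.
Qed.

Lemma continuous_L1 (f : G -> R) : continuous f -> L1 f.
Proof.
move=> cf; have [M _ fM] := continuous_bounded cf.
by apply: bounded_L1 fM; exact: continuous_borel.
Qed.

Lemma L1_measurable f : L1 f -> measurable_fun [set: T] (f : T -> R).
Proof. by move=> /measurable_int/measurable_EFinP. Qed.

Lemma L1D f g : L1 f -> L1 g -> L1 (fun x => f x + g x).
Proof. exact: integrableD. Qed.

Lemma L1N f : L1 f -> L1 (fun x => - f x).
Proof. exact: integrableN. Qed.

Lemma L1B f g : L1 f -> L1 g -> L1 (fun x => f x - g x).
Proof. by move=> f1 g1; apply: L1D => //; exact: L1N. Qed.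

Lemma L1Z c f : L1 f -> L1 (fun x => c * f x).
Proof. by move=> f1; exact: (@integrableZl _ _ _ mu setT measurableT c _ f1). Qed.

Lemma L1_norm f : L1 f -> L1 (fun x => `|f x|).
Proof. exact: integrable_norm. Qed.

Lemma L1M (f g : G -> R) (M : R) : measurable_fun [set: T] (f : T -> R) ->
  (forall x, `|f x| <= M) -> L1 g -> L1 (fun x => f x * g x).
Proof.
move=> mf fM g1.
apply: (le_integrable measurableT _ _ (L1Z M (L1_norm g1))).
  apply/measurable_EFinP; apply: measurable_funM => //; exact: L1_measurable.
move=> x _; rewrite /= lee_fin normrM (le_trans _ (ler_norm _))//.
by rewrite ler_wpM2r.
Qed.

Lemma continuousM_L1 (f g : G -> R) : continuous f -> L1 g ->
  L1 (fun x => f x * g x).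
Proof.
move=> cf; have [M _ fM] := continuous_bounded cf.
by apply: L1M fM; exact: continuous_borel.
Qed.

Lemma L1_sum (I : Type) (r : seq I) (F : I -> G -> R) : (forall i, L1 (F i)) ->
  L1 (fun x => \sum_(i <- r) F i x).
Proof.
move=> hF; elim: r => [|i r IH].
  under eq_fun do rewrite big_nil.
  by apply: continuous_L1 => x; exact: cvg_cst.
by under eq_fun do rewrite big_cons; exact: L1D.
Qed.

Definition mean (f : G -> R) : R := dual_weight mu * Rintegral mu [set: T] (f : T -> R).

Lemma weight_gt0 : 0 < dual_weight mu.
Proof. by rewrite invr_gt0 mass_gt0. Qed.

Lemma eq_mean f g : f =1 g -> mean f = mean g.
Proof. by move=> /funext ->. Qed.

Lemma meanD f g : L1 f -> L1 g -> mean (fun x => f x + g x) = mean f + mean g.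
Proof. by move=> f1 g1; rewrite /mean RintegralD// mulrDr. Qed.

Lemma meanZ c f : L1 f -> mean (fun x => c * f x) = c * mean f.
Proof. by move=> f1; rewrite /mean RintegralZl// mulrCA. Qed.

Lemma meanN f : L1 f -> mean (fun x => - f x) = - mean f.
Proof.
move=> f1; under eq_mean do rewrite -mulN1r.
by rewrite meanZ// mulN1r.
Qed.

Lemma meanB f g : L1 f -> L1 g -> mean (fun x => f x - g x) = mean f - mean g.
Proof. by move=> f1 g1; rewrite meanD ?meanN//; exact: L1N. Qed.

Lemma mean_cst c : mean (fun=> c) = c.
Proof.
rewrite /mean Rintegral_cst// mulrCA /dual_weight mulVf ?mulr1//.
by rewrite gt_eqF// mass_gt0.
Qed.

Lemma mean_ge0 f : (forall x, 0 <= f x) -> 0 <= mean f.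
Proof.
by move=> f0; rewrite mulr_ge0 ?Rintegral_ge0// ltW// weight_gt0.
Qed.

Lemma le_mean f g : L1 f -> L1 g -> (forall x, f x <= g x) -> mean f <= mean g.
Proof.
by move=> f1 g1 fg; rewrite ler_pM2l ?weight_gt0//; exact: le_Rintegral.
Qed.

Lemma norm_mean f : L1 f -> `|mean f| <= mean (fun x => `|f x|).
Proof.
move=> f1; rewrite normrM gtr0_norm ?weight_gt0// ler_pM2l ?weight_gt0//.
exact: le_normr_Rintegral.
Qed.

Lemma norm_mean_le f M : L1 f -> (forall x, `|f x| <= M) -> `|mean f| <= M.
Proof.
move=> f1 fM; rewrite (le_trans (norm_mean f1))// -[leRHS]mean_cst.
apply: le_mean => //; first exact: L1_norm.
by apply: continuous_L1 => x; exact: cvg_cst.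
Qed.

Lemma mean_sum (I : Type) (r : seq I) (F : I -> G -> R) : (forall i, L1 (F i)) ->
  mean (fun x => \sum_(i <- r) F i x) = \sum_(i <- r) mean (F i).
Proof.
move=> hF; elim: r => [|i r IH].
  by under eq_mean do rewrite big_nil; rewrite big_nil mean_cst.
under eq_mean do rewrite big_cons.
by rewrite big_cons meanD ?IH//; exact: L1_sum.
Qed.

Lemma shift_continuous (a : G) : continuous (fun x : G => x + a).
Proof.
move=> x; apply: (@continuous_comp _ _ _ (fun x : G => (x, a))
  (fun z : G * G => z.1 + z.2)); last exact: add_continuous.
by apply: cvg_pair; [exact: cvg_id|exact: cvg_cst].
Qed.

Lemma shift_measurable (a : G) :
  measurable_fun [set: T] ((fun x : G => x + a) : T -> T).
Proof.
apply: (@measurability _ _ T T setT _ (@open (pointedG G)) erefl) => _ [U oU <-].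
rewrite setTI; apply: open_borel.
by move/continuousP: (@shift_continuous a); exact.
Qed.

Lemma mu_shift (a : G) (A : set T) : measurable A ->
  mu ((fun x : G => x + a) @^-1` A) = mu A.
Proof.
move=> mA; case: Ghaar => _ _ _ _ /(_ (- a) A mA) <-.
congr (mu _); apply/seteqP; split=> [x /= Ax|_ [y Ay <-]].
  by exists (x + a) => //; rewrite addrC addrK.
by rewrite /= addrC addrA subrr add0r.
Qed.

Lemma mean_shift (a : G) (f : G -> R) : continuous f -> mean (fun x => f (x + a)) = mean f.
Proof.
move=> cf; congr (_ * fine _).
have msh := shift_measurable a.
have cfa : continuous (fun x => f (x + a)).
  move=> x; apply: (@continuous_comp _ _ _ (fun x : G => x + a) f).
    exact: shift_continuous.
  exact: cf.
transitivity (\int[pushforward mu ((fun x : G => (x + a)%R) : T -> T)]_x (f x)%:E)%E.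
  rewrite (integral_pushforward msh)//.
  - by apply/measurable_EFinP; exact: continuous_borel.
  - exact: continuous_L1.
by apply: eq_measure_integral => A mA _; exact: mu_shift.
Qed.

Lemma continuous_sum (I : Type) (r : seq I) (F : I -> G -> R) :
  (forall i, continuous (F i)) -> continuous (fun x => \sum_(i <- r) F i x).
Proof.
move=> cF; elim: r => [|i r IH] x.
  by under eq_fun do rewrite big_nil; exact: cvg_cst.
by under eq_fun do rewrite big_cons; apply: cvgD; [exact: cF|exact: IH].
Qed.

(* The Borel sets of G * G need not be generated by rectangles, so the Fubini theorem
   for product measures does not apply; instead, one finite quadrature rule is
   accurate for all functions that oscillate little on the members of a cover. *)
Lemma quadrature (U : G -> set G) : (forall a, open (U a)) -> (forall a, U a a) ->
  exists n (a : nat -> G) (w : nat -> R), forall (u : G -> R) (c : nat -> R) (e : R),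
    L1 u -> (forall i x, U (a i) x -> `|u x - c i| <= e) ->
    `|mean u - \sum_(i < n) w i * c i| <= e.
Proof.
move=> oU Ua.
have : @cover_compact (pointedG G) [set: G] by rewrite -compact_cover.
move=> /(_ _ [set: G] U) [//| |D _ covD]; first by move=> x _; exists x.
pose l : seq G := finmap.enum_fset D.
(* Padding the finite cover with empty sets turns it into a sequence, which [seqDU] makes disjoint
   without changing its union. *)
pose F i : set T := if (i < size l)%N then U (nth 0 l i) else set0.
have mF i : measurable (F i).
  by rewrite /F; case: ifP => // _; exact: open_borel.
pose B := seqDU F.
have mB i : measurable (B i).
  by apply: measurableD => //; exact: bigsetU_measurable.
have BF i x : B i x -> (i < size l)%N /\ U (nth 0 l i) x.
  by move=> [+ _]; rewrite /F; case: ifP.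
have coverB x : exists i, B i x.
  have [a aD Uax] := covD x I.
  have : (\bigcup_i F i) x.
    exists (index a l) => //.
    have al : a \in l by [].
    by rewrite /F index_mem al nth_index.
  by rewrite seqDU_bigcup_eq => -[i _ Bi]; exists i.
have sumB (c : nat -> R) i x : B i x ->
    \sum_(j < size l) c j * \1_(B j) x = c i.
  move=> Bix; have [il _] := BF _ _ Bix.
  rewrite (bigD1 (Ordinal il))//= indicE mem_set// mulr1 big1 ?addr0// => j ji.
  rewrite indicE memNset ?mulr0// => Bjx.
  move/eqP: ji; apply; apply: val_inj => /=.
  by apply: (@trivIset_seqDU _ F j i I I); exists x.
have L1i i : L1 (\1_(B i)).
  apply: (@bounded_L1 _ 1) => // x.
  by rewrite ger0_norm ?indicE// lern1 leq_b1.
exists (size l), (nth 0 l), (fun i => mean (\1_(B i))) => u c e u1 uc.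
(* The quadrature sum is the mean of the step function with value [c i] on [B i]; the weights are
   the means of the indicators. *)
have -> : \sum_(i < size l) mean \1_(B i) * c i =
    mean (fun x => \sum_(i < size l) c i * \1_(B i) x).
  rewrite mean_sum; last by move=> i; exact: L1Z.
  by apply: eq_bigr => i _; rewrite meanZ// mulrC.
have L1s : L1 (fun x => \sum_(i < size l) c i * \1_(B i) x).
  by apply: L1_sum => i; exact: L1Z.
rewrite -meanB//; apply: norm_mean_le => [|x]; first exact: L1B.
have [i Bix] := coverB x.
by rewrite (sumB _ _ _ Bix) uc//; have [] := BF _ _ Bix.
Qed.

Lemma continuous2_l (F : G * G -> R) (x : G) : continuous F -> continuous (fun y => F (x, y)).
Proof.
move=> cF y; apply: (@continuous_comp _ _ _ (fun y => (x, y)) F); last exact: cF.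
by apply: cvg_pair; [exact: cvg_cst|exact: cvg_id].
Qed.

Lemma continuous2_r (F : G * G -> R) (y : G) : continuous F -> continuous (fun x => F (x, y)).
Proof.
move=> cF x; apply: (@continuous_comp _ _ _ (fun x => (x, y)) F); last exact: cF.
by apply: cvg_pair; [exact: cvg_id|exact: cvg_cst].
Qed.

(** Compactness in the second variable: near each [(a, y)] both [F (x, y')] and [F (a, y')] are
    within [e / 2] of [F (a, y)], and finitely many such neighbourhoods of points [y] cover G. *)
Lemma tube (F : G * G -> R) (e : R) (a : G) : continuous F -> 0 < e ->
  \forall x \near a, forall y, `|F (x, y) - F (a, y)| <= e.
Proof.
move=> cF e0.
have := (@compact_near_coveringP G [set: G]).1 Gcompact G (nbhs a)
  (fun x y => `|F (x, y) - F (a, y)| <= e) _.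
have H : forall y, [set: G] y ->
   \forall y' \near y & x \near nbhs a, `|F (x, y') - F (a, y')| <= e.
  move=> y _.
  have e2 : 0 < e / 2 by rewrite divr_gt0.
  have /cvgrPdist_le/(_ _ e2) := cF (a, y).
  move=> -[[A B]] /= [nA nB] AB.
  exists (B, A) => //= -[y' x'] [/= By' Ax'].
  have h1 := AB (x', y') (conj Ax' By').
  have h2 := AB (a, y') (conj (nbhs_singleton nA) By').
  rewrite (le_trans (ler_distD (F (a, y)) _ _))// [leRHS](splitr e) lerD//.
  by rewrite distrC.
move=> /(_ _ H); apply: filterS => x hx y; exact: hx.
Qed.

(** By [tube] the kernels [F (x, _)] and [F (a, _)] are uniformly close, so the error is that
    closeness times the mean of [|h|]. Integrability of [h] is enough for this. *)
Lemma mean_continuous (F : G * G -> R) (h : G -> R) : continuous F -> L1 h ->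
  continuous (fun x => mean (fun y => F (x, y) * h y)).
Proof.
move=> cF h1 a; apply/cvgrPdist_le => e e0.
have M0 : 0 <= mean (fun y => `|h y|) by exact: mean_ge0.
have d0 : 0 < e / (mean (fun y => `|h y|) + 1) by rewrite divr_gt0// ltr_wpDl.
near=> x.
have hx y : `|F (x, y) - F (a, y)| <= e / (mean (fun y => `|h y|) + 1).
  by move: y; near: x; exact: tube.
have cFx z : L1 (fun y => F (z, y) * h y).
  by apply: continuousM_L1 => //; exact: continuous2_l.
rewrite distrC -meanB//.
rewrite (le_trans (norm_mean _))//; first exact: L1B.
apply: (@le_trans _ _ (mean (fun y => e / (mean (fun y => `|h y|) + 1) * `|h y|))).
  apply: le_mean.
  - by apply: L1_norm; exact: L1B.
  - by apply: L1Z; exact: L1_norm.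
  - by move=> y; rewrite -mulrBl normrM ler_wpM2r.
rewrite meanZ; last exact: L1_norm.
by rewrite mulrAC ler_pdivrMr ?ltr_wpDl// ler_pM2l// lerDl.
Unshelve. all: by end_near. Qed.

(** One quadrature rule in [x] serves every [y] at once, because the cells [U a] control the
    oscillation of [F] uniformly in [y]; the finite sum [S] then commutes with the mean in [y]. *)
Lemma mean_fubini (F : G * G -> R) (h : G -> R) : continuous F -> L1 h ->
  mean (fun x => mean (fun y => F (x, y) * h y)) =
  mean (fun y => mean (fun x => F (x, y)) * h y).
Proof.
move=> cF h1; apply/eqP; rewrite -subr_eq0 -normr_le0; apply/ler_addgt0Pr => e e0.
rewrite add0r.
set M := mean (fun y => `|h y|).
have M0 : 0 <= M by exact: mean_ge0.
(* Each of the two comparisons with [S] costs at most [d * M]; the [+ 1] keeps the denominator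
   positive when [M = 0]. *)
pose d := e / (2 * (M + 1)).
have d0 : 0 < d by rewrite divr_gt0// mulr_gt0// ltr_wpDl.
pose U a := interior [set x | forall y, `|F (x, y) - F (a, y)| <= d].
have Ua a : U a a by exact: tube.
have [n [a [w hw]]] := quadrature (fun a => @open_interior _ _) Ua.
have cFl x : L1 (fun y => F (x, y) * h y).
  by apply: continuousM_L1 => //; exact: continuous2_l.
have cFr : continuous (fun y => mean (fun x => F (x, y))).
  have cF' : continuous (fun z : G * G => F (z.2, z.1)).
    move=> z; apply: (@continuous_comp _ _ _ (fun z : G * G => (z.2, z.1)) F).
      by apply: cvg_pair; [exact: cvg_snd|exact: cvg_fst].
    exact: cF.
  have L11 : L1 (fun=> 1) by apply: continuous_L1 => x; exact: cvg_cst.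
  have := mean_continuous cF' L11.
  by under eq_fun do under eq_mean do rewrite mulr1.
pose S y := \sum_(i < n) w i * F (a i, y).
have cS : continuous S.
  apply: continuous_sum => i y; apply: cvgM; first exact: cvg_cst.
  exact: continuous2_l.
have S1 : mean (fun y => S y * h y) =
    \sum_(i < n) w i * mean (fun y => F (a i, y) * h y).
  under eq_mean do rewrite mulr_suml; rewrite mean_sum.
    apply: eq_bigr => i _; rewrite -meanZ//.
    by under eq_mean do rewrite -mulrA.
  move=> i; under eq_fun do rewrite -mulrA; exact: L1Z.
have A1 : `|mean (fun x => mean (fun y => F (x, y) * h y)) - mean (fun y => S y * h y)| <= d * M.
  rewrite S1; apply: (hw _ (fun i => mean (fun y => F (a i, y) * h y))).
    by apply: continuous_L1; exact: mean_continuous.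
  move=> i x /interior_subset/= Fx.
  rewrite -meanB//.
  rewrite (le_trans (norm_mean _))//; first exact: L1B.
  rewrite /M -meanZ; last exact: L1_norm.
  apply: le_mean.
  - by apply: L1_norm; exact: L1B.
  - by apply: L1Z; exact: L1_norm.
  - by move=> y; rewrite -mulrBl normrM ler_wpM2r.
have A2 : `|mean (fun y => S y * h y) - mean (fun y => mean (fun x => F (x, y)) * h y)| <= d * M.
  have L1a : L1 (fun y => S y * h y) by exact: continuousM_L1.
  have L1b : L1 (fun y => mean (fun x => F (x, y)) * h y) by exact: continuousM_L1.
  rewrite -meanB// (le_trans (norm_mean _))//; first exact: L1B.
  rewrite /M -meanZ; last exact: L1_norm.
  apply: le_mean.
  - by apply: L1_norm; exact: L1B.
  - by apply: L1Z; exact: L1_norm.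
  - move=> y; rewrite -mulrBl normrM ler_wpM2r// distrC.
    apply: (hw _ (fun i => F (a i, y))).
      by apply: continuous_L1; exact: continuous2_r.
    by move=> i x /interior_subset/=; exact.
rewrite (le_trans (ler_distD (mean (fun y => S y * h y)) _ _))//.
rewrite (le_trans (lerD A1 A2))// -mulrDl /d.
have M1 : M + 1 != 0 by rewrite gt_eqF// ltr_wpDl.
have -> : (e / (2 * (M + 1)) + e / (2 * (M + 1))) * M = e * M / (M + 1) by field.
by rewrite ler_pdivrMr ?ltr_wpDl// ler_pM2l// lerDl.
Qed.

Lemma opp_shift_continuous (a : G) : continuous (fun x : G => a - x).
Proof.
move=> x; apply: (@continuous_comp _ _ _ (fun x : G => (a, x))
  (fun z : G * G => z.1 - z.2)); last exact: sub_continuous.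
by apply: cvg_pair; [exact: cvg_cst|exact: cvg_id].
Qed.

(** Translation invariance implies invariance under inversion: integrating [f (y - x)] first in [y]
    gives the mean of [f], first in [x] the mean of its reflection. *)
Lemma mean_opp (f : G -> R) : continuous f -> mean (fun x => f (- x)) = mean f.
Proof.
move=> cf.
have cfo : continuous (fun x => f (- x)).
  move=> x; apply: (@continuous_comp _ _ _ (fun x : G => - x) f).
    exact: opp_continuous.
  exact: cf.
have cF : continuous (fun z : G * G => f (z.2 - z.1)).
  move=> z; apply: (@continuous_comp _ _ _ (fun z : G * G => z.2 - z.1) f).
    apply: (@continuous_comp _ _ _ (fun z : G * G => (z.2, z.1))
      (fun z : G * G => z.1 - z.2)); last exact: sub_continuous.
    by apply: cvg_pair; [exact: cvg_snd|exact: cvg_fst].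
  exact: cf.
have L11 : L1 (fun=> 1) by apply: continuous_L1 => x; exact: cvg_cst.
have eL : mean (fun x => mean (fun y => f (y - x) * 1)) = mean f.
  under eq_mean => x.
    under eq_mean do rewrite mulr1.
    rewrite (mean_shift (- x) cf); over.
  by rewrite mean_cst.
have eR : mean (fun y => mean (fun x => f (y - x)) * 1) = mean (fun x => f (- x)).
  under eq_mean => y.
    rewrite mulr1; under eq_mean do rewrite -opprB.
    rewrite (mean_shift (- y) cfo); over.
  by rewrite mean_cst.
by rewrite -eL -eR; exact/esym/(mean_fubini cF L11).
Qed.

(** If [f a > 0], finitely many translates of the open set where [f > f a / 2] cover G. The sum of
    the corresponding translates of [f] is then at least [f a / 2] everywhere, although each has
    mean 0. *)
Lemma mean_faithful (f : G -> R) : continuous f -> (forall x, 0 <= f x) ->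
  mean f = 0 -> forall x, f x = 0.
Proof.
move=> cf f0 mf0 a; apply/eqP; rewrite eq_le f0 andbT leNgt; apply/negP => fa.
pose U b := [set x | f a / 2 < f (x + (a - b))].
have cfb b : continuous (fun x => f (x + (a - b))).
  move=> x; apply: (@continuous_comp _ _ _ (fun x => x + (a - b)) f).
    exact: shift_continuous.
  exact: cf.
have oU b : open (U b).
  rewrite (_ : U b = (fun x => f (x + (a - b))) @^-1` [set t | f a / 2 < t])//.
  by apply: open_comp; [move=> x _; exact: cfb|exact: open_gt].
have : @cover_compact (pointedG G) [set: G] by rewrite -compact_cover.
move=> /(_ _ [set: G] U) [//| |D _ covD].
  move=> x _; exists x => //; rewrite /U/= addrC subrK.
  by rewrite ltr_pdivrMr// mulr_natr mulr2n ltrDl.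
have : f a / 2 <= mean (fun x => \sum_(b <- finmap.enum_fset D) f (x + (a - b))).
  rewrite -[leLHS]mean_cst; apply: le_mean.
  - by apply: continuous_L1 => x; exact: cvg_cst.
  - by apply: L1_sum => b; exact: continuous_L1.
  - move=> x; have [b bD Ubx] := covD x I.
    have bD' : b \in finmap.enum_fset D by [].
    by rewrite (big_rem b)//= ler_wpDr ?sumr_ge0// ltW.
rewrite mean_sum; last by move=> b; exact: continuous_L1.
rewrite big1 => [|b _]; last by rewrite (mean_shift _ cf).
by rewrite leNgt divr_gt0.
Qed.

(** * Means of complex-valued functions *)

Definition CL1 (f : G -> R[i]) : Prop :=
  L1 (fun x => complex.Re (f x)) /\ L1 (fun x => complex.Im (f x)).

Definition CE (f : G -> R[i]) : R[i] :=
  Complex (mean (fun x => complex.Re (f x))) (mean (fun x => complex.Im (f x))).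

Lemma Re_CE f : @complex.Re R (CE f) = mean (fun x => complex.Re (f x)).
Proof. by []. Qed.

Lemma Im_CE f : @complex.Im R (CE f) = mean (fun x => complex.Im (f x)).
Proof. by []. Qed.

Lemma ccont_CL1 f : ccont f -> CL1 f.
Proof. by move=> [rf jf]; split; exact: continuous_L1. Qed.

Lemma CL1D f g : CL1 f -> CL1 g -> CL1 (fun x => f x + g x).
Proof.
move=> [rf jf] [rg jg]; split.
  by under eq_fun do rewrite Re_add; exact: L1D.
by under eq_fun do rewrite Im_add; exact: L1D.
Qed.

Lemma CL1N f : CL1 f -> CL1 (fun x => - f x).
Proof.
move=> [rf jf]; split.
  by under eq_fun do rewrite Re_opp; exact: L1N.
by under eq_fun do rewrite Im_opp; exact: L1N.
Qed.

Lemma CL1B f g : CL1 f -> CL1 g -> CL1 (fun x => f x - g x).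
Proof. by move=> f1 g1; apply: CL1D => //; exact: CL1N. Qed.

Lemma ccontM_CL1 f g : ccont f -> CL1 g -> CL1 (fun x => f x * g x).
Proof.
move=> [rf jf] [rg jg]; split.
  by under eq_fun do rewrite Re_mul; apply: L1B; exact: continuousM_L1.
by under eq_fun do rewrite Im_mul; apply: L1D; exact: continuousM_L1.
Qed.

Lemma CL1Z c f : CL1 f -> CL1 (fun x => c * f x).
Proof. by move=> f1; apply: ccontM_CL1 => //; exact: ccont_cst. Qed.

Lemma eq_CE f g : f =1 g -> CE f = CE g.
Proof. by move=> /funext ->. Qed.

Lemma CED f g : CL1 f -> CL1 g -> CE (fun x => f x + g x) = CE f + CE g.
Proof.
move=> [rf jf] [rg jg]; apply: eq_ReIm; rewrite ?Re_add ?Im_add !(Re_CE, Im_CE).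
  by under eq_mean do rewrite Re_add; rewrite meanD.
by under eq_mean do rewrite Im_add; rewrite meanD.
Qed.

Lemma CEZ c f : CL1 f -> CE (fun x => c * f x) = c * CE f.
Proof.
move=> [rf jf]; apply: eq_ReIm; rewrite ?Re_mul ?Im_mul !(Re_CE, Im_CE).
  by under eq_mean do rewrite Re_mul; rewrite meanB ?meanZ//; exact: L1Z.
by under eq_mean do rewrite Im_mul; rewrite meanD ?meanZ//; exact: L1Z.
Qed.

Lemma CEN f : CL1 f -> CE (fun x => - f x) = - CE f.
Proof.
by move=> f1; under eq_CE do rewrite -mulN1r; rewrite CEZ// mulN1r.
Qed.

Lemma CEB f g : CL1 f -> CL1 g -> CE (fun x => f x - g x) = CE f - CE g.
Proof. by move=> f1 g1; rewrite CED ?CEN//; exact: CL1N. Qed.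

Lemma CE_cst c : CE (fun=> c) = c.
Proof. by apply: eq_ReIm; rewrite /= mean_cst. Qed.

Lemma CE_conj f : CL1 f -> CE (fun x => (f x)^*) = (CE f)^*.
Proof.
move=> [rf jf]; apply: eq_ReIm; rewrite ?Re_cj ?Im_cj !(Re_CE, Im_CE).
  by under eq_mean do rewrite Re_cj.
by under eq_mean do rewrite Im_cj; rewrite meanN.
Qed.

Lemma CE_shift a f : ccont f -> CE (fun x => f (x + a)) = CE f.
Proof.
move=> [rf jf]; apply: eq_ReIm => /=.
  exact: (@mean_shift a (fun x => complex.Re (f x))).
exact: (@mean_shift a (fun x => complex.Im (f x))).
Qed.

Lemma CE_opp f : ccont f -> CE (fun x => f (- x)) = CE f.
Proof.
move=> [rf jf]; apply: eq_ReIm => /=.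
  exact: (@mean_opp (fun x => complex.Re (f x))).
exact: (@mean_opp (fun x => complex.Im (f x))).
Qed.

Lemma CE_reflect a f : ccont f -> CE (fun x => f (a - x)) = CE f.
Proof.
move=> cf; rewrite -(@CE_shift a f)//.
rewrite -(@CE_opp (fun x => f (x + a))); last first.
  by apply: (@ccont_comp _ _ _ f (fun x => x + a)) => //; exact: shift_continuous.
by apply: eq_CE => x; rewrite addrC.
Qed.

Lemma cabs_measurable (f : G -> R[i]) :
  measurable_fun [set: T] (fun x : T => complex.Re (f x)) ->
  measurable_fun [set: T] (fun x : T => complex.Im (f x)) ->
  measurable_fun [set: T] (fun x : T => cabs (f x)).
Proof.
move=> rf jf; apply: (measurableT_comp (f := @Num.sqrt R)).
  by apply: continuous_measurable_fun; exact: sqrt_continuous.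
by apply: measurable_funD; apply: measurable_funX.
Qed.

Lemma CL1_cabs f : CL1 f -> L1 (fun x => cabs (f x)).
Proof.
move=> [rf jf]; apply: (le_integrable measurableT _ _ (L1D (L1_norm rf) (L1_norm jf))).
  apply/measurable_EFinP; apply: cabs_measurable; exact: L1_measurable.
move=> x _; rewrite /= lee_fin ger0_norm ?cabs_ge0// ger0_norm ?addr_ge0//.
exact: cabs_ReIm.
Qed.

Lemma cabs_CE f : CL1 f -> cabs (CE f) <= mean (fun x => cabs (f x)).
Proof.
move=> f1; have [z0|z0] := eqVneq (CE f) 0.
  by rewrite z0 cabs0 mean_ge0// => x; exact: cabs_ge0.
set z := CE f in z0 *.
have cz0 : 0 < cabs z.
  rewrite lt_neqAle cabs_ge0 andbT eq_sym; apply/eqP => /cabs_eq0.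
  exact/eqP.
(* The unit scalar [u] rotates the mean onto the positive half-line, where its modulus is the mean
   of the real part of [u * f]. *)
pose u : R[i] := z^* * ((cabs z)^-1)%:C%C.
have cu : cabs u = 1.
  rewrite cabsM cabs_conj cabsr ger0_norm ?invr_ge0 ?cabs_ge0// mulfV//.
  by rewrite gt_eqF.
have -> : cabs z = complex.Re (CE (fun x => u * f x)).
  rewrite CEZ// -/z /u mulrAC [z^* * z]mulrC -sqr_cabsE -rmorphM/=.
  by rewrite expr2 -mulrA mulfV ?mulr1// gt_eqF.
rewrite /CE/=; have [uf _] : CL1 (fun x => u * f x) by exact: CL1Z.
apply: le_mean => //; first exact: CL1_cabs.
move=> x; rewrite (le_trans (ler_norm _))// (le_trans (normRe_cabs _))//.
by rewrite cabsM cu mul1r.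
Qed.

Lemma cabs_CE_le f M : CL1 f -> (forall x, cabs (f x) <= M) -> cabs (CE f) <= M.
Proof.
move=> f1 fM; rewrite (le_trans (cabs_CE f1))// -[leRHS]mean_cst.
apply: le_mean => //; first exact: CL1_cabs.
by apply: continuous_L1 => x; exact: cvg_cst.
Qed.

Let L1_slice (H : G * G -> R) (k : G -> R) x : continuous H -> L1 k ->
  L1 (fun y => H (x, y) * k y).
Proof. by move=> cH; apply: continuousM_L1; exact: continuous2_l. Qed.

(** Splitting into four real products lets [mean_continuous] and [mean_fubini] be applied term by
    term. *)
Lemma CE_sliceE (F : G * G -> R[i]) (h : G -> R[i]) x : ccont F -> CL1 h ->
  CE (fun y => F (x, y) * h y) = Complex
    (mean (fun y => complex.Re (F (x, y)) * complex.Re (h y)) -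
     mean (fun y => complex.Im (F (x, y)) * complex.Im (h y)))
    (mean (fun y => complex.Re (F (x, y)) * complex.Im (h y)) +
     mean (fun y => complex.Im (F (x, y)) * complex.Re (h y))).
Proof.
move=> [rF jF] [rh jh]; apply: eq_ReIm; rewrite !(Re_CE, Im_CE) [RHS]/=.
  under eq_mean do rewrite Re_mul.
  by rewrite meanB//; [exact: (L1_slice x rF rh)|exact: (L1_slice x jF jh)].
under eq_mean do rewrite Im_mul.
by rewrite meanD//; [exact: (L1_slice x rF jh)|exact: (L1_slice x jF rh)].
Qed.

Lemma CE_continuous (F : G * G -> R[i]) (h : G -> R[i]) : ccont F -> CL1 h ->
  ccont (fun x => CE (fun y => F (x, y) * h y)).
Proof.
move=> cF h1; under eq_fun do rewrite CE_sliceE//.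
move: cF h1 => [rF jF] [rh jh]; split=> /= x.
  by apply: cvgB; [exact: (mean_continuous rF rh)|exact: (mean_continuous jF jh)].
by apply: cvgD; [exact: (mean_continuous rF jh)|exact: (mean_continuous jF rh)].
Qed.

Lemma CE_fubini (F : G * G -> R[i]) (h : G -> R[i]) : ccont F -> CL1 h ->
  CE (fun x => CE (fun y => F (x, y) * h y)) =
  CE (fun y => CE (fun x => F (x, y)) * h y).
Proof.
move=> cF h1; under eq_CE do rewrite CE_sliceE//.
move: cF h1 => [rF jF] [rh jh].
have L11 : L1 (fun=> 1) by apply: continuous_L1 => x; exact: cvg_cst.
have l2 (H : G * G -> R) (k : G -> R) : continuous H -> L1 k ->
    L1 (fun y => mean (fun x => H (x, y)) * k y).
  move=> cH; apply: continuousM_L1.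
  have cH' : continuous (fun z : G * G => H (z.2, z.1)).
    move=> z; apply: (@continuous_comp _ _ _ (fun z : G * G => (z.2, z.1)) H).
      by apply: cvg_pair; [exact: cvg_snd|exact: cvg_fst].
    exact: cH.
  have := mean_continuous cH' L11.
  by under eq_fun do under eq_mean do rewrite mulr1.
have l3 (H : G * G -> R) (k : G -> R) : continuous H -> L1 k ->
    L1 (fun x => mean (fun y => H (x, y) * k y)).
  by move=> cH k1; apply: continuous_L1; exact: mean_continuous.
apply: eq_ReIm; rewrite !(Re_CE, Im_CE) [in LHS]/=.
  under [RHS]eq_mean do rewrite Re_mul !(Re_CE, Im_CE).
  rewrite meanB; [|exact: (l3 _ _ rF rh)|exact: (l3 _ _ jF jh)].
  rewrite meanB; [|exact: (l2 _ _ rF rh)|exact: (l2 _ _ jF jh)].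
  by rewrite (mean_fubini rF rh) (mean_fubini jF jh).
under [RHS]eq_mean do rewrite Im_mul !(Re_CE, Im_CE).
rewrite meanD; [|exact: (l3 _ _ rF jh)|exact: (l3 _ _ jF rh)].
rewrite meanD; [|exact: (l2 _ _ rF jh)|exact: (l2 _ _ jF rh)].
by rewrite (mean_fubini rF jh) (mean_fubini jF rh).
Qed.

(** * Square means and the Cauchy-Schwarz inequality *)

Definition N2 (f : G -> R[i]) : R := mean (fun x => cabs (f x) ^+ 2).

Lemma sqr_cabs_continuous (f : G -> R[i]) : ccont f ->
  continuous (fun x => cabs (f x) ^+ 2).
Proof.
move=> cf x; apply: (@continuous_comp _ _ _ (fun x => cabs (f x)) (fun t : R => t ^+ 2)).
  exact: ccont_cabs.
exact: exprn_continuous.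
Qed.

Lemma N2_ge0 f : 0 <= N2 f.
Proof. by apply: mean_ge0 => x; exact: sqr_ge0. Qed.

Lemma N2E f : ccont f -> (N2 f)%:C%C = CE (fun x => f x * (f x)^*).
Proof.
move=> cf; apply: eq_ReIm => /=.
  by apply: eq_mean => x; rewrite -sqr_cabsE.
rewrite -(mean_cst 0); apply: eq_mean => x; rewrite -sqr_cabsE//.
Qed.

Lemma N2_eq0 f : ccont f -> N2 f = 0 -> forall x, f x = 0.
Proof.
move=> cf N0 x; apply: cabs_eq0; apply/eqP; rewrite -sqrf_eq0; apply/eqP.
apply: (@mean_faithful (fun x => cabs (f x) ^+ 2)) => //.
  exact: sqr_cabs_continuous.
by move=> y; exact: sqr_ge0.
Qed.

Lemma N2_reflect a f : ccont f -> N2 (fun y => f (a - y)) = N2 f.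
Proof.
move=> cf; have c2 := sqr_cabs_continuous cf.
have c3 : continuous (fun x => cabs (f (x + a)) ^+ 2).
  move=> x; apply: (@continuous_comp _ _ _ (fun x => x + a) (fun x => cabs (f x) ^+ 2)).
    exact: shift_continuous.
  exact: c2.
rewrite /N2 -(mean_shift a c2) -(mean_opp c3).
by apply: eq_mean => x; rewrite addrC.
Qed.

Lemma N2_le f M : ccont f -> (forall x, cabs (f x) <= M) -> N2 f <= M ^+ 2.
Proof.
move=> cf fM; rewrite -[leRHS]mean_cst; apply: le_mean.
- by apply: continuous_L1; exact: sqr_cabs_continuous.
- by apply: continuous_L1 => x; exact: cvg_cst.
- by move=> x; rewrite lerXn2r// nnegrE (cabs_ge0, le_trans (cabs_ge0 (f x))).
Qed.

Let expand_sqr (q : R) (a b z : R[i]) :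
  (q%:C%C * a - z * b^*) * (q%:C%C * a - z * b^*)^* =
  (q ^+ 2)%:C%C * (a * a^*) + (z * z^*) * (b * b^*) - (q%:C%C * z^*) * (a * b)
  - (q%:C%C * z) * (a * b)^*.
Proof.
by case: a b z => [a1 a2] [b1 b2] [z1 z2]; apply: eq_ReIm => /=; ring.
Qed.

Let collect_sqr (q p : R) (z : R[i]) :
  (q ^+ 2)%:C%C * p%:C%C + (z * z^*) * q%:C%C - (q%:C%C * z^*) * z
  - (q%:C%C * z) * z^* = (q * (q * p - cabs z ^+ 2))%:C%C.
Proof. by rewrite sqr_cabs; case: z => [z1 z2]; apply: eq_ReIm => /=; ring. Qed.

(** The pairing is bilinear, hence the conjugate of [g] in [h]: with [Q = N2 g], [h] is [Q] times
    the component of [f] orthogonal to that conjugate. Expanding [N2 h] gives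
    [Q * (Q * P - cabs z ^+ 2) >= 0]; scaling by [Q] avoids a division. *)
Lemma cauchy_schwarz f g : ccont f -> ccont g ->
  cabs (CE (fun x => f x * g x)) ^+ 2 <= N2 f * N2 g.
Proof.
move=> cf cg; set z := CE _.
have [g0|g0] := eqVneq (N2 g) 0.
  have -> : z = 0.
    by rewrite -(CE_cst 0); apply: eq_CE => x; rewrite (N2_eq0 cg g0) mulr0.
  by rewrite g0 cabs0 expr0n mulr0.
have Qp : 0 < N2 g by rewrite lt_neqAle eq_sym g0 N2_ge0.
set P := N2 f; set Q := N2 g in g0 Qp *.
pose h x := Q%:C%C * f x - z * (g x)^*.
have ch : ccont h.
  by apply: ccontB; apply: ccontZ => //; exact: ccont_conj.
have := N2_ge0 h; rewrite -lecR N2E//.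
have -> : CE (fun x => h x * (h x)^*) = (Q * (Q * P - cabs z ^+ 2))%:C%C.
  have c1 : CL1 (fun x => f x * (f x)^*).
    by apply: ccont_CL1; apply: ccontM => //; exact: ccont_conj.
  have c2 : CL1 (fun x => g x * (g x)^*).
    by apply: ccont_CL1; apply: ccontM => //; exact: ccont_conj.
  have c3 : CL1 (fun x => f x * g x) by apply: ccont_CL1; exact: ccontM.
  have c4 : CL1 (fun x => (f x * g x)^*).
    by apply: ccont_CL1; apply: ccont_conj; exact: ccontM.
  have z1 := CL1Z ((Q ^+ 2)%:C%C) c1; have z2 := CL1Z (z * z^*) c2.
  have z3 := CL1Z (Q%:C%C * z^*) c3; have z4 := CL1Z (Q%:C%C * z) c4.
  under eq_CE do rewrite expand_sqr.
  rewrite CEB ?CEB ?CED//; [|exact: CL1D|by apply: CL1B => //; exact: CL1D].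
  by rewrite !CEZ// CE_conj// -/z -!N2E// collect_sqr.
by rewrite lecR pmulr_rge0// subr_ge0 mulrC.
Qed.

(** * The convolution algebra *)

Implicit Types (f g h k : G -> R[i]) (x y : G).

(** The translated factor is the left one: when it is continuous, the right one may be merely
    integrable. *)
Definition conv (f g : G -> R[i]) (x : G) : R[i] := CE (fun y => f (x - y) * g y).

(** The involution of the group algebra: convolution by [star f] is the L^2 adjoint of convolution
    by [f]. *)
Definition star (f : G -> R[i]) (x : G) : R[i] := (f (- x))^*.

Lemma ccont_sub (f : G -> R[i]) : ccont f -> ccont (fun z : G * G => f (z.1 - z.2)).
Proof.
by move=> cf; exact: (ccont_comp cf (@sub_continuous G)).
Qed.

Lemma ccont_reflect (f : G -> R[i]) a : ccont f -> ccont (fun x => f (a - x)).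
Proof. by move=> cf; exact: (ccont_comp cf (@opp_shift_continuous a)). Qed.

Lemma ccont_shift (f : G -> R[i]) a : ccont f -> ccont (fun x => f (x + a)).
Proof. by move=> cf; exact: (ccont_comp cf (@shift_continuous a)). Qed.

Lemma ccont_star f : ccont f -> ccont (star f).
Proof.
move=> cf; apply: ccont_conj; exact: (ccont_comp cf (@opp_continuous G)).
Qed.

Lemma ccont_conv f g : ccont f -> CL1 g -> ccont (conv f g).
Proof. by move=> cf g1; exact: (CE_continuous (ccont_sub cf) g1). Qed.

Lemma ccont_convM f g x : ccont f -> ccont g -> ccont (fun y => f (x - y) * g y).
Proof. by move=> cf cg; apply: ccontM => //; exact: ccont_reflect. Qed.

Lemma convM_CL1 f g x : ccont f -> CL1 g -> CL1 (fun y => f (x - y) * g y).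
Proof. by move=> cf cg; apply: ccontM_CL1 => //; exact: ccont_reflect. Qed.

Lemma convC f g : ccont f -> ccont g -> conv f g = conv g f.
Proof.
move=> cf cg; apply/funext => x; rewrite /conv.
rewrite -(CE_reflect x (ccont_convM x cf cg)); apply: eq_CE => y.
by rewrite subKr mulrC.
Qed.

Lemma convA f g h : ccont f -> ccont g -> CL1 h ->
  conv f (conv g h) = conv (conv f g) h.
Proof.
move=> cf cg h1; apply/funext => x; rewrite /conv.
pose F (z : G * G) := f (x - z.1) * g (z.1 - z.2).
have cF : ccont F.
  apply: ccontM; last exact: ccont_sub.
  apply: (ccont_comp (ccont_reflect x cf) (h := fst)) => z; exact: cvg_fst.
transitivity (CE (fun y => CE (fun z => F (y, z) * h z))).
  apply: eq_CE => y; rewrite -CEZ; last exact: convM_CL1.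
  by apply: eq_CE => z; rewrite mulrA.
rewrite (CE_fubini cF h1); apply: eq_CE => z; congr (_ * _).
have cFz : ccont (fun y => F (y, z)).
  exact: (ccontM (ccont_reflect x cf) (ccont_shift (- z) cg)).
rewrite -(CE_shift z cFz); apply: eq_CE => y.
by rewrite /F/= addrK opprD addrA [x - y - z]addrAC.
Qed.

Lemma star_conv f g : ccont f -> ccont g -> star (conv f g) = conv (star f) (star g).
Proof.
move=> cf cg; apply/funext => x; rewrite /star /conv -CE_conj; last first.
  by apply: ccont_CL1; exact: ccont_convM.
rewrite -CE_opp; last by apply: ccont_conj; exact: ccont_convM.
by apply: eq_CE => y; rewrite opprK rmorphM opprB addrC.
Qed.

Lemma starK f : star (star f) = f.
Proof. by apply/funext => x; rewrite /star opprK conjCK. Qed.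

(** Cauchy-Schwarz applied to the reflected translate of [f]. Through this bound, control in square
    mean becomes uniform control. *)
Lemma conv_sqr_le f g x : ccont f -> ccont g ->
  cabs (conv f g x) ^+ 2 <= N2 f * N2 g.
Proof.
move=> cf cg; rewrite /conv -(N2_reflect x cf).
exact: (cauchy_schwarz (ccont_reflect x cf) cg).
Qed.

Lemma cabs_conv_le f g A B x : ccont f -> ccont g -> (forall x, cabs (f x) <= A) ->
  (forall x, cabs (g x) <= B) -> cabs (conv f g x) <= A * B.
Proof.
move=> cf cg fA gB; apply: cabs_CE_le.
  by apply: ccont_CL1; exact: ccont_convM.
by move=> y; rewrite cabsM ler_pM// cabs_ge0.
Qed.

Lemma conv_self f : ccont f -> star f = f -> conv f f 0 = (N2 f)%:C%C.
Proof.
move=> cf sf; rewrite N2E//; apply: eq_CE => y.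
by rewrite sub0r -[in f (- y)]sf /star opprK mulrC.
Qed.

Lemma convDr f g h : ccont f -> CL1 g -> CL1 h ->
  conv f (fun x => g x + h x) = fun x => conv f g x + conv f h x.
Proof.
move=> cf g1 h1; apply/funext => x; rewrite /conv.
rewrite -(CED (convM_CL1 x cf g1) (convM_CL1 x cf h1)).
by apply: eq_CE => y; rewrite mulrDr.
Qed.

Lemma convZr c f g : ccont f -> CL1 g ->
  conv f (fun x => c * g x) = fun x => c * conv f g x.
Proof.
move=> cf g1; apply/funext => x; rewrite /conv -(CEZ c (convM_CL1 x cf g1)).
by apply: eq_CE => y; rewrite mulrCA.
Qed.

Lemma convZl c f g : ccont f -> ccont g ->
  conv (fun x => c * f x) g = fun x => c * conv f g x.
Proof.
move=> cf cg; rewrite convC//; last exact: ccontZ.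
by rewrite convZr ?(convC cg cf)//; exact: ccont_CL1.
Qed.

Lemma convDl f g h : ccont f -> ccont g -> ccont h ->
  conv (fun x => f x + g x) h = fun x => conv f h x + conv g h x.
Proof.
move=> cf cg ch; rewrite convC//; last exact: ccontD.
by rewrite convDr ?(convC ch)//; exact: ccont_CL1.
Qed.

Lemma convBr f g h : ccont f -> CL1 g -> CL1 h ->
  conv f (fun x => g x - h x) = fun x => conv f g x - conv f h x.
Proof.
move=> cf g1 h1; rewrite convDr//; last exact: CL1N.
rewrite (_ : (fun x => - h x) = fun x => -1 * h x); last first.
  by apply/funext => x; rewrite mulN1r.
by rewrite convZr//; apply/funext => x; rewrite mulN1r.
Qed.

Lemma convBl f g h : ccont f -> ccont g -> ccont h ->
  conv (fun x => f x - g x) h = fun x => conv f h x - conv g h x.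
Proof.
move=> cf cg ch; rewrite convC//; last exact: ccontB.
by rewrite convBr ?(convC ch)//; exact: ccont_CL1.
Qed.

Lemma ccont_bounded f : ccont f -> exists2 A, 0 < A & forall x, cabs (f x) <= A.
Proof.
move=> cf; have [M M0 fM] := continuous_bounded (ccont_cabs cf).
by exists M => // x; rewrite (le_trans (ler_norm _)).
Qed.

(** * Uniform convergence *)

Lemma eq_cabs_small (z w : R[i]) : (forall e, 0 < e -> cabs (z - w) <= e) -> z = w.
Proof.
move=> h; apply/eqP; rewrite -subr_eq0; apply/eqP; apply: cabs_eq0.
apply/eqP; rewrite eq_le cabs_ge0 andbT; apply/ler_addgt0Pr => e e0.
by rewrite add0r h.
Qed.

Definition ucvg (u : nat -> G -> R[i]) v := forall e, 0 < e ->
  exists N, forall n, (N <= n)%N -> forall x, cabs (u n x - v x) <= e.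

Lemma ucvg_unique u v w : ucvg u v -> ucvg u w -> v = w.
Proof.
move=> uv uw; apply/funext => x; apply: eq_cabs_small => e e0.
have e2 : 0 < e / 2 by rewrite divr_gt0.
have [N hN] := uv _ e2; have [M hM] := uw _ e2.
have := hN (maxn N M) (leq_maxl _ _) x.
have := hM (maxn N M) (leq_maxr _ _) x.
set t := u _ _ => tw tv; have -> : v x - w x = - (t - v x) + (t - w x) by ring.
by rewrite (le_trans (cabsD _ _))// cabsN [leRHS]splitr lerD.
Qed.

Lemma ucvg_cst v : ucvg (fun=> v) v.
Proof. by move=> e e0; exists 0%N => n _ x; rewrite subrr cabs0 ltW. Qed.

Lemma ucvg_shift u v (s : nat -> nat) : (forall n, (n <= s n)%N) -> ucvg u v ->
  ucvg (fun n => u (s n)) v.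
Proof.
move=> hs uv e /uv[N hN]; exists N => n Nn; apply: hN.
exact: leq_trans Nn (hs n).
Qed.

Lemma ucvg_star u v : ucvg u v -> ucvg (fun n => star (u n)) (star v).
Proof.
move=> uv e /uv[N hN]; exists N => n Nn x; rewrite /star -rmorphB cabs_conj.
exact: hN.
Qed.

Lemma ucvg_conv f u v : ccont f -> (forall n, ccont (u n)) -> ccont v ->
  ucvg u v -> ucvg (fun n => conv f (u n)) (conv f v).
Proof.
move=> cf cu cv uv e e0; have [A A0 fA] := ccont_bounded cf.
have [N hN] := uv (e / A) (divr_gt0 e0 A0); exists N => n Nn x.
have /(congr1 (fun h => h x)) <- := convBr cf (ccont_CL1 (cu n)) (ccont_CL1 cv).
have := cabs_conv_le x cf (ccontB (cu n) cv) fA (hN n Nn).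
by rewrite mulrCA mulfV ?mulr1// gt_eqF.
Qed.

Lemma uniform_limitR (u : nat -> G -> R) : (forall n, continuous (u n)) ->
  (forall e, 0 < e -> exists N, forall n m, (N <= n)%N -> (N <= m)%N ->
    forall x, `|u n x - u m x| <= e) ->
  exists2 v : G -> R, continuous v & forall e, 0 < e ->
    exists N, forall n, (N <= n)%N -> forall x, `|u n x - v x| <= e.
Proof.
move=> cu cauchy_u.
have cvgu x : cvgn (u^~ x).
  apply: cauchy_cvg; apply: cauchy_exP => e e0.
  have e2 : 0 < e / 2 by rewrite divr_gt0.
  have [N hN] := cauchy_u _ e2; exists (u N x); exists N => // n /= Nn.
  by rewrite /ball/= (le_lt_trans (hN N n _ _ x))// ltr_pdivrMr// ltr_pMr// ltr1n.
pose v x := limn (u^~ x).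
have uv e : 0 < e -> exists N, forall n, (N <= n)%N -> forall x, `|u n x - v x| <= e.
  move=> e0; have [N hN] := cauchy_u _ e0; exists N => n Nn x.
  apply/ler_addgt0Pr => d d0.
  have /cvgrPdist_le/(_ _ d0)[M _ hM] := cvgu x.
  have := hM (maxn N M) (leq_maxr _ _); rewrite -/(v x) distrC => h.
  rewrite (le_trans (ler_distD (u (maxn N M) x) _ _))// lerD//.
  by apply: hN => //; exact: leq_maxl.
exists v => // a; apply/cvgrPdist_le => e e0.
have e3 : 0 < e / 3 by rewrite divr_gt0.
have [N hN] := uv _ e3.
have /cvgrPdist_le/(_ _ e3) := cu N a.
apply: filterS => x hx.
have -> : v a - v x = (v a - u N a) + (u N a - u N x) + (u N x - v x) by ring.
have -> : e = e / 3 + e / 3 + e / 3 by field.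
rewrite (le_trans (ler_normD _ _))// lerD//; last exact: hN.
by rewrite (le_trans (ler_normD _ _))// lerD// distrC; exact: hN.
Qed.

Lemma uniform_limit (u : nat -> G -> R[i]) : (forall n, ccont (u n)) ->
  (forall e, 0 < e -> exists N, forall n m, (N <= n)%N -> (N <= m)%N ->
    forall x, cabs (u n x - u m x) <= e) ->
  exists2 v, ccont v & ucvg u v.
Proof.
move=> cu cauchy_u.
have [||v1 cv1 uv1] := @uniform_limitR (fun n x => complex.Re (u n x)).
- by move=> n; have [] := cu n.
- move=> e /cauchy_u[N hN]; exists N => n m Nn Nm x.
  by rewrite -Re_opp -Re_add (le_trans (normRe_cabs _))// hN.
have [||v2 cv2 uv2] := @uniform_limitR (fun n x => complex.Im (u n x)).
- by move=> n; have [] := cu n.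
- move=> e /cauchy_u[N hN]; exists N => n m Nn Nm x.
  by rewrite -Im_opp -Im_add (le_trans (normIm_cabs _))// hN.
exists (fun x => Complex (v1 x) (v2 x)) => // e e0.
have e2 : 0 < e / 2 by rewrite divr_gt0.
have [N hN] := uv1 _ e2; have [M hM] := uv2 _ e2.
exists (maxn N M) => n; rewrite geq_max => /andP[Nn Mn] x.
rewrite (le_trans (cabs_ReIm _))// Re_add Im_add Re_opp Im_opp/= [leRHS]splitr.
by rewrite lerD ?hN ?hM.
Qed.

(** * Convolution powers of a self-adjoint function *)

Section power_iteration.
Variable k : G -> R[i].
Hypotheses (ck : ccont k) (sk : star k = k) (k0 : exists x, k x != 0).

(** [pw n] is the convolution power of order n + 1, whence the successor in [conv_pw]. Below, [Q n]
    is the power of order 2n + 2, and [a n] is both its value at 0 and a bound for its modulus. *)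
Let pw n := iter n (conv k) k.

Let ccont_pw n : ccont (pw n).
Proof. by elim: n => // n IH; apply: ccont_conv => //; exact: ccont_CL1. Qed.

Let CL1_pw n : CL1 (pw n).
Proof. exact: ccont_CL1. Qed.

Let star_pw n : star (pw n) = pw n.
Proof.
elim: n => // n IH; have := star_conv ck (ccont_pw n); rewrite sk IH; exact.
Qed.

Let conv_pw n m : conv (pw n) (pw m) = pw (n + m).+1.
Proof.
by elim: n => // n IH; have := convA ck (ccont_pw n) (CL1_pw m); rewrite IH => <-.
Qed.

Let a n := N2 (pw n).

Let Q n := conv (pw n) (pw n).

Let Q0 n : Q n 0 = (a n)%:C%C.
Proof. exact: conv_self. Qed.

Let QE n : Q n = pw (n + n).+1.
Proof. exact: conv_pw. Qed.

Let ccont_Q n : ccont (Q n).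
Proof. by rewrite QE. Qed.

Let conv_Q n m : conv (Q n) (Q m) = Q (n + m).+1.
Proof. by rewrite !QE conv_pw; congr (pw _); rewrite addSn !addnS addnACA. Qed.

Let cabs_Q n x : cabs (Q n x) <= a n.
Proof.
rewrite -(@ler_pXn2r _ 2) ?nnegrE ?cabs_ge0 ?N2_ge0//.
by rewrite [leRHS]expr2; exact: conv_sqr_le.
Qed.

(** A self-adjoint element is not nilpotent: if [pw n.+1] vanished, so would all later powers, among
    them [Q n], whose value at 0 is [N2 (pw n)]. *)
Let a_neq0 n : a n != 0.
Proof.
suff pn : exists x, pw n x != 0.
  by apply/eqP => /(N2_eq0 (ccont_pw n)) p0; have [x] := pn; rewrite p0 eqxx.
elim: n => // n [x pnx]; apply: contrapT => h.
have p0 y : pw n.+1 y = 0.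
  by apply/eqP; apply/negPn/negP => py; apply: h; exists y.
have pj j y : pw (j + n.+1) y = 0.
  elim: j y => [//|j IH y].
  rewrite addSn -(CE_cst 0) [LHS]/(CE (fun t => k (y - t) * pw (j + n.+1) t)).
  by apply: eq_CE => t; rewrite IH mulr0.
have : a n = 0 by apply: (@complexI R); rewrite -Q0 QE -addnS pj.
by move=> /(N2_eq0 (ccont_pw n)) pn0; rewrite pn0 eqxx in pnx.
Qed.

Let a_gt0 n : 0 < a n.
Proof. by rewrite lt_neqAle eq_sym a_neq0 N2_ge0. Qed.

(** The product of [pw n] and [pw n.+2] is [Q n.+1], so Cauchy-Schwarz at 0 is the inequality. *)
Let a_logconvex n : a n.+1 ^+ 2 <= a n * a n.+2.
Proof.
have <- : cabs (conv (pw n) (pw n.+2) 0) = a n.+1.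
  rewrite conv_pw !addnS -addSn -addnS -QE Q0 cabsr ger0_norm//; exact: N2_ge0.
exact: conv_sqr_le.
Qed.

Let a_submul n m : a (n + m).+1 <= a n * a m.
Proof.
have <- : cabs (conv (Q n) (Q m) 0) = a (n + m).+1.
  by rewrite conv_Q Q0 cabsr ger0_norm//; exact: N2_ge0.
by apply: cabs_conv_le.
Qed.

(** Spectrally, [r] is the largest eigenvalue of convolution by [conv k k] and [e] is the kernel of
    the projection onto its eigenspace. The last clause keeps [e] inside the ideal of any [e0] that
    fixes [k]. *)
Lemma idempotent_limit : exists (r : R) (e : G -> R[i]),
  [/\ 0 < r, ccont e, star e = e, conv e e = e & e 0 != 0] /\
  conv (conv k k) e = (fun x => r%:C%C * e x) /\
  forall e0, ccont e0 -> conv e0 k = k -> conv e0 e = e.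
Proof.
have [r [d [r0 d1 bd]]] := logconvex_ratio_limit a_gt0 a_logconvex a_submul.
pose b n := a n / r ^+ n.+1.
pose c n : R[i] := ((r ^+ n.+1)^-1)%:C%C.
pose u n x := c n * Q n x.
have cu n : ccont (u n) by exact: ccontZ.
have u1 n : CL1 (u n) by exact: ccont_CL1.
have u0 n : u n 0 = (b n)%:C%C by rewrite /u Q0 -rmorphM/= mulrC.
have su n : star (u n) = u n.
  have cc : (c n)^* = c n by exact: conjc_real.
  have sQ : star (Q n) = Q n by rewrite QE star_pw.
  by apply/funext => x; rewrite -[in RHS]/(u n x) /u -[in RHS]sQ /star rmorphM/= cc.
have cuu n m : conv (u n) (u m) = u (n + m).+1.
  rewrite /u convZl//; last exact: cu.
  rewrite convZr//; last exact: ccont_CL1.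
  apply/funext => x; rewrite conv_Q mulrA; congr (_ * _).
  by rewrite /c -rmorphM/= -invfM -exprD addSn addnS.
(* Square distances between the [u n] are combinations of values of [b], so convergence of the real
   sequence [b] makes [u] Cauchy in square mean. *)
have Nu n m : N2 (fun x => u n x - u m x) = b (n + n).+1 - b (n + m).+1 *+ 2 + b (m + m).+1.
  have cd : ccont (fun x => u n x - u m x) by exact: ccontB.
  apply: (@complexI R); rewrite -conv_self//; last first.
    by apply/funext => x; rewrite /star rmorphB -[in RHS]su -[in RHS](su m).
  rewrite convBl// convBr// convBr// !cuu !u0 [(m + n)%N]addnC.
  by rewrite rmorphD rmorphB rmorphMn/=; ring.
have [e ce ue] : exists2 v, ccont v & ucvg u v.
  (* The shift by one is what makes convergence uniform: [u n.+1] is the convolution of [u 0] with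
     [u n], and [conv_sqr_le] applies. *)
  suff [v cv uv] : exists2 v, ccont v & ucvg (fun n => u n.+1) v.
    exists v => // eps /uv[N hN]; exists N.+1 => -[//|n] Nn x; exact: hN.
  apply: uniform_limit => // eps eps0.
  have C0 : 0 < N2 (u 0%N) + 1 by rewrite ltr_wpDl// N2_ge0.
  (* The four occurrences of [b] in [Nu], counted with multiplicity, each deviate from [d] by at
     most [dl], and their limits cancel; hence the factor 4. *)
  pose dl := eps ^+ 2 / (N2 (u 0%N) + 1) / 4.
  have dl0 : 0 < dl by rewrite !divr_gt0// exprn_gt0.
  have /cvgrPdist_le/(_ _ dl0)[N _ hN] := bd.
  have bN j : (N <= j)%N -> `|d - b j| <= dl by exact: hN.
  exists N => n m Nn Nm x.
  have Nnm : N2 (fun x => u n x - u m x) <= dl * 4.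
    have h1 := bN (n + n).+1 (leq_trans Nn (leqW (leq_addr _ _))).
    have h2 := bN (n + m).+1 (leq_trans Nn (leqW (leq_addr _ _))).
    have h3 := bN (m + m).+1 (leq_trans Nm (leqW (leq_addr _ _))).
    move: h1 h2 h3; rewrite !ler_norml Nu mulr2n => /andP[? ?] /andP[? ?] /andP[? ?].
    lra.
  rewrite -(@ler_pXn2r _ 2) ?nnegrE ?cabs_ge0 ?(ltW eps0)//.
  have -> : u n.+1 x - u m.+1 x = conv (u 0%N) (fun x => u n x - u m x) x.
    by rewrite convBr// !cuu.
  rewrite (le_trans (conv_sqr_le _ _ (ccontB (cu n) (cu m))))//.
  rewrite (le_trans (ler_wpM2l (N2_ge0 _) Nnm))//.
  have -> : N2 (u 0%N) * (dl * 4) = eps ^+ 2 * (N2 (u 0%N) / (N2 (u 0%N) + 1)).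
    by rewrite /dl; field; rewrite gt_eqF.
  by rewrite ler_piMr ?sqr_ge0// ler_pdivrMr// mul1r lerDl.
(* Let m tend to infinity in [conv (u n) (u m) = u (n + m).+1]. *)
have cue n : conv (u n) e = e.
  apply: (ucvg_unique (ucvg_conv (cu n) cu ce ue)).
  under [X in ucvg X]eq_fun do rewrite cuu.
  by apply: ucvg_shift ue => m; rewrite leqW// leq_addl.
exists r, e; split; [split=> //|split].
- apply: (ucvg_unique (ucvg_star ue)).
  by under [X in ucvg X]eq_fun do rewrite su.
- apply: (ucvg_unique (ucvg_conv ce cu ce ue)).
  under [X in ucvg X]eq_fun do rewrite convC// cue.
  exact: ucvg_cst.
- apply/eqP => e00.
  have q0 : 0 < 4^-1 :> R by rewrite invr_gt0.
  (* [u n 0] is [b n], which tends to [d >= 1]; tolerances of 1/4 already contradict a limit 0. *)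
  have [N hN] := ue _ q0; have /cvgrPdist_le/(_ _ q0)[M _ hM] := bd.
  have := hN (maxn N M) (leq_maxl _ _) 0; rewrite e00 subr0 u0 cabsr.
  have := hM (maxn N M) (leq_maxr _ _); rewrite -/(b _) !ler_norml.
  by move=> /andP[? ?] /andP[? ?]; lra.
- have := cue 0%N; rewrite /u convZl// => /(congr1 (fun h x => r%:C%C * h x)).
  move=> <-; apply/funext => x; rewrite mulrA /c -rmorphM/= expr1.
  by rewrite mulfV ?gt_eqF// rmorph1 mul1r.
- move=> e0 ce0 e0k.
  have e0pw n : conv e0 (pw n) = pw n.
    by case: n => // n; have := convA ce0 ck (CL1_pw n); rewrite e0k.
  apply: (ucvg_unique (ucvg_conv ce0 cu ce ue)).
  rewrite [X in ucvg X](_ : _ = u)//; apply/funext => n; rewrite /u convZr//.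
    by rewrite QE e0pw.
  exact: ccont_CL1.
Qed.

End power_iteration.

(** * Characters from convolution idempotents *)

Section characters.
Implicit Types (xi phi e : G -> R[i]).

Lemma dual_ccont xi : dual xi -> ccont xi.
Proof. by case. Qed.

Lemma dual_neq0 xi x : dual xi -> xi x != 0.
Proof.
case=> _ c1 _ _; apply/eqP => x0; have := c1 x; rewrite x0 cabs0 => /esym/eqP.
by rewrite oner_eq0.
Qed.

Lemma dual0 xi : dual xi -> xi 0 = 1.
Proof.
move=> dxi; have [xiD _ _ _] := dxi; have := xiD 0 0; rewrite addr0 => h.
by apply: (mulfI (dual_neq0 0 dxi)); rewrite -h mulr1.
Qed.

Lemma dual_opp xi x : dual xi -> xi (- x) = (xi x)^*.
Proof.
move=> dxi; have [xiD c1 _ _] := dxi.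
apply: (mulfI (dual_neq0 x dxi)).
by rewrite -xiD subrr dual0// -sqr_cabsE c1 expr1n rmorph1.
Qed.

Definition idem e : Prop := [/\ ccont e, star e = e, conv e e = e & e 0 != 0].

Lemma idem0 e : idem e -> e 0 = (N2 e)%:C%C.
Proof. by case=> ce se ee _; rewrite -{1}ee conv_self. Qed.

Lemma idem_le e x : idem e -> cabs (e x) <= N2 e.
Proof.
case=> ce se ee _; rewrite -(@ler_pXn2r _ 2) ?nnegrE ?cabs_ge0 ?N2_ge0//.
by rewrite -[in leLHS]ee [leRHS]expr2; exact: conv_sqr_le.
Qed.

(** An idempotent satisfies [|e| <= N2 e] pointwise, so averaging [|e|^2] gives [N2 e <= (N2 e)^2],
    and [N2 e] is positive. *)
Lemma idem_ge1 e : idem e -> 1 <= N2 e.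
Proof.
move=> ie; have [ce _ _ e0] := ie.
have N0 : 0 < N2 e.
  rewrite lt_neqAle N2_ge0 andbT eq_sym; apply: contra e0 => /eqP N0.
  by rewrite idem0// N0 rmorph0.
have := N2_le ce (fun x => idem_le x ie).
by rewrite expr2 -{1}[N2 e]mulr1 ler_pM2l.
Qed.

Lemma idemB e e' : idem e -> idem e' -> conv e e' = e' -> e' <> e ->
  idem (fun x => e x - e' x).
Proof.
move=> [ce se ee e0] [ce' se' ee' e'0] ee1 ne.
have cd : ccont (fun x => e x - e' x) by exact: ccontB.
have sd : star (fun x => e x - e' x) = (fun x => e x - e' x).
  by apply/funext => x; rewrite /star rmorphB -[in RHS]se -[in RHS]se'.
split => //.
  rewrite convBl// !convBr//; [|exact: ccont_CL1..].
  rewrite ee ee1 ee' (convC ce' ce) ee1.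
  by apply/funext => x; rewrite subrr subr0.
(* The value at 0 of the self-adjoint idempotent [e - e'] is its square mean; were it zero, [e']
   would equal [e]. *)
apply/negP => /eqP d0; apply: ne; apply/funext => x; apply/esym/eqP.
rewrite -subr_eq0; apply/eqP; apply: (N2_eq0 cd).
apply: (@complexI R); rewrite rmorph0 -conv_self// -d0.
rewrite convBl// !convBr//; [|exact: ccont_CL1..].
by rewrite ee ee1 ee' (convC ce' ce) ee1 subrr subr0.
Qed.

Section indecomposable.
Variable e : G -> R[i].
Hypothesis ie : idem e.
Hypothesis e_min : forall e', idem e' -> conv e e' = e' -> e' = e.

Let ce : ccont e. Proof. by case: ie. Qed.

(** The idempotent that [idempotent_limit] extracts from [k] is fixed by [e], hence equals [e] by
    minimality; and multiplying [conv k k] by [e] changes nothing. *)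
Let sqr_in_corner k : ccont k -> star k = k -> conv e k = k ->
  exists s : R, conv k k = fun x => s%:C%C * e x.
Proof.
move=> ck sk ek; have [k0|k0] := pselect (exists x, k x != 0).
  have [r [e' [[r0 ce' se' ee' e'0] [kke' e'min]]]] := idempotent_limit ck sk k0.
  have E : e' = e by apply: e_min => //; exact: e'min.
  exists r; rewrite -E -kke' E (convC _ ce); last exact: ccont_conv (ccont_CL1 _).
  by rewrite convA ?ek//; exact: ccont_CL1.
exists 0; apply/funext => x; rewrite rmorph0 mul0r -(CE_cst 0).
apply: eq_CE => y; have [->|ky] := eqVneq (k y) 0; first by rewrite mulr0.
by exfalso; apply: k0; exists y.
Qed.

(* Both k * k and (k + e) * (k + e) = k * k + 2 k + e are multiples of e. *)
Let selfadjoint_in_corner k : ccont k -> star k = k -> conv e k = k ->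
  exists c : R[i], k = fun x => c * e x.
Proof.
move=> ck sk ek; have [_ se ee _] := ie.
have [s hs] := sqr_in_corner ck sk ek.
have [||| s' hs'] := @sqr_in_corner (fun x => k x + e x).
- exact: ccontD.
- by apply/funext => x; rewrite /star rmorphD -[in RHS]sk -[in RHS]se.
- by rewrite convDr ?ek ?ee//; exact: ccont_CL1.
exists ((s' - s - 1)%:C%C / 2); apply/funext => x.
move: hs' => /(congr1 (fun h => h x)).
rewrite convDl//; last exact: ccontD.
rewrite !convDr//; [|exact: ccont_CL1..].
rewrite hs (convC ck ce) ek ee => h.
have -> : k x = (s%:C%C * e x + k x + (k x + e x) - s%:C%C * e x - e x) / 2 by field.
by rewrite h !rmorphB rmorph1; field.
Qed.

(** Apply the self-adjoint case to [h + star h] and to ['i * (h - star h)], from which [h] is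
    recovered linearly. *)
Lemma corner_scalar h : ccont h -> conv e h = h ->
  exists c : R[i], h = fun x => c * e x.
Proof.
move=> ch eh; have [_ se ee _] := ie.
have csh := ccont_star ch.
have esh : conv e (star h) = star h by rewrite -{1}se -star_conv// eh.
have ci : ('i : R[i])^* = - 'i by exact: conjCi.
have [|||c hc] := @selfadjoint_in_corner (fun x => h x + star h x).
- exact: ccontD.
- by apply/funext => x; rewrite {1}/star rmorphD/= -/(star h (- x)) -/(star (star h) x) starK addrC.
- by rewrite convDr ?eh ?esh//; exact: ccont_CL1.
have [|||d hd] := @selfadjoint_in_corner (fun x => 'i * (h x - star h x)).
- by apply: ccontZ; exact: ccontB.
- apply/funext => x; rewrite {1}/star rmorphM/= rmorphB/= ci.
  by rewrite -/(star h x) -/(star (star h) x) starK mulNr -mulrN opprB.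
- rewrite convZr//; last by apply: ccont_CL1; exact: ccontB.
  by rewrite convBr ?eh ?esh//; exact: ccont_CL1.
exists ((c - 'i * d) / 2); apply/funext => x.
move: hc => /(congr1 (fun h => h x)) hc; move: hd => /(congr1 (fun h => h x)) hd.
have -> : h x = (h x + star h x - ('i * 'i) * (h x - star h x)) / 2.
  by rewrite -expr2 sqrCi; field.
by rewrite -mulrA hd hc; field.
Qed.

Lemma indecomposable_character : exists2 xi, dual xi & conv e xi = xi.
Proof.
have [_ se ee e0] := ie.
pose xi x := (e 0)^-1 * e x.
have tr x a : e (x + a) * e 0 = e a * e x.
  have cea : ccont (fun x => e (x + a)) by exact: ccont_shift.
  have eea : conv e (fun x => e (x + a)) = (fun x => e (x + a)).
    apply/funext => y; rewrite -[in RHS]ee /conv.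
    rewrite -(CE_shift a (ccont_convM (y + a) ce ce)).
    by apply: eq_CE => z; rewrite opprD addrACA subrr addr0.
  have [c hc] := corner_scalar cea eea.
  have := congr1 (fun h => h x) hc; have := congr1 (fun h => h 0) hc => /=.
  by rewrite add0r => -> ->; ring.
have xiM x y : xi (x + y) = xi x * xi y.
  have -> : xi (x + y) = (e 0)^-1 * (e (x + y) * e 0) / e 0 by rewrite /xi; field.
  by rewrite tr /xi; field.
have xi0 : xi 0 = 1 by rewrite /xi mulVf.
have xi_le x : cabs (xi x) <= 1.
  rewrite cabsM; have := idem_le x ie.
  have -> : cabs (e 0)^-1 = (N2 e)^-1.
    apply: (@complexI R); rewrite cabsE normfV -cabsE idem0// cabsr ger0_norm ?N2_ge0//.
    by rewrite -fmorphV.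
  by rewrite ler_pdivrMl ?mulr1// (lt_le_trans ltr01)// idem_ge1.
exists xi; last by rewrite /xi convZr ?ee//; exact: ccont_CL1.
have [rxi jxi] : ccont xi by exact: ccontZ.
split=> // x; apply/eqP; rewrite eq_le xi_le/=.
(* The moduli of [xi x] and [xi (- x)] have product 1 and are both at most 1. *)
have /(congr1 (@cabs R)) := xiM x (- x); rewrite subrr xi0 cabsM cabs1 => ->.
by rewrite ler_piMr ?cabs_ge0.
Qed.

End indecomposable.

(* Splitting an idempotent decreases N2, its value at 0, by at least 1 (idem_ge1), so
   an indecomposable one is reached after finitely many steps. *)
Lemma idem_character e : idem e -> exists2 xi, dual xi & conv e xi = xi.
Proof.
move=> ie; have [n en] : exists n : nat, N2 e < n%:R.
  by exists (Num.truncn (N2 e)).+1; exact: truncnS_gt.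
elim: n e ie en => [|n IH] e ie en.
  by have := N2_ge0 e; rewrite leNgt en.
have [[e' [ie' ee' ne]]|h] := pselect (exists e', [/\ idem e', conv e e' = e' & e' <> e]).
  have id := idemB ie ie' ee' ne.
  have /IH : N2 e' < n%:R.
    have h1 := idem_ge1 id.
    have h2 : N2 e' + N2 (fun x => e x - e' x) = N2 e.
      by apply: (@complexI R); rewrite rmorphD/= -(idem0 ie) -(idem0 ie') -(idem0 id) addrC subrK.
    by move: en; rewrite -h2 -natr1; lra.
  move=> /(_ ie')[xi dxi e'xi]; exists xi => //.
  have [ce _ _ _] := ie; have [ce' _ _ _] := ie'.
  by rewrite -e'xi convA ?ee' ?e'xi//; exact/ccont_CL1/dual_ccont.
apply: indecomposable_character => // e' ie' ee'.
by apply: contrapT => ne; apply: h; exists e'.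
Qed.

(** * Uniqueness of Fourier coefficients *)

Lemma conv_dual xi f x : dual xi -> CL1 f ->
  conv xi f x = xi x * CE (fun y => (xi y)^* * f y).
Proof.
move=> dxi f1; have [xiD _ _ _] := dxi.
rewrite -CEZ; last by apply: ccontM_CL1 => //; exact/ccont_conj/dual_ccont.
by apply: eq_CE => y; rewrite xiD dual_opp// mulrA.
Qed.

(** If [k] were nonzero, a character [xi] fixed by the idempotent [e] built from [k] would satisfy
    [conv (conv k k) xi = r xi] with [r > 0], whereas [conv k xi] is a coefficient of [k] times
    [xi], that is 0. *)
Lemma selfadjoint_zero k : ccont k -> star k = k ->
  (forall xi, dual xi -> CE (fun y => (xi y)^* * k y) = 0) -> forall x, k x = 0.
Proof.
move=> ck sk coef0 x; apply: contrapT => /eqP kx.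
have [r [e [[r0 ce se ee e0] [kke _]]]] := idempotent_limit ck sk (ex_intro _ x kx).
have [//|xi dxi exi] := @idem_character e.
have cxi := dual_ccont dxi; have xi1 := ccont_CL1 cxi.
have kxi : conv k xi = fun=> 0.
  apply/funext => y; rewrite convC// conv_dual ?coef0 ?mulr0//.
  exact: ccont_CL1.
have ckk : ccont (conv k k) by apply: ccont_conv => //; exact: ccont_CL1.
have : conv (conv k k) xi 0 = r%:C%C * xi 0.
  by rewrite -{1}exi convA// kke convZl// exi.
rewrite -convA// kxi (dual0 dxi) mulr1.
have -> : conv k (fun=> 0) 0 = 0.
  by rewrite -[RHS](CE_cst 0); apply: eq_CE => y; rewrite mulr0.
by move=> /esym/(congr1 (@complex.Re R))/=/eqP; rewrite gt_eqF.
Qed.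

(** The coefficients of [star f] are conjugate to those of [f], so both self-adjoint components of
    [f] have vanishing coefficients. *)
Lemma ccont_zero f : ccont f ->
  (forall xi, dual xi -> CE (fun y => (xi y)^* * f y) = 0) -> forall x, f x = 0.
Proof.
move=> cf coef0.
have csf := ccont_star cf.
have coefs xi : dual xi -> CE (fun y => (xi y)^* * star f y) = 0.
  move=> dxi; have cxi := dual_ccont dxi.
  rewrite -CE_opp; last by apply: ccontM => //; exact: ccont_conj.
  rewrite -(conjC0 (R[i] : numClosedFieldType)) -(coef0 _ dxi) -CE_conj; last first.
    by apply: ccont_CL1; apply: ccontM => //; exact: ccont_conj.
  by apply: eq_CE => y; rewrite dual_opp// /star opprK rmorphM.
have ci : ('i : R[i])^* = - 'i by exact: conjCi.
have l1 xi g : dual xi -> ccont g -> CL1 (fun y => (xi y)^* * g y).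
  by move=> /dual_ccont dxi cg; apply: ccont_CL1; apply: ccontM => //; exact: ccont_conj.
have A1 : forall x, f x + star f x = 0.
  apply: selfadjoint_zero.
  - exact: ccontD.
  - by apply/funext => x; rewrite {1}/star rmorphD/= -/(star f (- x)) -/(star (star f) x) starK addrC.
  move=> xi dxi; under eq_CE do rewrite mulrDr.
  by rewrite CED ?coef0 ?coefs ?addr0//; exact: l1.
have A2 : forall x, 'i * (f x - star f x) = 0.
  apply: selfadjoint_zero.
  - by apply: ccontZ; exact: ccontB.
  - apply/funext => x; rewrite {1}/star rmorphM/= rmorphB/= ci.
    by rewrite -/(star f x) -/(star (star f) x) starK mulNr -mulrN opprB.
  move=> xi dxi; under eq_CE do rewrite mulrCA mulrBr.
  rewrite CEZ; last by apply: CL1B; exact: l1.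
  by rewrite CEB ?coef0 ?coefs ?subrr ?mulr0//; exact: l1.
move=> x; have h1 := A1 x; have /eqP := A2 x.
rewrite mulf_eq0 (negbTE (@neq0Ci _))/= subr_eq0 => /eqP h2.
move: h1; rewrite -h2 -mulr2n => /eqP; rewrite mulrn_eq0/= => /eqP.
exact.
Qed.

(** Convolving [f] with the reflection [psi] of [phi] gives a continuous function, to which
    [ccont_zero] applies: its coefficients are products of those of [psi] and [f], and its value at
    0 is the pairing of [phi] with [f]. *)
Lemma CL1_ortho f phi : CL1 f ->
  (forall xi, dual xi -> CE (fun y => (xi y)^* * f y) = 0) ->
  ccont phi -> CE (fun y => phi y * f y) = 0.
Proof.
move=> f1 coef0 cphi.
pose psi := fun x => phi (- x).
have cpsi : ccont psi by exact: (ccont_comp cphi (@opp_continuous G)).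
have := @ccont_zero (conv psi f) (ccont_conv cpsi f1) _ 0.
rewrite /conv; under eq_CE do rewrite sub0r /psi opprK.
apply => xi dxi; have [xiD _ _ _] := dxi; have cxi := dual_ccont dxi.
pose F (z : G * G) := (xi z.1)^* * psi (z.1 - z.2).
have cF : ccont F.
  apply: ccontM; last exact: ccont_sub.
  by apply: ccont_conj; apply: (ccont_comp cxi (h := fst)) => z; exact: cvg_fst.
transitivity (CE (fun x => CE (fun y => F (x, y) * f y))).
  apply: eq_CE => x; rewrite -(CEZ _ (convM_CL1 x cpsi f1)).
  by apply: eq_CE => y; rewrite mulrA.
rewrite (CE_fubini cF f1).
transitivity (CE (fun y => CE (fun x => (xi x)^* * psi x) * ((xi y)^* * f y))); last first.
  rewrite CEZ ?coef0 ?mulr0//.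
  by apply: ccontM_CL1 => //; exact: ccont_conj.
apply: eq_CE => y; rewrite mulrA; congr (_ * _).
have cFy : ccont (fun x => F (x, y)).
  exact: (ccontM (ccont_conj cxi) (ccont_shift (- y) cpsi)).
rewrite -(CE_shift y cFy) mulrC -CEZ; last first.
  by apply: ccont_CL1; apply: ccontM => //; exact: ccont_conj.
by apply: eq_CE => x; rewrite /F/= addrK xiD rmorphM/= mulrA [(xi y)^* * _]mulrC.
Qed.

End characters.

End mean.

(** * Integrable functions orthogonal to the continuous ones *)

Section ae_zero.
Variables (R : realType) (G : topologicalZmodType).
Variable mu : {measure set (borel G) -> \bar R}.
Hypothesis Ghaus : hausdorff_space G.
Hypothesis Gcompact : compact [set: G].
Hypothesis Ghaar : haar_measure mu.

Let T := borel G.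

Lemma compact_borel (K : set G) : compact K -> measurable (K : set T).
Proof.
move=> cK; rewrite -[K]setCK; apply: measurableC; apply: open_borel.
by apply: closed_openC; exact: compact_closed.
Qed.

Lemma null_of_small (N : set T) : measurable N ->
  (forall n, (mu N <= (n.+1%:R^-1)%:E)%E) -> mu N = 0%E.
Proof.
move=> mN hN; apply/eqP; rewrite eq_le measure_ge0 andbT.
apply/lee_addgt0Pr => e e0; rewrite add0e.
have /ltr_add_invr[n hn] : 0 < e by [].
by rewrite (le_trans (hN n))// lee_fin ltW// -[ltLHS]add0r.
Qed.

Lemma mu_fin_num (A : set T) : measurable A -> mu A \is a fin_num.
Proof. by move=> mA; rewrite ge0_fin_numE// mu_finE. Qed.

Let ltB_leB (a b : \bar R) (e : R) : a \is a fin_num -> b \is a fin_num ->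
  (a - e%:E < b -> a - b <= e%:E)%E.
Proof.
move: a b => [a||] [b||]// _ _.
by rewrite -!EFinB lte_fin lee_fin => ?; lra.
Qed.

Let ltD_leB (a b : \bar R) (e : R) : a \is a fin_num -> b \is a fin_num ->
  (a < b + e%:E -> a - b <= e%:E)%E.
Proof.
move: a b => [a||] [b||]// _ _.
by rewrite -EFinD -EFinB lte_fin lee_fin => ?; lra.
Qed.

Lemma inner_approx (U : set G) (e : R) : open U -> 0 < e ->
  exists K : set G, [/\ compact K, K `<=` U & (mu (U `\` K) <= e%:E)%E].
Proof.
move=> oU e0; have mU := open_borel oU; have Ufin := mu_fin_num mU.
have [_ _ _ /(_ U oU) hU _] := Ghaar.
rewrite hU in Ufin; have [_ [K [cK KU] <-]] := ub_ereal_sup_adherent e0 Ufin.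
rewrite -hU => lt; have mK := compact_borel cK.
exists K; split => //; rewrite measureD ?mu_finE// (setIidr KU).
exact: (ltB_leB (mu_fin_num mU) (mu_fin_num mK) lt).
Qed.

Lemma outer_approx (A : set T) (e : R) : measurable A -> 0 < e ->
  exists U : set G, [/\ open U, A `<=` U & (mu (U `\` A) <= e%:E)%E].
Proof.
move=> mA e0; have Afin := mu_fin_num mA.
have [_ _ /(_ A mA) hA _ _] := Ghaar.
rewrite hA in Afin; have [_ [U [oU AU] <-]] := lb_ereal_inf_adherent e0 Afin.
rewrite -hA => lt; have mU := open_borel oU.
exists U; split => //; rewrite measureD ?mu_finE// (setIidr AU).
exact: (ltD_leB (mu_fin_num mU) (mu_fin_num mA) lt).
Qed.

Variable h : G -> R.
Hypothesis h1 : L1 mu h.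

(** Dominated convergence with majorant [|h|]. It is used to pass from continuous functions to
    indicators of open sets, then to indicators of Borel sets. *)
Lemma mean_bounded_cvg (phi : nat -> G -> R) (psi : G -> R) (N : set T) :
  (forall n, measurable_fun [set: T] (phi n : T -> R)) ->
  (forall n x, `|phi n x| <= 1) ->
  measurable_fun [set: T] (psi : T -> R) ->
  measurable N -> mu N = 0%E ->
  (forall x, ~ N x -> exists n, forall m, (n <= m)%N -> phi m x = psi x) ->
  (forall n, mean mu (fun x => phi n x * h x) = 0) ->
  mean mu (fun x => psi x * h x) = 0.
Proof.
move=> mphi phi1 mpsi mN N0 cvg phi0.
have mh := L1_measurable h1.
have [] := @dominated_convergence _ _ R mu setT measurableT
  (fun n x => (phi n x * h x)%:E) (fun x => (psi x * h x)%:E) (fun x => `|h x|%:E).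
- by move=> n; apply/measurable_EFinP; exact: measurable_funM.
- by apply/measurable_EFinP; exact: measurable_funM.
- exists N; split => // x /= hx; apply: contrapT => Nx; apply: hx => _.
  have [n hn] := cvg _ Nx; apply: cvg_near_cst; exists n => // m /= nm.
  by rewrite hn.
- exact: L1_norm.
- by apply: aeW => x n _; rewrite lee_fin normrM ler_piMl.
move=> ipsi _ hcvg.
have z0 n : (\int[mu]_x (phi n x * h x)%:E = 0)%E.
  have i1 : mu.-integrable setT (EFin \o (fun x : T => phi n x * h x)).
    exact: L1M (mphi n) (phi1 n) h1.
  have := integrable_fin_num measurableT i1 => /fineK <-.
  have /eqP := phi0 n; rewrite mulf_eq0 gt_eqF/= ?weight_gt0// => /eqP.
  by rewrite /Rintegral => ->.
rewrite /mean /Rintegral; have := cvg_lim (@ereal_hausdorff R) hcvg.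
under [X in limn X]eq_fun do rewrite z0.
by rewrite lim_cst// => <-; rewrite mulr0.
Qed.

Hypothesis h_ortho : forall phi : G -> R, continuous phi ->
  mean mu (fun x => phi x * h x) = 0.

(** Urysohn functions equal to 1 on [K 0], ..., [K n] and to 0 off [U] stabilize to the indicator of
    [U], except on the part of [U] missed by all [K n], which inner regularity makes null. *)
Let mean_open (U : set G) : open U -> mean mu (fun x => \1_U x * h x) = 0.
Proof.
move=> oU; have mU := open_borel oU.
have /choice[K hK] n : exists K : set G,
    [/\ compact K, K `<=` U & (mu (U `\` K) <= (n.+1%:R^-1)%:E)%E].
  by apply: inner_approx => //; rewrite invr_gt0.
pose K' n := \big[setU/set0]_(i < n.+1) K i.
have cK' n : compact (K' n).
  by apply: bigsetU_compact => i _; have [] := hK i.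
have K'U n : K' n `<=` U.
  by rewrite /K' -bigcup_mkord => x [i _]; have [_ + _] := hK i; apply.
have /choice[phi hphi] n : exists phi : G -> R, [/\ continuous phi,
    range phi `<=` `[0, 1]%classic, phi @` (~` U) `<=` [set 0] &
    phi @` (K' n) `<=` [set 1]].
  have sep := (@normal_separatorP R _).1 (compact_normal Ghaus Gcompact).
  apply/uniform_separatorP; apply: sep.
  - exact: open_closedC.
  - exact: compact_closed.
  - by rewrite -subset0 => x [/= nUx /K'U].
have phi01 n x : 0 <= phi n x <= 1.
  by have [_ /(_ (phi n x)) + _ _] := hphi n; rewrite /= in_itv/=; apply; exists x.
have mK n : measurable (K n : set T) by apply: compact_borel; have [] := hK n.
apply: (@mean_bounded_cvg phi _ (U `\` \bigcup_n K n)).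
- by move=> n; apply: continuous_borel; have [] := hphi n.
- by move=> n x; have /andP[a b] := phi01 n x; rewrite ger0_norm.
- exact: measurable_indic.
- by apply: measurableD => //; exact: bigcupT_measurable.
- apply: null_of_small => [|n].
    by apply: measurableD => //; exact: bigcupT_measurable.
  have [_ _] := hK n; apply: le_trans; apply: le_measure; rewrite ?inE.
  + by apply: measurableD => //; exact: bigcupT_measurable.
  + exact: measurableD.
  + by move=> x [Ux nK]; split => // Kx; apply: nK; exists n.
- move=> x nx; have [Ux|nUx] := pselect (U x).
    have [n _ Knx] : (\bigcup_n K n) x by apply: contrapT => nK; apply: nx.
    exists n => m nm; rewrite indicE mem_set//.
    have [_ _ _ +] := hphi m; apply; exists x => //.
    by rewrite /K' -bigcup_mkord; exists n.
  exists 0%N => m _; rewrite indicE memNset//.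
  by have [_ _ + _] := hphi m; apply; exists x.
- by move=> n; apply: h_ortho; have [] := hphi n.
Qed.

(** Outer regularity: the indicators of the decreasing open sets [V n] stabilize to that of [A] off
    a null set. *)
Let mean_measurable (A : set T) : measurable A ->
  mean mu (fun x => \1_A x * h x) = 0.
Proof.
move=> mA.
have /choice[U hU] n : exists U : set G,
    [/\ open U, A `<=` U & (mu (U `\` A) <= (n.+1%:R^-1)%:E)%E].
  by apply: outer_approx => //; rewrite invr_gt0.
pose V n := \big[setI/setT]_(i < n.+1) U i.
have oV n : open (V n).
  rewrite /V; apply: (big_ind (fun X : set G => open X)).
  - exact: openT.
  - exact: openI.
  - by move=> i _; have [] := hU i.
have VE n x : V n x <-> forall i, (i <= n)%N -> U i x.
  rewrite /V -bigcap_mkord; split => [h' i ni|h' i ni]; exact: h'.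
have mU n : measurable (U n : set T) by apply: open_borel; have [] := hU n.
apply: (@mean_bounded_cvg (fun n => \1_(V n)) _ ((\bigcap_n U n) `\` A)).
- by move=> n; apply: measurable_indic; exact: open_borel.
- by move=> n x; rewrite ger0_norm ?indicE// lern1 leq_b1.
- exact: measurable_indic.
- by apply: measurableD => //; exact: bigcapT_measurable.
- apply: null_of_small => [|n].
    by apply: measurableD => //; exact: bigcapT_measurable.
  have [_ _] := hU n; apply: le_trans; apply: le_measure; rewrite ?inE.
  + by apply: measurableD => //; exact: bigcapT_measurable.
  + exact: measurableD.
  + by move=> x [Ux nA]; split => //; exact: Ux.
- move=> x nx; have [Ax|nAx] := pselect (A x).
    exists 0%N => m _; rewrite !indicE !mem_set//.
    by apply/VE => i _; have [_ + _] := hU i; apply.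
  have [n nUx] : exists n, ~ U n x.
    apply: contrapT => h'; apply: nx; split => // n _.
    by apply: contrapT => nU; apply: h'; exists n.
  exists n => m nm; rewrite !indicE !memNset// => /VE/(_ _ nm).
  exact: nUx.
- by move=> n; exact: mean_open.
Qed.

(** [|h|] is [h] on the set where [h > 0] minus [h] on the set where [h < 0], so its mean is a
    difference of two zeros. *)
Lemma ae_zero : {ae mu, forall x, h x = 0}.
Proof.
have mh := L1_measurable h1.
have mpos : measurable ([set x | 0 < h x] : set T).
  have := mh measurableT `]0, +oo[%classic (measurable_itv _).
  rewrite setTI; congr measurable; apply/seteqP; split => x;
    by rewrite /= in_itv/= andbT.
have mneg : measurable ([set x | h x < 0] : set T).
  have := mh measurableT `]-oo, 0[%classic (measurable_itv _).
  by rewrite setTI; congr measurable; apply/seteqP; split => x; rewrite /= in_itv.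
have l1 (A : set T) : measurable A -> L1 mu (fun x => \1_A x * h x).
  move=> mA; have mi : measurable_fun [set: T] (\1_A : T -> R) by exact: measurable_indic.
  have bi x : `|(\1_A x : R)| <= 1 by rewrite ger0_norm ?indicE// lern1 leq_b1.
  exact: (L1M mi bi h1).
have : mean mu (fun x => `|h x|) = 0.
  have := meanB (l1 _ mpos) (l1 _ mneg).
  rewrite (mean_measurable mpos) (mean_measurable mneg) subrr => <-.
  apply: eq_mean => x; rewrite !indicE.
  have Epos : (x \in [set x | 0 < h x]) = (0 < h x) by apply/idP/idP; rewrite inE.
  have Eneg : (x \in [set x | h x < 0]) = (h x < 0) by apply/idP/idP; rewrite inE.
  rewrite Epos Eneg; have [hx|hx|<-] := ltgtP 0 (h x).
  - by rewrite mul1r mul0r subr0 gtr0_norm.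
  - by rewrite mul1r mul0r sub0r ltr0_norm.
  - by rewrite normr0 !mulr0 subrr.
move=> /eqP; rewrite mulf_eq0 gt_eqF/= ?weight_gt0// => /eqP h0.
have i0 : (\int[mu]_x `|(h x)%:E| = 0)%E.
  have fi := integrable_fin_num measurableT (L1_norm h1).
  by rewrite -(fineK fi); congr (_%:E); exact: h0.
have mE : measurable_fun setT (fun x : T => (h x)%:E) by exact/measurable_EFinP.
have /(ae_eq_integral_abs mu measurableT mE).1 := i0.
by apply: filterS => x /(_ I)[].
Qed.

End ae_zero.

(** * Lebesgue spaces *)

Section Lp_tools.
Context d (T : measurableType d) (R : realType).
Variable mu : {measure set T -> \bar R}.

Lemma measurable_powR_norm (f : T -> R) (p : R) : measurable_fun setT f ->
  measurable_fun setT (fun x => (`|f x| `^ p)%:E).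
Proof.
move=> mf; apply/measurable_EFinP.
apply: (measurableT_comp (f := fun t : R => t `^ p)); first exact: measurable_powR.
exact: measurableT_comp.
Qed.

Lemma powR_cvg (t : nat -> R) (l p : R) : 0 < p -> (forall k, 0 <= t k) -> 0 <= l ->
  t @ \oo --> l -> (fun k => t k `^ p) @ \oo --> l `^ p.
Proof.
move=> p0 t0; rewrite le_eqVlt => /predU1P[<-|l0] tl.
  (* At a limit 0 the power need not be differentiable, so this case is done by hand. *)
  rewrite powR0 ?gt_eqF//; apply/cvgrPdist_lt => e e0.
  have e1 : 0 < e `^ p^-1 by rewrite powR_gt0.
  have /cvgrPdist_lt/(_ _ e1) := tl.
  apply: filterS => k; rewrite !sub0r !normrN !ger0_norm ?powR_ge0// => h.
  have := gt0_ltr_powR p0 (t0 k) (ltW e1) h.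
  by rewrite -powRrM mulVf ?gt_eqF// powRr1// ltW.
apply: (@cvg_comp _ _ _ t (fun x : R => x `^ p) _ (nbhs l)) => //.
have := is_derive1_powR p l0 => -[+ _].
by move=> /derivable1_diffP/differentiable_continuous.
Qed.

Lemma limn_einf_le (u : nat -> \bar R) (e : \bar R) : (forall k, u k <= e)%E ->
  (limn_einf u <= e)%E.
Proof.
move=> ue; rewrite limn_einf_lim; apply: lime_le; first exact: is_cvg_einfs.
by apply: nearW => n; apply: ge_ereal_inf; exists (u n) => //; exists n => /=.
Qed.

Lemma powR_le_self (p t C : R) : 1 <= p -> 0 <= t -> t `^ p <= C -> t <= 1 + C.
Proof.
move=> p1 t0 tC; have C0 : 0 <= C by rewrite (le_trans _ tC)// powR_ge0.
have [t1|t1] := leP t 1; first by rewrite (le_trans t1)// lerDl.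
by rewrite (le_trans (le1r_powR (ltW t1) p1))// (le_trans tC)// lerDr.
Qed.


(** With both bounds written as p-th powers, the triangle inequality can be iterated on integrals of
    [|f|^p] without extracting roots of extended reals. *)
Lemma minkowski_powR (p A B : R) (f g : T -> R) : 1 <= p -> 0 <= A -> 0 <= B ->
  measurable_fun setT f -> measurable_fun setT g ->
  (\int[mu]_x (`|f x| `^ p)%:E <= (A `^ p)%:E)%E ->
  (\int[mu]_x (`|g x| `^ p)%:E <= (B `^ p)%:E)%E ->
  (\int[mu]_x (`|f x + g x| `^ p)%:E <= ((A + B) `^ p)%:E)%E.
Proof.
move=> p1 A0 B0 mf mg fA gB.
have p0 : 0 < p by rewrite (lt_le_trans _ p1).
have LE h : (\int[mu]_x (`|h x| `^ p)%:E = 'N[mu]_p%:E[EFin \o h] `^ p)%E.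
  by rewrite poweR_Lnorm ?gt_eqF//; apply: eq_integral => x _; rewrite poweR_EFin.
have Nle h C : 0 <= C -> (\int[mu]_x (`|h x| `^ p)%:E <= (C `^ p)%:E)%E ->
    ('N[mu]_p%:E[EFin \o h] <= C%:E)%E.
  move=> C0; rewrite LE -poweR_EFin => hC.
  have p' : 0 <= p^-1 by rewrite invr_ge0 ltW.
  have := gt0_ler_poweR p' _ _ hC.
  rewrite -!poweRrM mulfV ?gt_eqF// !poweRe1 ?lee_fin ?Lnorm_ge0//; apply.
    by rewrite in_itv/= poweR_ge0 leey.
  by rewrite in_itv/= lee_fin powR_ge0 leey.
rewrite LE -poweR_EFin; apply: gt0_ler_poweR.
- exact: ltW.
- by rewrite in_itv/= Lnorm_ge0 leey.
- by rewrite in_itv/= lee_fin addr_ge0// leey.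
rewrite (le_trans (minkowski_EFin mu mf mg p1))// EFinD leeD//; exact: Nle.
Qed.

(** * Completeness of L^p *)

Section riesz_fischer.
Variables (p : R) (u : nat -> T -> R).
Hypothesis p1 : 1 <= p.
Hypothesis mu_ : forall n, measurable_fun setT (u n).
Hypothesis cauchy_u : forall e : R, 0 < e -> exists N, forall n m,
  (N <= n)%N -> (N <= m)%N -> (\int[mu]_x (`|u n x - u m x| `^ p)%:E <= e%:E)%E.

Let p0 : 0 < p. Proof. by rewrite (lt_le_trans _ p1). Qed.

(** The factor [2 ^+ k] inside the p-th power turns integrability of the summed powers into
    pointwise geometric decay of the increments, without any triangle inequality for infinite
    sums. *)
Let fast_subsequence : exists n_ : nat -> nat, (forall k, (k <= n_ k)%N) /\
  forall k, (\int[mu]_x ((2 ^+ k * `|u (n_ k.+1) x - u (n_ k) x|) `^ p)%:E <=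
    (2^-1 ^+ k)%:E)%E.
Proof.
pose e k : R := 2^-1 ^+ k / (2 ^+ k) `^ p.
have e0 k : 0 < e k by rewrite divr_gt0 ?exprn_gt0 ?powR_gt0 ?exprn_gt0// invr_gt0.
have /choice[N hN] k := cauchy_u (e0 k).
pose n_ k := (k + \sum_(j < k.+1) N j)%N.
have nN k : (N k <= n_ k)%N by rewrite /n_ big_ord_recr/= addnA leq_addl.
have nS k : (n_ k <= n_ k.+1)%N.
  by rewrite /n_ leq_add// [leqRHS]big_ord_recr/= leq_addr.
exists n_; split=> [k|k]; first exact: leq_addr.
under eq_integral => x _ do rewrite powRM ?exprn_ge0// EFinM.
rewrite ge0_integralZl_EFin ?powR_ge0//; last first.
  by apply: measurable_powR_norm; exact: measurable_funB.
have c0 : (0 <= ((2 ^+ k) `^ p)%:E :> \bar R)%E by rewrite lee_fin powR_ge0.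
rewrite (le_trans (lee_wpmul2l c0 (hN k _ _ (leq_trans (nN k) (nS k)) (nN k))))//.
by rewrite -EFinM lee_fin /e mulrCA mulfV ?mulr1// gt_eqF// powR_gt0// exprn_gt0.
Qed.

Lemma cauchy_Lp_limit : exists2 g : T -> R, measurable_fun setT g &
  forall e : R, 0 < e -> exists N, forall n, (N <= n)%N ->
    (\int[mu]_x (`|u n x - g x| `^ p)%:E <= e%:E)%E.
Proof.
have [n_ [n_ge hn_]] := fast_subsequence.
pose D k x := 2 ^+ k * `|u (n_ k.+1) x - u (n_ k) x|.
have D0 k x : 0 <= D k x by rewrite mulr_ge0// exprn_ge0.
have mD k : measurable_fun setT (fun x => (D k x `^ p)%:E).
  rewrite [X in measurable_fun _ X](_ : _ =
      (fun x => (`|2 ^+ k * (u (n_ k.+1) x - u (n_ k) x)| `^ p)%:E)).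
    apply: measurable_powR_norm; apply: measurable_funM => //.
    exact: measurable_funB.
  by apply/funext => x; rewrite normrM ger0_norm ?exprn_ge0.
(* Where [F x] is finite, each [D k x] is at most [1 + F x], so the increments of the subsequence
   are dominated by [(1 + F x) / 2^k]. *)
pose F x := (\sum_(0 <= k <oo) (D k x `^ p)%:E)%E.
have F0 x : (0 <= F x)%E by apply: nneseries_ge0 => k _ _; rewrite lee_fin powR_ge0.
have mF : measurable_fun setT F.
  by apply: ge0_emeasurable_sum => // k x _ _; rewrite lee_fin powR_ge0.
have intF : mu.-integrable setT F.
  apply/integrableP; split => //.
  under eq_integral => x _ do rewrite gee0_abs//.
  rewrite integral_nneseries//; last by move=> k x _; rewrite lee_fin powR_ge0.
  apply: (@le_lt_trans _ _ 2%:E); last exact: ltry.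
  apply: lime_le.
    by apply: is_cvg_nneseries => k _ _; apply: integral_ge0 => x _; rewrite lee_fin powR_ge0.
  apply: nearW => n.
  apply: (@le_trans _ _ (\sum_(0 <= k < n) (2^-1 ^+ k)%:E)%E).
    by apply: lee_sum => k _; exact: hn_.
  rewrite sumEFin lee_fin.
  have -> : \sum_(0 <= k < n) 2^-1 ^+ k = 2 - 2 * 2^-1 ^+ n :> R.
    elim: n => [|n IH]; first by rewrite big_nil expr0; lra.
    by rewrite big_nat_recr//= IH exprS; field.
  by rewrite lerBlDr lerDl mulr_ge0// exprn_ge0// invr_ge0.
pose N := [set x | F x = +oo%E].
have mN : measurable N.
  rewrite -[N]setTI; exact: (mF measurableT [set +oo%E] (emeasurable_set1 _)).
have N0 : mu N = 0%E.
  apply: (measure_negligible mN); apply: negligibleS (integrable_ae measurableT intF).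
  by move=> x /= Fx /(_ I); rewrite Fx.
(* Killing the subsequence on the null set [N] makes it converge everywhere, so its limit is
   measurable. *)
pose v k x := u (n_ k) x * \1_(~` N) x.
have mv k : measurable_fun setT (v k).
  by apply: measurable_funM => //; apply: measurable_indic; exact: measurableC.
have cv x : cvgn (v^~ x).
  have [Nx|nNx] := pselect (N x).
    rewrite (_ : v^~ x = fun=> 0); first exact: is_cvg_cst.
    by apply/funext => k; rewrite /v indicE memNset ?mulr0//; exact.
  have Ffin : F x \is a fin_num.
    by rewrite ge0_fin_numE// ltey; apply/eqP.
  have Dle k : D k x <= 1 + fine (F x).
    apply: (powR_le_self p1) => //; rewrite -lee_fin fineK//.
    apply: le_trans (nneseries_lim_ge k.+1 _); last first.
      by move=> j _ _; rewrite lee_fin powR_ge0.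
    rewrite big_nat_recr//= leeDr// sume_ge0// => j _.
    by rewrite lee_fin powR_ge0.
  pose w k := u (n_ k) x.
  rewrite (_ : v^~ x = w); last first.
    by apply/funext => k; rewrite /v indicE mem_set ?mulr1.
  rewrite (_ : w = fun k => w 0%N + series (telescope w) k); last first.
    by apply/funext => k; exact: eq_sum_telescope.
  apply: is_cvgD; first exact: is_cvg_cst.
  apply: normed_cvg.
  apply: (@series_le_cvg _ _ (geometric (1 + fine (F x)) 2^-1)) => //.
  - by move=> k /=.
  - by move=> k; rewrite /geometric/= mulr_ge0 ?exprn_ge0// addr_ge0// fine_ge0.
  - move=> k; rewrite /geometric /telescope/= exprVn ler_pdivlMr ?exprn_gt0//.
    by rewrite mulrC; exact: Dle.
  - by apply: is_cvg_geometric_series; rewrite ger0_norm ?invr_ge0// invf_lt1// ltr1n.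
pose g x := limn (v^~ x).
have vg x : v^~ x @ \oo --> g x by exact: cv.
exists g; first by apply: (measurable_fun_cvg mv) => x _; exact: vg.
move=> e e0; have [M hM] := cauchy_u e0; exists M => n Mn.
have mf k : measurable_fun setT (fun x => (`|u n x - v (k + M)%N x| `^ p)%:E).
  by apply: measurable_powR_norm; exact: measurable_funB.
have lim_f x : limn_einf (fun k => (`|u n x - v (k + M)%N x| `^ p)%:E) =
    (`|u n x - g x| `^ p)%:E.
  suff h : (fun k => (`|u n x - v (k + M)%N x| `^ p)%:E) @ \oo -->
      (`|u n x - g x| `^ p)%:E by have [] := cvg_limn_einf_sup h.
  apply: cvg_EFin; first by apply: nearW.
  apply: (powR_cvg p0) => //.
  apply: cvg_norm; apply: cvgB; first exact: cvg_cst.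
  by have := vg x; rewrite -(@cvg_shiftn M).
have f0 k x : setT x -> (0 <= (`|u n x - v (k + M)%N x| `^ p)%:E)%E.
  by rewrite lee_fin powR_ge0.
(* Fatou in k for [u n - v (k + M)]: the shift by [M] keeps the second index at least [M], where the
   Cauchy bound holds. *)
have := fatou mu measurableT mf f0.
under eq_integral do rewrite lim_f.
move=> /le_trans; apply.
apply: limn_einf_le => k.
rewrite (@ge0_ae_eq_integral _ _ _ mu setT _ (fun x => (`|u n x - u (n_ (k + M)%N) x| `^ p)%:E))//.
- apply: hM => //; exact: leq_trans (leq_addl _ _) (n_ge _).
- by apply: measurable_powR_norm; exact: measurable_funB.
- exists N; split => // x /= h'; apply: contrapT => nNx; apply: h' => _.
  by rewrite /v indicE mem_set ?mulr1.
Qed.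

End riesz_fischer.

End Lp_tools.

(** * L^p integrals of complex-valued functions *)

Section complex_Lp.
Variables (R : realType) (G : topologicalZmodType).
Variable mu : {measure set (borel G) -> \bar R}.
Hypothesis Gcompact : compact [set: G].
Hypothesis Ghaar : haar_measure mu.

Let T := borel G.
Implicit Types (f g h : G -> R[i]) (p q : R).

Definition cmeas f : Prop :=
  measurable_fun [set: T] (fun x : T => complex.Re (f x)) /\
  measurable_fun [set: T] (fun x : T => complex.Im (f x)).

(** The p-th power of the L^p norm, kept without the root: triangle inequalities are stated through
    bounds of the form [A ^ p]. *)
Definition Lpint p f : \bar R :=
  (\int[mu]_(x in [set: T]) ((cabs (f x)) `^ p)%:E)%E.

Lemma cmeas_ccont f : ccont f -> cmeas f.
Proof. by move=> [rf jf]; split; exact: continuous_borel. Qed.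

Lemma cmeasD f g : cmeas f -> cmeas g -> cmeas (fun x => f x + g x).
Proof.
move=> [rf jf] [rg jg]; split.
  by under eq_fun do rewrite Re_add; exact: measurable_funD.
by under eq_fun do rewrite Im_add; exact: measurable_funD.
Qed.

Lemma cmeasN f : cmeas f -> cmeas (fun x => - f x).
Proof.
move=> [rf jf]; split.
  by under eq_fun do rewrite Re_opp; exact: measurableT_comp.
by under eq_fun do rewrite Im_opp; exact: measurableT_comp.
Qed.

Lemma cmeasB f g : cmeas f -> cmeas g -> cmeas (fun x => f x - g x).
Proof. by move=> mf mg; apply: cmeasD => //; exact: cmeasN. Qed.

Lemma CL1_cmeas f : CL1 mu f -> cmeas f.
Proof. by move=> [rf jf]; split; [exact: (L1_measurable rf)|exact: (L1_measurable jf)]. Qed.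

Lemma cmeas_cabs f : cmeas f -> measurable_fun [set: T] (fun x : T => cabs (f x)).
Proof. by move=> [rf jf]; exact: cabs_measurable. Qed.

Lemma cmeas_powR p f : cmeas f ->
  measurable_fun [set: T] (fun x : T => (cabs (f x) `^ p)%:E).
Proof.
move=> mf; apply/measurable_EFinP.
apply: (measurableT_comp (f := fun t : R => t `^ p)); first exact: measurable_powR.
exact: cmeas_cabs.
Qed.

Lemma Lpint_ge0 p f : (0 <= Lpint p f)%E.
Proof. by apply: integral_ge0 => x _; rewrite lee_fin powR_ge0. Qed.

Lemma Lpint_normE p f : Lpint p f = (\int[mu]_x (`|cabs (f x)| `^ p)%:E)%E.
Proof. by apply: eq_integral => x _; rewrite (ger0_norm (cabs_ge0 _)). Qed.

Lemma LpintB p f g : Lpint p (fun x => f x - g x) = Lpint p (fun x => g x - f x).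
Proof. by apply: eq_integral => x _; rewrite cabsB. Qed.

Lemma Lpint_minkowski p (A B : R) f g : 1 <= p -> 0 <= A -> 0 <= B ->
  cmeas f -> cmeas g -> (Lpint p f <= (A `^ p)%:E)%E -> (Lpint p g <= (B `^ p)%:E)%E ->
  (Lpint p (fun x => (f x + g x)%R) <= ((A + B) `^ p)%:E)%E.
Proof.
move=> p1 A0 B0 mf mg; rewrite !Lpint_normE => fA gB.
have p0 : 0 <= p by rewrite (le_trans _ p1).
apply: le_trans (minkowski_powR p1 A0 B0 (cmeas_cabs mf) (cmeas_cabs mg) fA gB).
apply: ge0_le_integral => //.
- by apply: measurable_powR_norm; apply: cmeas_cabs; exact: cmeasD.
- by apply: measurable_powR_norm; apply: measurable_funD; exact: cmeas_cabs.
- move=> x _; rewrite lee_fin ge0_ler_powR ?nnegrE// !ger0_norm ?cabs_ge0//.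
    exact: cabsD.
  by rewrite addr_ge0// cabs_ge0.
Qed.

Lemma cauchy_Lpint_limit p (u : nat -> G -> R[i]) : 1 <= p -> (forall n, cmeas (u n)) ->
  (forall e : R, 0 < e -> exists N, forall n m, (N <= n)%N -> (N <= m)%N ->
    (Lpint p (fun x => (u n x - u m x)%R) <= e%:E)%E) ->
  exists2 g, cmeas g & forall e : R, 0 < e -> exists N, forall n, (N <= n)%N ->
    (Lpint p (fun x => (u n x - g x)%R) <= e%:E)%E.
Proof.
move=> p1 um cu; have p0 : 0 < p by rewrite (lt_le_trans _ p1).
have le_part (part : R[i] -> R) f : (forall z, `|part z| <= cabs z) ->
    measurable_fun [set: T] (fun x : T => part (f x)) -> cmeas f ->
    ((\int[mu]_(x in [set: T]) (`|part (f x)| `^ p)%:E) <= Lpint p f)%E.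
  move=> lepart mpart mf; apply: ge0_le_integral => //.
  - exact: measurable_powR_norm.
  - exact: cmeas_powR.
  - by move=> x _; rewrite lee_fin ge0_ler_powR ?nnegrE ?cabs_ge0// ltW.
have [||g1 mg1 ug1] := @cauchy_Lp_limit _ T R mu p (fun n (x : T) => complex.Re (u n x)) p1.
- by move=> n; have [] := um n.
- move=> e /cu[N hN]; exists N => n m Nn Nm; apply: le_trans (hN n m Nn Nm).
  have mnm := cmeasB (um n) (um m).
  apply: le_trans (le_part (@complex.Re R) _ (@normRe_cabs R) (proj1 mnm) mnm).
  by under [leRHS]eq_integral do rewrite Re_add Re_opp.
have [||g2 mg2 ug2] := @cauchy_Lp_limit _ T R mu p (fun n (x : T) => complex.Im (u n x)) p1.
- by move=> n; have [] := um n.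
- move=> e /cu[N hN]; exists N => n m Nn Nm; apply: le_trans (hN n m Nn Nm).
  have mnm := cmeasB (um n) (um m).
  apply: le_trans (le_part (@complex.Im R) _ (@normIm_cabs R) (proj2 mnm) mnm).
  by under [leRHS]eq_integral do rewrite Im_add Im_opp.
pose g x := Complex (g1 x) (g2 x).
have mg : cmeas g by [].
exists g; [exact: mg|move=> e e0].
(* Half of the allowed norm for each of the real and imaginary parts, so that [(a + a) ^ p = e]. *)
pose a := e `^ p^-1 / 2.
have a0 : 0 < a by rewrite divr_gt0// powR_gt0.
have [N1 hN1] := ug1 (a `^ p) (powR_gt0 _ a0).
have [N2 hN2] := ug2 (a `^ p) (powR_gt0 _ a0).
exists (maxn N1 N2) => n; rewrite geq_max => /andP[n1 n2].
have aE : (a + a) `^ p = e.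
  by rewrite /a -splitr -powRrM mulVf ?gt_eqF// powRr1// ltW.
have [[m1 m2] [m3 m4]] := (um n, mg).
have mR : measurable_fun [set: T] (fun x : T => `|complex.Re (u n x) - g1 x|).
  by apply: measurableT_comp => //; exact: measurable_funB.
have mI : measurable_fun [set: T] (fun x : T => `|complex.Im (u n x) - g2 x|).
  by apply: measurableT_comp => //; exact: measurable_funB.
have := minkowski_powR (mu := mu) p1 (ltW a0) (ltW a0) mR mI.
rewrite aE => h; apply: le_trans (h _ _).
- apply: ge0_le_integral => //.
  + by move=> x _; rewrite lee_fin powR_ge0.
  + exact: (cmeas_powR p (cmeasB (um n) mg)).
  + exact: (measurable_powR_norm p (measurable_funD mR mI)).
  + move=> x _; rewrite lee_fin ge0_ler_powR ?nnegrE ?cabs_ge0 ?(ltW p0)//.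
    rewrite ger0_norm ?addr_ge0//.
    by have := cabs_ReIm (u n x - g x); rewrite Re_add Im_add Re_opp Im_opp.
- by under eq_integral do rewrite normr_id; exact: hN1.
- by under eq_integral do rewrite normr_id; exact: hN2.
Qed.

Lemma Lpint_bounded p f (M : R) : 0 <= p -> cmeas f -> (forall x, cabs (f x) <= M) ->
  (Lpint p f <= (M `^ p * mass mu)%:E)%E.
Proof.
move=> p0 mf fM; rewrite EFinM (massE Gcompact Ghaar) -integral_cst//.
apply: ge0_le_integral => //.
- by move=> x _; rewrite lee_fin powR_ge0.
- exact: (cmeas_powR p mf).
- move=> x _; rewrite lee_fin ge0_ler_powR ?nnegrE ?cabs_ge0//.
  exact: le_trans (cabs_ge0 _) (fM x).
Qed.

(** Above the threshold [t ^ p = e], the quotient [t ^ q / t ^ p] is at least [e ^ (q / p - 1)].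
    Integrated over a finite measure, this plays the role of the Hölder inclusion of L^q in L^p. *)
Let powR_interp p q (t e : R) : 0 < p -> p <= q -> 0 <= t -> 0 < e ->
  t `^ p <= e + e `^ (1 - q / p) * t `^ q.
Proof.
move=> p0 pq t0 e0; have [te|te] := leP (t `^ p) e.
  by rewrite (le_trans te)// lerDl mulr_ge0 ?powR_ge0.
rewrite -[leLHS]add0r lerD ?(ltW e0)//.
have tp0 : 0 < t `^ p := lt_trans e0 te.
have -> : t `^ q = t `^ p * (t `^ p) `^ (q / p - 1).
  rewrite mulr_powRB1 ?(ltW tp0)//; last by rewrite divr_gt0// (lt_le_trans p0).
  by rewrite -powRrM mulrCA mulfV ?mulr1// gt_eqF.
rewrite mulrCA ler_peMr ?(ltW tp0)// -opprB powRN mulrC ler_pdivlMr ?powR_gt0// mul1r.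
rewrite ge0_ler_powR ?nnegrE ?(ltW e0) ?(ltW tp0) ?(ltW te)//.
by rewrite subr_ge0 ler_pdivlMr// mul1r.
Qed.

Lemma Lpint_interp p q (e : R) f : 0 < p -> p <= q -> 0 < e -> cmeas f ->
  (Lpint p f <= (e * mass mu)%:E + (e `^ (1 - q / p))%:E * Lpint q f)%E.
Proof.
move=> p0 pq e0 mf; rewrite EFinM (massE Gcompact Ghaar) -integral_cst//.
have nq (x : T) : [set: T] x -> (0 <= (cabs (f x) `^ q)%:E)%E.
  by rewrite lee_fin powR_ge0.
have c0 : 0 <= e `^ (1 - q / p) by exact: powR_ge0.
rewrite -(ge0_integralZl_EFin mu measurableT nq (cmeas_powR q mf) c0).
rewrite -ge0_integralD//; first last.
- apply/measurable_EFinP; apply: measurable_funM => //.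
  by apply/measurable_EFinP; exact: cmeas_powR.
- by move=> x _; rewrite lee_fin mulr_ge0// powR_ge0.
- by move=> x _; rewrite lee_fin ltW.
apply: ge0_le_integral => //.
- by move=> x _; rewrite lee_fin powR_ge0.
- exact: (cmeas_powR p mf).
- apply/measurable_EFinP; apply: measurable_funD => //; apply: measurable_funM => //.
  by apply/measurable_EFinP; exact: cmeas_powR.
- by move=> x _; rewrite -EFinM -EFinD lee_fin; apply: powR_interp => //; exact: cabs_ge0.
Qed.

Lemma Lpint_lty p q f : 0 < p -> p <= q -> cmeas f ->
  (Lpint q f < +oo)%E -> (Lpint p f < +oo)%E.
Proof.
move=> p0 pq mf qf; apply: le_lt_trans (Lpint_interp p0 pq ltr01 mf) _.
by rewrite lte_add_pinfty ?ltry// lte_mul_pinfty// lee_fin powR_ge0.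
Qed.

(** The threshold [a] and the bound on [Lpint q] are chosen so that each term of [Lpint_interp]
    contributes [e / 2]. *)
Lemma Lpint_small p q (e : R) : 0 < p -> p <= q -> 0 < e ->
  exists2 d : R, 0 < d & forall f, cmeas f -> (Lpint q f <= d%:E)%E -> (Lpint p f <= e%:E)%E.
Proof.
move=> p0 pq e0; have m0 := mass_gt0 Gcompact Ghaar.
pose a := e / (2 * mass mu); have a0 : 0 < a by rewrite divr_gt0// mulr_gt0.
have b0 : 0 < a `^ (1 - q / p) by rewrite powR_gt0.
exists (e / (2 * a `^ (1 - q / p))); first by rewrite divr_gt0// mulr_gt0.
move=> f mf hf; apply: (le_trans (Lpint_interp p0 pq a0 mf)).
have b0' : (0 <= (a `^ (1 - q / p))%:E :> \bar R)%E by rewrite lee_fin ltW.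
apply: (le_trans (leeD2l _ (lee_wpmul2l b0' hf))).
rewrite -EFinM -EFinD lee_fin.
rewrite le_eqVlt; apply/orP; left; apply/eqP; rewrite /a.
move: (gt_eqF b0); rewrite -/a; set b := a `^ _; move=> /negbT b1.
by rewrite /a; field; rewrite b1 gt_eqF.
Qed.

Lemma Lpint1_CL1 f : cmeas f -> (Lpint 1 f < +oo)%E -> CL1 mu f.
Proof.
move=> mf fin.
have icabs : mu.-integrable [set: T] (EFin \o (fun x : T => cabs (f x))).
  apply/integrableP; split; first by apply/measurable_EFinP; exact: cmeas_cabs.
  apply: le_lt_trans fin; rewrite le_eqVlt; apply/orP; left; apply/eqP.
  apply: eq_integral => x _ /=.
  by rewrite ger0_norm ?cabs_ge0// powRr1// cabs_ge0.
split; apply: (le_integrable measurableT _ _ icabs).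
- by apply/measurable_EFinP; have [] := mf.
- by move=> x _ /=; rewrite lee_fin (le_trans (normRe_cabs _))// ler_norm.
- by apply/measurable_EFinP; have [] := mf.
- by move=> x _ /=; rewrite lee_fin (le_trans (normIm_cabs _))// ler_norm.
Qed.

Lemma mean_cabs_Lpint f : CL1 mu f -> (mass mu * mean mu (fun x => cabs (f x)))%:E = Lpint 1 f.
Proof.
move=> f1; have fi := integrable_fin_num measurableT (CL1_cabs f1).
rewrite /mean mulrA /dual_weight mulfV ?mul1r ?(gt_eqF (mass_gt0 Gcompact Ghaar))//.
rewrite /Rintegral (fineK fi); apply: eq_integral => x _.
by rewrite powRr1// cabs_ge0.
Qed.

Lemma Lpint_ae p f g : cmeas f -> cmeas g -> {ae mu, forall x, f x = g x} ->
  Lpint p f = Lpint p g.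
Proof.
move=> mf mg fg; apply: ge0_ae_eq_integral => //.
- exact: cmeas_powR.
- exact: cmeas_powR.
- by move=> x _; rewrite lee_fin powR_ge0.
- by move=> x _; rewrite lee_fin powR_ge0.
- have [N [mN N0 sub]] := fg; exists N; split => // x h; apply: sub => fgx.
  by apply: h => _; rewrite fgx.
Qed.

End complex_Lp.

(** * Trigonometric polynomials *)

Section trig.
Variables (R : realType) (G : topologicalZmodType).
Variable mu : {measure set (borel G) -> \bar R}.
Hypothesis Ghaus : hausdorff_space G.
Hypothesis Gcompact : compact [set: G].
Hypothesis Ghaar : haar_measure mu.

Let T := borel G.
Implicit Types (f g h xi eta : G -> R[i]) (c : (G -> R[i]) -> R[i])
  (F : seq (G -> R[i])).

(** The coefficient for the normalized mean, in which the characters are orthonormal; it differs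
    from [fourier] by the factor [mass mu]. *)
Definition coef f xi : R[i] := CE mu (fun x => (xi x)^* * f x).

Lemma mean_integral (h : G -> R) : L1 mu h ->
  (mass mu * mean mu h)%:E = (\int[mu]_(x in [set: T]) (h x)%:E)%E.
Proof.
move=> h1; rewrite /mean mulrA /dual_weight mulfV ?mul1r ?(gt_eqF (mass_gt0 Gcompact Ghaar))//.
by rewrite /Rintegral (fineK (integrable_fin_num measurableT h1)).
Qed.

Lemma fourierE f xi : fourier mu f xi = (mass mu)%:C%C * coef f xi.
Proof.
have m0 : mass mu != 0 by rewrite gt_eqF// mass_gt0.
apply: eq_ReIm; rewrite ?Re_mul ?Im_mul /coef !(Re_CE, Im_CE) mul0r ?subr0 ?addr0.
  by rewrite /mean mulrA mulfV// mul1r.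
by rewrite /mean mulrA mulfV// mul1r.
Qed.

Lemma cabs_dual xi x : dual xi -> cabs (xi x) = 1.
Proof. by case. Qed.

Lemma dual_conjM xi x : dual xi -> (xi x)^* * xi x = 1.
Proof. by move=> dxi; rewrite mulrC -sqr_cabsE cabs_dual// expr1n. Qed.

Lemma fcoefD f g xi : dual xi -> CL1 mu f -> CL1 mu g ->
  coef (fun x => f x + g x) xi = coef f xi + coef g xi.
Proof.
move=> /dual_ccont/ccont_conj cxi f1 g1; rewrite /coef -CED; [|exact: ccontM_CL1..].
by apply: eq_CE => x; rewrite mulrDr.
Qed.

Lemma fcoefB f g xi : dual xi -> CL1 mu f -> CL1 mu g ->
  coef (fun x => f x - g x) xi = coef f xi - coef g xi.
Proof.
move=> /dual_ccont/ccont_conj cxi f1 g1; rewrite /coef -CEB; [|exact: ccontM_CL1..].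
by apply: eq_CE => x; rewrite mulrBr.
Qed.

Lemma cabs_coef_le f xi : dual xi -> CL1 mu f ->
  ((mass mu * cabs (coef f xi))%:E <= Lpint mu 1 f)%E.
Proof.
move=> dxi f1; have cxi := ccont_conj (dual_ccont dxi).
rewrite -(mean_cabs_Lpint Gcompact Ghaar f1) lee_fin ler_pM2l ?mass_gt0//.
rewrite (le_trans (cabs_CE Gcompact Ghaar (ccontM_CL1 Gcompact cxi f1)))// le_eqVlt.
apply/orP; left; apply/eqP; apply: eq_mean => x.
by rewrite cabsM cabs_conj cabs_dual// mul1r.
Qed.

(** Translating by a point [a] where the characters differ multiplies the mean by [z != 1], yet the
    mean is invariant. *)
Lemma dual_orthogonal xi eta : dual xi -> dual eta -> xi <> eta -> coef eta xi = 0.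
Proof.
move=> dxi deta ne.
have [a xa] : exists a, xi a <> eta a.
  apply: contrapT => h; apply: ne; apply/funext => a.
  by apply: contrapT => ha; apply: h; exists a.
have cc : ccont (fun x => (xi x)^* * eta x).
  by apply: ccontM; [apply: ccont_conj|]; exact: dual_ccont.
pose z := (xi a)^* * eta a.
have zcoef : z * coef eta xi = coef eta xi.
  rewrite /coef -CEZ; last exact: ccont_CL1.
  rewrite -[RHS](CE_shift Gcompact Ghaar a cc); apply: eq_CE => x.
  by have [xiD _ _ _] := dxi; have [etaD _ _ _] := deta;
    rewrite xiD etaD rmorphM/= /z; ring.
have z1 : z != 1.
  apply/eqP => z1; apply: xa.
  by rewrite -[LHS]mulr1 -z1 /z mulrA [xi a * _]mulrC dual_conjM// mul1r.
move/eqP: zcoef; rewrite -subr_eq0 -[X in _ - X]mul1r -mulrBl mulf_eq0.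
by rewrite subr_eq0 (negbTE z1)/= => /eqP.
Qed.

Lemma dual_normal xi : dual xi -> coef xi xi = 1.
Proof.
move=> dxi; rewrite -[RHS](CE_cst Gcompact Ghaar 1); apply: eq_CE => x.
exact: dual_conjM.
Qed.

Lemma CE_sum (I : Type) (r : seq I) (H : I -> G -> R[i]) : (forall i, CL1 mu (H i)) ->
  CE mu (fun x => \sum_(i <- r) H i x) = \sum_(i <- r) CE mu (H i).
Proof.
move=> hH; have hr s : CL1 mu (fun x => \sum_(i <- s) H i x).
  elim: s => [|i s IH].
    under eq_fun do rewrite big_nil.
    exact/(ccont_CL1 Gcompact Ghaar)/ccont_cst.
  by under eq_fun do rewrite big_cons; exact: CL1D.
elim: r => [|i r IH].
  by under eq_CE do rewrite big_nil; rewrite big_nil CE_cst.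
by under eq_CE do rewrite big_cons; rewrite big_cons CED ?IH.
Qed.

Definition trig F c x : R[i] := \sum_(xi <- F) c xi * xi x.

Lemma trig_cons xi F c x : trig (xi :: F) c x = c xi * xi x + trig F c x.
Proof. by rewrite /trig big_cons. Qed.

Lemma ccont_trig F c : {in F, forall xi, dual xi} -> ccont (trig F c).
Proof.
elim: F => [|xi F IH] dF.
  by apply: (@eq_ccont _ _ (fun=> 0)); [move=> x; rewrite /trig big_nil|exact: ccont_cst].
apply: (@eq_ccont _ _ (fun x => c xi * xi x + trig F c x)).
  by move=> x; rewrite trig_cons.
apply: ccontD; last by apply: IH => eta eF; apply: dF; rewrite inE eF orbT.
by apply: ccontZ; apply: dual_ccont; apply: dF; rewrite inE eqxx.
Qed.

Lemma CL1_trig F c : {in F, forall xi, dual xi} -> CL1 mu (trig F c).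
Proof. by move=> dF; apply: ccont_CL1 => //; exact: ccont_trig. Qed.

Lemma coef_trig F c eta : uniq F -> {in F, forall xi, dual xi} -> dual eta ->
  coef (trig F c) eta = if eta \in F then c eta else 0.
Proof.
move=> + + deta; elim: F => [_ _|xi F IH /=/andP[xiF uF] dF].
  rewrite -[RHS](CE_cst Gcompact Ghaar 0); apply: eq_CE => x.
  by rewrite /trig big_nil mulr0.
have dF' : {in F, forall xi, dual xi} by move=> t tF; apply: dF; rewrite inE tF orbT.
have dxi : dual xi by apply: dF; rewrite inE eqxx.
have x1 := ccont_CL1 Gcompact Ghaar (dual_ccont dxi).
have -> : coef (trig (xi :: F) c) eta = c xi * coef xi eta + coef (trig F c) eta.
  have E : trig (xi :: F) c = fun x => c xi * xi x + trig F c x.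
    by apply/funext => x; exact: trig_cons.
  rewrite E fcoefD//; [congr (_ + _)|exact: CL1Z|exact: CL1_trig].
  rewrite /coef -CEZ; last first.
    by apply: ccontM_CL1 => //; exact/ccont_conj/dual_ccont.
  by apply: eq_CE => x; rewrite mulrCA.
rewrite IH// inE; have [->|ne] := eqVneq eta xi.
  by rewrite (negbTE xiF) dual_normal// mulr1 addr0.
rewrite dual_orthogonal//= ?mulr0 ?add0r//; exact/eqP.
Qed.

Lemma N2_trig F c : uniq F -> {in F, forall xi, dual xi} ->
  N2 mu (trig F c) = \sum_(xi <- F) cabs (c xi) ^+ 2.
Proof.
move=> uF dF; have ct := ccont_trig c dF.
apply: (@complexI R); rewrite N2E// rmorph_sum.
(* The guard [*+ (xi \in F)] makes every summand integrable, as [CE_sum] requires for all indices;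
   only members of [F] are known to be characters. *)
have E x : trig F c x * (trig F c x)^* =
    \sum_(xi <- F) c xi * (xi x * (trig F c x)^* *+ (xi \in F)).
  rewrite {1}/trig mulr_suml; apply: eq_big_seq => xi xiF.
  by rewrite xiF mulr1n mulrA.
under eq_CE do rewrite E.
have l1 xi : CL1 mu (fun x => xi x * (trig F c x)^* *+ (xi \in F)).
  case: (boolP (xi \in F)) => xiF; last exact/(ccont_CL1 Gcompact Ghaar)/ccont_cst.
  apply: ccont_CL1 => //; apply: ccontM; last exact: ccont_conj.
  exact/dual_ccont/dF.
rewrite CE_sum; last by move=> xi; exact: CL1Z.
apply: eq_big_seq => xi xiF; rewrite CEZ//.
rewrite -[RHS]/((cabs (c xi) ^+ 2)%:C%C) sqr_cabsE; congr (_ * _).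
have dxi := dF _ xiF.
have <- : coef (trig F c) xi = c xi by rewrite coef_trig// xiF.
rewrite /coef -CE_conj; last first.
  by apply: ccont_CL1 => //; apply: ccontM => //; exact/ccont_conj/dual_ccont.
by apply: eq_CE => x; rewrite xiF mulr1n rmorphM/= conjCK.
Qed.

Let sqr_sum_le (I : Type) (r : seq I) (a : I -> R) :
  (\sum_(i <- r) a i) ^+ 2 <= (size r)%:R * \sum_(i <- r) a i ^+ 2.
Proof.
have aux (b : R) (s : seq I) :
    2 * b * \sum_(i <- s) a i <= (size s)%:R * b ^+ 2 + \sum_(i <- s) a i ^+ 2.
  elim: s => [|i s IH]; first by rewrite !big_nil mulr0 mul0r addr0.
  rewrite !big_cons [(size _)%:R]/= -natr1.
  have := sqr_ge0 (b - a i); nra.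
elim: r => [|i r IH]; first by rewrite !big_nil mul0r expr0n.
rewrite !big_cons /= -natr1; have := aux (a i) r; move: IH.
set S := \sum_(i <- r) a i; set Q := \sum_(i <- r) _; nra.
Qed.

Lemma cabs_trig F c x : {in F, forall xi, dual xi} ->
  cabs (trig F c x) ^+ 2 <= (size F)%:R * \sum_(xi <- F) cabs (c xi) ^+ 2.
Proof.
move=> dF; apply: le_trans (sqr_sum_le F (fun xi => cabs (c xi))).
rewrite lerXn2r ?nnegrE ?cabs_ge0//.
  by apply: sumr_ge0 => xi _; exact: cabs_ge0.
rewrite (le_trans (cabs_sum _ _ _))// le_eqVlt; apply/orP; left; apply/eqP.
by apply: eq_big_seq => xi xiF; rewrite cabsM cabs_dual ?mulr1//; exact: dF.
Qed.

(** Write [|S|^p] as [|S|^(p-2)] times [|S|^2]. The first factor is bounded pointwise by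
    Cauchy-Schwarz over the [nu] frequencies, the second is integrated by Parseval. *)
Lemma Lpint_trig p F c (nu E : R) : 2 <= p -> uniq F -> {in F, forall xi, dual xi} ->
  (size F)%:R <= nu -> \sum_(xi <- F) cabs (c xi) ^+ 2 <= E ->
  (Lpint mu p (trig F c) <= ((nu * E) `^ ((p - 2) / 2) * (mass mu * E))%:E)%E.
Proof.
move=> p2 uF dF Fnu cE; have ct := ccont_trig c dF.
have Q0 : 0 <= \sum_(xi <- F) cabs (c xi) ^+ 2 by apply: sumr_ge0 => xi _; exact: sqr_ge0.
have E0 : 0 <= E := le_trans Q0 cE.
have nu0 : 0 <= nu by rewrite (le_trans _ Fnu).
have p2' : 0 <= (p - 2) / 2 by rewrite divr_ge0// subr_ge0.
have l2 : L1 mu (fun x => cabs (trig F c x) ^+ 2).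
  by apply: (continuous_L1 Gcompact Ghaar); exact: sqr_cabs_continuous.
have B0 : 0 <= (nu * E) `^ ((p - 2) / 2) by exact: powR_ge0.
apply: (@le_trans _ _ (((nu * E) `^ ((p - 2) / 2))%:E *
  \int[mu]_(x in [set: T]) (cabs (trig F c x) ^+ 2)%:E)%E).
  have mt := L1_measurable l2.
  rewrite -ge0_integralZl_EFin//; [|by move=> x _; rewrite lee_fin sqr_ge0|exact/measurable_EFinP].
  apply: ge0_le_integral => //.
  - by move=> x _; rewrite lee_fin powR_ge0.
  - exact: (cmeas_powR p (cmeas_ccont ct)).
  - by apply/measurable_EFinP; exact: measurable_funM.
  - move=> x _; rewrite -EFinM lee_fin.
    set t := cabs _; have t0 : 0 <= t by exact: cabs_ge0.
    (* The case [t = 0] is separate because adding exponents requires a nonzero base or a nonzero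
       total exponent; here [p >= 2] makes both sides 0. *)
    have -> : t `^ p = (t ^+ 2) `^ ((p - 2) / 2) * t ^+ 2.
      have [->|tn0] := eqVneq t 0.
        by rewrite powR0 ?gt_eqF ?expr0n ?mulr0// (lt_le_trans _ p2).
      rewrite -(powR_mulrn 2)// -powRrM -powRD; last by rewrite tn0 implybT.
      by congr (_ `^ _); field.
    have tle : t ^+ 2 <= nu * E.
      by apply: le_trans (cabs_trig c x dF) _; exact: ler_pM.
    apply: ler_wpM2r; first exact: sqr_ge0.
    by apply: ge0_ler_powR => //; rewrite nnegrE ?sqr_ge0// mulr_ge0.
rewrite -mean_integral// -EFinM lee_fin ler_wpM2l// ler_pM2l ?mass_gt0//.
by have := N2_trig c uF dF; rewrite /N2 => ->.
Qed.

Lemma coef_eq0_ae f : CL1 mu f -> (forall xi, dual xi -> coef f xi = 0) ->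
  {ae mu, forall x, f x = 0}.
Proof.
move=> f1 f0; have [rf jf] := f1.
have ortho (phi : G -> R) : continuous phi ->
    CE mu (fun x => (phi x)%:C%C * f x) = 0.
  move=> cphi; apply: (CL1_ortho Gcompact Ghaar f1 f0).
  by split => //= x; exact: cvg_cst.
have r0 : {ae mu, forall x, complex.Re (f x) = 0}.
  apply: (ae_zero Ghaus Gcompact Ghaar rf) => phi /ortho/(congr1 (@complex.Re R)) h.
  rewrite -[RHS]/(@complex.Re R 0) -h Re_CE; apply: eq_mean => x.
  by rewrite Re_mul/= mul0r subr0.
have j0 : {ae mu, forall x, complex.Im (f x) = 0}.
  apply: (ae_zero Ghaus Gcompact Ghaar jf) => phi /ortho/(congr1 (@complex.Im R)) h.
  rewrite -[RHS]/(@complex.Im R 0) -h Im_CE; apply: eq_mean => x.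
  by rewrite Im_mul/= mul0r addr0.
have FF := ae_filter_ringOfSetsType mu.
move: r0 j0; apply: filterS2 => x rx jx; exact: eq_ReIm.
Qed.

End trig.

(** * Dyadic decomposition *)

Section dyadic.
Variables (R : realType) (G : topologicalZmodType).
Variable mu : {measure set (borel G) -> \bar R}.
Hypothesis Ghaus : hausdorff_space G.
Hypothesis Gcompact : compact [set: G].
Hypothesis Ghaar : haar_measure mu.

Implicit Types (f g xi : G -> R[i]) (F : seq (G -> R[i])).

Lemma sum_le_esum (I : choiceType) (D : set I) (t : I -> R) (r : seq I) :
  uniq r -> {in r, forall i, D i} ->
  ((\sum_(i <- r) t i)%:E <= esum D (fun i => (t i)%:E))%E.
Proof.
move=> ur rD; apply: esum_ge; exists [set` r].
  by split; [exact: finite_seq|move=> i /= ir; exact: rD].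
by rewrite -fsbig_seq// sumEFin.
Qed.

(** * Series with geometric increments in L^p *)

Section geometric_tail.
Variables (p L theta : R) (S : nat -> G -> R[i]).
Hypotheses (p1 : 1 <= p) (L0 : 0 < L) (theta0 : 0 < theta) (theta1 : theta < 1).
Hypothesis cS : forall n, ccont (S n).
Hypothesis dS : forall k,
  (Lpint mu p (fun x => (S k.+1 x - S k x)%R) <= ((L * theta ^+ k) `^ p)%:E)%E.

Definition tail k := L * theta ^+ k / (1 - theta).

Let th : 0 < 1 - theta. Proof. by rewrite subr_gt0. Qed.

Lemma tail_gt0 k : 0 < tail k.
Proof. by rewrite divr_gt0// mulr_gt0// exprn_gt0. Qed.

Let p0 : 0 < p. Proof. by rewrite (lt_le_trans _ p1). Qed.

Lemma Lpint_tail k n :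
  (Lpint mu p (fun x => (S (k + n)%N x - S k x)%R) <= (tail k `^ p)%:E)%E.
Proof.
have mS j := cmeas_ccont (cS j).
(* The exact finite geometric sum is what the induction carries; [tail k] is its value for n
   infinite. *)
pose A n := L * theta ^+ k * (1 - theta ^+ n) / (1 - theta).
have A0 j : 0 <= A j.
  rewrite divr_ge0 ?(ltW th)// mulr_ge0//; first by rewrite mulr_ge0 ?exprn_ge0// ltW.
  by rewrite subr_ge0 exprn_ile1// ltW.
apply: (@le_trans _ _ (A n `^ p)%:E); last first.
  rewrite lee_fin ge0_ler_powR ?nnegrE ?A0 ?(ltW (tail_gt0 k)) ?(ltW p0)//.
  rewrite ler_wpM2r ?invr_ge0 ?(ltW th)//; apply: ler_piMr.
    by rewrite mulr_ge0 ?exprn_ge0// ltW.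
  by rewrite gerBl exprn_ge0// ltW.
elim: n => [|n IH].
  rewrite addn0 /A expr0 subrr mulr0 mul0r powR0 ?gt_eqF//.
  rewrite /Lpint integral0_eq// => x _.
  by rewrite subrr cabs0 powR0// gt_eqF.
have -> : A n.+1 = A n + L * theta ^+ (k + n).
  by rewrite /A exprS exprD; field; rewrite gt_eqF.
rewrite addnS.
have -> : Lpint mu p (fun x => S (k + n).+1 x - S k x) =
    Lpint mu p (fun x => (S (k + n)%N x - S k x) + (S (k + n).+1 x - S (k + n)%N x)).
  by apply: eq_integral => x _; congr ((cabs _ `^ p)%:E); ring.
apply: Lpint_minkowski => //.
- by rewrite mulr_ge0 ?exprn_ge0 ?ltW.
- exact: cmeasB.
- exact: cmeasB.
Qed.

(** The factor 2 leaves room for two errors of size [tail k]: from the limit to a late partial sum,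
    and from there to the sum of index [k]. *)
Lemma tail_small (e : R) : 0 < e -> exists k, (2 * tail k) `^ p <= e.
Proof.
move=> e0; have b0 : 0 < e `^ p^-1 * (1 - theta) / (2 * L).
  by rewrite divr_gt0 ?mulr_gt0// powR_gt0.
have : `|theta| < 1 by rewrite gtr0_norm.
move=> /cvg_expr/cvgrPdist_le/(_ _ b0)[k _ /(_ k (leqnn k))].
rewrite sub0r normrN ger0_norm ?exprn_ge0 ?(ltW theta0)// => hk.
exists k; rewrite -[leRHS](_ : (e `^ p^-1) `^ p = e); last first.
  by rewrite -powRrM mulVf ?gt_eqF// powRr1// ltW.
rewrite ge0_ler_powR ?nnegrE ?powR_ge0 ?(ltW p0)//.
  by rewrite mulr_ge0// ltW// tail_gt0.
move: hk; rewrite ler_pdivlMr ?mulr_gt0// /tail => hk.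
by rewrite mulrA ler_pdivrMr// (le_trans _ hk)// le_eqVlt; apply/orP; left; apply/eqP; ring.
Qed.

Lemma Lpint_tail_limit : exists2 g, CL1 mu g & forall e : R, 0 < e ->
  exists N, forall n, (N <= n)%N -> (Lpint mu p (fun x => (S n x - g x)%R) <= e%:E)%E.
Proof.
have mS j := cmeas_ccont (cS j).
have cauchyS e : 0 < e -> exists N, forall n m, (N <= n)%N -> (N <= m)%N ->
    (Lpint mu p (fun x => (S n x - S m x)%R) <= e%:E)%E.
  move=> /tail_small[N hN]; exists N => n m Nn Nm.
  wlog nm : n m Nn Nm / (m <= n)%N.
    by move=> h; have [|/ltnW] := leqP m n; [exact: h|rewrite LpintB; exact: h].
  rewrite -(subnKC nm); apply: (le_trans (Lpint_tail _ _)).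
  rewrite lee_fin (le_trans _ hN)// ge0_ler_powR ?nnegrE ?(ltW p0) ?(ltW (tail_gt0 _))//.
    by rewrite mulr_ge0// ltW// tail_gt0.
  apply: (@le_trans _ _ (tail N)).
    rewrite /tail ler_wpM2r ?invr_ge0 ?(ltW th)// ler_wpM2l ?(ltW L0)//.
    by rewrite ler_wiXn2l ?ltW.
  by rewrite ler_peMl ?(ltW (tail_gt0 _))// ler1n.
have [g mg Sg] := cauchy_Lpint_limit p1 mS cauchyS.
exists g => //; have [N /(_ N (leqnn N)) hN] := Sg 1 ltr01.
have d1 : CL1 mu (fun x => S N x - g x).
  apply: Lpint1_CL1; first exact: cmeasB.
  apply: (Lpint_lty Gcompact Ghaar ltr01 p1); first exact: cmeasB.
  by rewrite (le_lt_trans hN)// ltry.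
have -> : g = fun x => S N x - (S N x - g x) by apply/funext => x; rewrite subKr.
by apply: CL1B => //; exact: ccont_CL1.
Qed.

End geometric_tail.

(** * Levels and blocks of the dual *)

Variables (gamma : (G -> R[i]) -> R) (s alpha : R).
Hypotheses (s_gt0 : 0 < s) (s_alpha : s < alpha).
Hypothesis gamma_sum : (esum (@dual R G) (fun xi => (dual_weight mu
      * ((1 + gamma xi ^+ 2)^-1) `^ alpha)%:E) < +oo)%E.

Let a xi : R := 1 + gamma xi ^+ 2.

Let a1 xi : 1 <= a xi. Proof. by rewrite lerDl sqr_ge0. Qed.

Let a0 xi : 0 < a xi. Proof. exact: lt_le_trans (a1 xi). Qed.

Let alpha0 : 0 < alpha. Proof. exact: lt_trans s_alpha. Qed.

(** The factor [mass mu] undoes [dual_weight mu], so that characters are counted with weight 1; the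
    [+ 1] makes [K] positive. *)
Let K : R := fine (esum (@dual R G) (fun xi => (dual_weight mu
  * ((1 + gamma xi ^+ 2)^-1) `^ alpha)%:E)) * mass mu + 1.

Let K0 : 0 < K.
Proof.
rewrite ltr_wpDl// mulr_ge0 ?(ltW (mass_gt0 Gcompact Ghaar))//.
apply: fine_ge0; apply: esum_ge0 => xi _.
by rewrite lee_fin mulr_ge0 ?powR_ge0// ltW// (weight_gt0 Gcompact Ghaar).
Qed.

(** Markov's inequality for the weighted counting measure: each character with [a xi <= N]
    contributes at least [dual_weight mu] times [N ^ (- alpha)] to the finite sum. *)
Let level_size F (N : R) : 0 < N -> uniq F ->
  {in F, forall xi, dual xi /\ a xi <= N} -> (size F)%:R <= K * N `^ alpha.
Proof.
move=> N0 uF hF; have m0 := mass_gt0 Gcompact Ghaar.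
have w0 := weight_gt0 Gcompact Ghaar.
pose E := esum (@dual R G) (fun xi => (dual_weight mu
  * ((1 + gamma xi ^+ 2)^-1) `^ alpha)%:E).
have dF : {in F, forall xi, dual xi} by move=> xi /hF[].
have := sum_le_esum (fun xi => dual_weight mu * ((1 + gamma xi ^+ 2)^-1) `^ alpha) uF dF.
rewrite -/E.
have E0 : (0 <= E)%E.
  apply: esum_ge0 => xi _; rewrite lee_fin mulr_ge0 ?powR_ge0//; exact: ltW.
rewrite -(@fineK _ E); last by rewrite ge0_fin_numE.
rewrite lee_fin => hE; have KE : K = fine E * mass mu + 1 by [].
have : \sum_(xi <- F) dual_weight mu * (N^-1) `^ alpha <= fine E.
  apply: le_trans hE; rewrite big_seq [leRHS]big_seq; apply: ler_sum => xi xiF.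
  rewrite ler_wpM2l ?(ltW w0)//; apply: ge0_ler_powR.
  - exact: ltW.
  - by rewrite nnegrE invr_ge0 ltW.
  - by rewrite nnegrE invr_ge0 ltW// a0.
  - by rewrite lef_pV2 ?posrE ?a0//; have [] := hF _ xiF.
rewrite big_const_seq count_predT iter_addr_0 => h.
rewrite -mulr_natl in h.
have NN : (N^-1) `^ alpha * N `^ alpha = 1.
  by rewrite -powRM ?invr_ge0 ?(ltW N0)// mulVf ?gt_eqF// powR1.
have wm : dual_weight mu * mass mu = 1 by rewrite mulVf// gt_eqF.
have Na : 0 < N `^ alpha by rewrite powR_gt0.
have : (size F)%:R <= fine E * mass mu * N `^ alpha.
  have -> : (size F)%:R = (size F)%:R * (dual_weight mu * (N^-1) `^ alpha)
      * (mass mu * N `^ alpha) :> R.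
    by rewrite -mulrA mulrACA wm NN !mulr1.
  have mN : 0 <= mass mu * N `^ alpha by rewrite mulr_ge0// ltW.
  rewrite -[leRHS]mulrA. exact: (ler_wpM2r mN h).
by move=> /le_trans; apply; rewrite KE ler_pM2r// lerDl.
Qed.

Let level_finite (N : R) : 0 < N -> finite_set [set xi | dual xi /\ a xi <= N].
Proof.
move=> N0; apply: contrapT => inf.
have [B BA hB] := infinite_set_fset (Num.truncn (K * N `^ alpha)).+1 inf.
have := @level_size (finmap.enum_fset B) N N0 (finmap.fset_uniq B) _.
move=> /(_ (fun xi xiB => BA xi xiB)).
rewrite leNgt => /negP; apply.
by rewrite (lt_le_trans (truncnS_gt _))// ler_nat.
Qed.


Let level k : seq (G -> R[i]) :=
  finmap.enum_fset (fset_set [set xi | dual xi /\ a xi <= 2 ^+ k]).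

Let mem_level k xi : xi \in level k <-> dual xi /\ a xi <= 2 ^+ k.
Proof.
have fin : finite_set [set xi | dual xi /\ a xi <= 2 ^+ k].
  by apply: level_finite; rewrite exprn_gt0.
by have := in_fset_set fin xi; rewrite /level => ->; rewrite inE.
Qed.

Let level_uniq k : uniq (level k).
Proof. exact: finmap.fset_uniq. Qed.

Let level_dual k : {in level k, forall xi, dual xi}.
Proof. by move=> xi /mem_level[]. Qed.

Let block k : seq (G -> R[i]) := [seq xi <- level k.+1 | ~~ (a xi <= 2 ^+ k)].

Let block_uniq k : uniq (block k).
Proof. exact: filter_uniq. Qed.

Let block_dual k : {in block k, forall xi, dual xi}.
Proof. by move=> xi; rewrite mem_filter => /andP[_ /level_dual]. Qed.

Let trig_level_succ k (c : (G -> R[i]) -> R[i]) x :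
  trig (level k.+1) c x = trig (level k) c x + trig (block k) c x.
Proof.
rewrite /trig (bigID (fun xi => a xi <= 2 ^+ k)) -!(big_filter _ (fun xi => ~~ _)).
congr (_ + _); rewrite -big_filter; apply: perm_big; apply: uniq_perm => //.
  exact: filter_uniq.
move=> xi; rewrite mem_filter; apply/andP/idP.
  by move=> [xk /mem_level[dxi _]]; apply/mem_level.
move=> /mem_level[dxi xk]; split => //; apply/mem_level; split => //.
by rewrite (le_trans xk)// ler_weXn2l// ler1n.
Qed.

Let block_size k : (size (block k))%:R <= K * (2 ^+ k.+1) `^ alpha.
Proof.
apply: level_size; [by rewrite exprn_gt0|exact: block_uniq|].
by move=> xi; rewrite mem_filter => /andP[_ /mem_level].
Qed.

Let powR_exprn (x : R) (k : nat) (y : R) : 0 <= x -> (x ^+ k) `^ y = (x `^ y) ^+ k.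
Proof.
move=> x0; elim: k => [|k IH]; first by rewrite !expr0 powR1.
by rewrite !exprS powRM ?exprn_ge0// IH.
Qed.

Let powR_pow2 (k : nat) (y : R) : (2 ^+ k) `^ y = (2 `^ y) ^+ k.
Proof. exact: powR_exprn. Qed.

Lemma trig_approx_gt0 (p M e : R) : 2 <= p -> p < 2 * alpha / (alpha - s) ->
  0 < M -> 0 < e ->
  exists F, [/\ uniq F, {in F, forall xi, dual xi} &
    forall f, CL1 mu f ->
      (forall F', uniq F' -> {in F', forall xi, dual xi} ->
        \sum_(xi <- F') (1 + gamma xi ^+ 2) `^ s * cabs (coef mu f xi) ^+ 2 <= M) ->
      (Lpint mu p (fun x => (f x - trig F (coef mu f) x)%R) <= e%:E)%E].
Proof.
move=> p2 pa M0 e0; have m0 := mass_gt0 Gcompact Ghaar.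
have p1 : 1 <= p by rewrite (le_trans _ p2)// ler1n.
have p0 : 0 < p by rewrite (lt_le_trans _ p1).
pose r := (p - 2) / 2.
(* [tau] is the ratio of the bounds for consecutive blocks: size times energy grows like
   [2^(k (alpha - s))] and is raised to the power [r], while the energy decays like [2^(- k s)]. The
   exponent is negative exactly when [p (alpha - s) < 2 alpha]. *)
pose tau := 2 `^ ((alpha - s) * r - s).
have tau0 : 0 < tau by rewrite powR_gt0.
have tau1 : tau < 1.
  have as0 : 0 < alpha - s by rewrite subr_gt0.
  have neg : (alpha - s) * r - s < 0.
    by move: pa; rewrite ltr_pdivlMr// /r => pa; lra.
  rewrite /tau -[ltRHS](powRr0 2) /powR (gt_eqF (_ : 0 < 2))//.
  by rewrite ltr_expR ltr_pM2r// ln_gt0// ltr1n.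
(* The bound of [Lpint_trig] at k = 0; the factor [2 ^ alpha] comes from block k being counted
   inside level k + 1. *)
pose X := (K * 2 `^ alpha * M) `^ r * (mass mu * M).
have X0 : 0 < X.
  by rewrite mulr_gt0 ?powR_gt0 ?mulr_gt0 ?powR_gt0.
(* Roots of order p, since the geometric series is summed in the norm while [X * tau ^+ k] bounds
   its p-th power. *)
pose L := X `^ p^-1; pose theta := tau `^ p^-1.
have L0 : 0 < L by rewrite powR_gt0.
have theta0 : 0 < theta by rewrite powR_gt0.
have theta1 : theta < 1.
  have := gt0_ltr_powR (_ : 0 < p^-1) (_ : tau \in Num.nneg) (_ : 1 \in Num.nneg) tau1.
  by rewrite powR1; apply; rewrite ?invr_gt0 ?nnegrE ?ltW.
have LX k : (L * theta ^+ k) `^ p = X * tau ^+ k.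
  rewrite powRM ?exprn_ge0 ?ltW// /L -powRrM mulVf ?gt_eqF// powRr1 ?(ltW X0)//.
  congr (_ * _); rewrite powR_exprn ?(ltW theta0)//.
  by rewrite /theta -powRrM mulVf ?gt_eqF// powRr1// ltW.
have [k0 hk0] := tail_small p1 L0 theta0 theta1 e0.
exists (level k0); split => //.
move=> f f1 hM.
pose S k := trig (level k) (coef mu f).
have cS k : ccont (S k) by apply: ccont_trig; exact: level_dual.
have dS k : (Lpint mu p (fun x => (S k.+1 x - S k x)%R) <= ((L * theta ^+ k) `^ p)%:E)%E.
  have -> : Lpint mu p (fun x => S k.+1 x - S k x) = Lpint mu p (trig (block k) (coef mu f)).
    apply: eq_integral => x _; congr ((cabs _ `^ p)%:E).
    by rewrite /S trig_level_succ; ring.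
  have E0 : 0 <= (2 `^ (- s)) ^+ k * M by rewrite mulr_ge0 ?exprn_ge0 ?powR_ge0 ?ltW.
  (* On block k the weight [a xi ^ s] is at least [2^(k s)], so the weighted bound [M] leaves energy
     at most [2^(- k s) M]. *)
  have hE : \sum_(xi <- block k) cabs (coef mu f xi) ^+ 2 <= (2 `^ (- s)) ^+ k * M.
    have s2 : 0 < (2 ^+ k) `^ s by rewrite powR_gt0 ?exprn_gt0.
    rewrite powRN exprVn -powR_pow2 ler_pdivlMl//.
    apply: le_trans (hM _ (block_uniq k) (block_dual (k := k))).
    rewrite mulr_sumr big_seq [leRHS]big_seq; apply: ler_sum => xi.
    rewrite mem_filter -ltNge => /andP[ax _]; rewrite ler_wpM2r ?sqr_ge0//.
    apply: ge0_ler_powR; [exact: ltW| | |exact: ltW].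
      by rewrite nnegrE exprn_ge0.
    by rewrite nnegrE ltW// a0.
  apply: (le_trans (Lpint_trig Gcompact Ghaar p2 (block_uniq k)
    (block_dual (k := k)) (block_size k) hE)).
  rewrite LX lee_fin -/r le_eqVlt; apply/orP; left; apply/eqP.
  have -> : K * (2 ^+ k.+1) `^ alpha * ((2 `^ (- s)) ^+ k * M) =
      (K * 2 `^ alpha * M) * (2 ^+ k) `^ (alpha - s).
    rewrite !powR_pow2 exprS powRB; last by rewrite pnatr_eq0 implybT.
    by rewrite powRN expr_div_n exprVn; ring.
  rewrite powRM ?mulr_ge0 ?powR_ge0 ?(ltW K0) ?(ltW M0)//.
  rewrite -powRrM powR_pow2 /X /tau powRB; last by rewrite pnatr_eq0 implybT.
  by rewrite powRN expr_div_n exprVn; ring.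
have [g g1 Sg] := Lpint_tail_limit p1 L0 theta0 theta1 cS dS.
have mg := CL1_cmeas g1; have mf := CL1_cmeas f1.
have mS k := cmeas_ccont (cS k).
have S1 k : CL1 mu (S k) by exact: ccont_CL1.
(* Once [xi] belongs to level n, the partial sum [S n] has the same coefficient as [f]; closeness in
   L^p implies closeness in L^1, hence of coefficients. *)
have coefg xi : dual xi -> coef mu (fun x => f x - g x) xi = 0.
  move=> dxi; rewrite fcoefB//; apply/eqP; rewrite subr_eq0; apply/eqP.
  apply: eq_cabs_small => d d0.
  have md : 0 < mass mu * d by exact: mulr_gt0.
  have [d' d'0 hd'] := Lpint_small Gcompact Ghaar ltr01 p1 md.
  have [N hN] := Sg _ d'0.
  have [k xk] : exists k, a xi <= 2 ^+ k.
    exists (Num.truncn (a xi)).+1; rewrite (le_trans (ltW (truncnS_gt _)))//.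
    by rewrite -natrX ler_nat ltnW// ltn_expl.
  pose n := maxn N k.
  have xn : xi \in level n.
    apply/mem_level; split => //; rewrite (le_trans xk)// ler_weXn2l ?ler1n//.
    exact: leq_maxr.
  have <- : coef mu (S n) xi = coef mu f xi.
    by rewrite /S (coef_trig Gcompact Ghaar)// ?xn//; exact: level_dual.
  rewrite -fcoefB// -(ler_pM2l m0) -lee_fin.
  apply: (le_trans (cabs_coef_le Gcompact Ghaar dxi (CL1B (S1 n) g1))).
  by apply: hd'; [exact: cmeasB|apply: hN; exact: leq_maxl].
have fg : {ae mu, forall x, f x - g x = 0}.
  exact: (coef_eq0_ae Ghaus Gcompact Ghaar (CL1B f1 g1) coefg).
rewrite (@Lpint_ae _ _ mu p _ (fun x => g x - S k0 x)).
- have t0 := tail_gt0 L0 theta0 theta1 k0.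
  have [N hN] := Sg (tail L theta k0 `^ p) (powR_gt0 p t0).
  pose n := (k0 + N)%N.
  have -> : Lpint mu p (fun x => g x - S k0 x) =
      Lpint mu p (fun x => (g x - S n x) + (S n x - S k0 x)).
    by apply: eq_integral => x _; congr ((cabs _ `^ p)%:E); ring.
  apply: (@le_trans _ _ ((2 * tail L theta k0) `^ p)%:E); last by rewrite lee_fin.
  rewrite [2 * _]mulr_natl mulr2n; apply: Lpint_minkowski => //.
  + exact: ltW.
  + exact: ltW.
  + exact: cmeasB.
  + exact: cmeasB.
  + by rewrite LpintB; apply: hN; exact: leq_addl.
  + exact: Lpint_tail.
- exact: (cmeasB mf (mS k0)).
- exact: (cmeasB mg (mS k0)).
- have FF := ae_filter_ringOfSetsType mu.
  by apply: filterS fg => x /eqP; rewrite subr_eq0 => /eqP ->.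
Qed.

End dyadic.

(** * Uniform approximation by finitely many frequencies *)

Section uniform_approx.
Variables (R : realType) (G : topologicalZmodType).
Variable mu : {measure set (borel G) -> \bar R}.
Hypothesis Ghaus : hausdorff_space G.
Hypothesis Gcompact : compact [set: G].
Hypothesis Ghaar : haar_measure mu.

Implicit Types (f g xi : G -> R[i]) (F : seq (G -> R[i])).

(* The sum S of n characters has mean square n, but |S| >= n / 2 on U; covering G by
   finitely many translates of U bounds n. *)
Lemma equicontinuous_dual_finite (U : set G) : open U -> U 0 ->
  (forall h, U h -> forall xi, dual xi -> cabs (xi h - 1) <= 2^-1) ->
  finite_set (@dual R G).
Proof.
move=> oU U0 Usmall.
pose V b := (fun x : G => x - b) @^-1` U.
have oV b : open (V b).
  by apply: open_comp oU => x _; exact: shift_continuous.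
have : @cover_compact (pointedG G) [set: G] by rewrite -compact_cover.
move=> /(_ _ [set: G] V) [//| |D _ covD].
  by move=> x _; exists x => //; rewrite /V/= subrr.
pose l : seq G := finmap.enum_fset D.
(* With n characters and m translates, [(n / 2)^2] is at most the mean of the sum of the translated
   squares, which is [m n]; so n is at most 4m. *)
have bound F : uniq F -> {in F, forall xi, dual xi} -> (size F <= 4 * size l)%N.
  move=> uF dF; pose S := trig F (fun=> 1).
  have cS : ccont S by exact: ccont_trig.
  pose n : R := (size F)%:R.
  have SU h : U h -> n / 2 <= cabs (S h).
    move=> Uh; have h1 : cabs (n%:C%C - S h) <= n / 2.
      have -> : n%:C%C - S h = \sum_(xi <- F) (1 - xi h).
        rewrite big_split/= sumrN /S /trig big_const_seq count_predT iter_addr_0.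
        have -> : n%:C%C = 1 *+ size F by exact: rmorph_nat.
        by under eq_bigr do rewrite mul1r.
      rewrite (le_trans (cabs_sum _ _ _))//.
      have -> : n / 2 = \sum_(xi <- F) 2^-1.
        by rewrite big_const_seq count_predT iter_addr_0 /n mulr_natl.
      rewrite big_seq [leRHS]big_seq; apply: ler_sum => xi xiF.
      by rewrite cabsB; apply: Usmall => //; exact: dF.
    have := cabsD (n%:C%C - S h) (S h).
    by rewrite subrK cabsr ger0_norm ?ler0n// => h2; lra.
  have N2S : N2 mu S = n.
    rewrite N2_trig// (eq_bigr (fun=> 1)); last by move=> xi _; rewrite cabs1 expr1n.
    by rewrite big_const_seq count_predT iter_addr_0.
  have cS2 := sqr_cabs_continuous cS.
  have cSb b : continuous (fun x => cabs (S (x - b)) ^+ 2).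
    move=> x; apply: (@continuous_comp _ _ _ (fun x : G => x - b) (fun x => cabs (S x) ^+ 2)).
      exact: shift_continuous.
    exact: cS2.
  have : (n / 2) ^+ 2 <= mean mu (fun x => \sum_(b <- l) cabs (S (x - b)) ^+ 2).
    rewrite -[leLHS](mean_cst Gcompact Ghaar); apply: (le_mean Gcompact Ghaar).
    - by apply: (continuous_L1 Gcompact Ghaar) => x; exact: cvg_cst.
    - by apply: (L1_sum Gcompact Ghaar) => b; exact: continuous_L1.
    - move=> x; have [b bD Vbx] := covD x I.
      have bl : b \in l by [].
      rewrite (big_rem b)//= -[leLHS]addr0 lerD ?sumr_ge0// => [|t _]; last exact: sqr_ge0.
      by rewrite lerXn2r ?nnegrE ?cabs_ge0 ?divr_ge0 ?ler0n//; exact: SU.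
  rewrite (mean_sum Gcompact Ghaar); last by move=> b; exact: continuous_L1.
  rewrite (eq_bigr (fun=> n)); last first.
    by move=> b _; rewrite (mean_shift Gcompact Ghaar (- b) cS2) -N2S.
  rewrite big_const_seq count_predT iter_addr_0 -[X in _ <= X]mulr_natr => h.
  have [->//|F0] := posnP (size F).
  have n0 : 0 < n by rewrite /n ltr0n.
  rewrite -(ler_nat R) natrM -/n -(ler_pM2l n0); move: h; set t := (size l)%:R; nra.
apply: contrapT => /(infinite_set_fset (4 * size l).+1)[B BA].
have := bound (finmap.enum_fset B) (finmap.fset_uniq B) (fun xi xiB => BA xi xiB).
by rewrite ltnNge => ->.
Qed.

Variables (gamma : (G -> R[i]) -> R) (s alpha : R).
Hypotheses (s_ge0 : 0 <= s) (s_alpha : s < alpha).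
Hypothesis gamma_sum : (esum (@dual R G) (fun xi => (dual_weight mu
      * ((1 + gamma xi ^+ 2)^-1) `^ alpha)%:E) < +oo)%E.
Hypothesis equicont : forall eps : R, 0 < eps ->
  exists U : set G, [/\ open U, U 0 &
    forall h, U h -> forall xi, @dual R G xi ->
      cabs (xi h - 1) / (1 + gamma xi ^+ 2) `^ s <= eps].

(** The H^s bound on finite sets of characters, in the normalization of [coef]; in this form it
    involves real sums only. *)
Definition Hs_bounded (M : R) f := forall F, uniq F -> {in F, forall xi, dual xi} ->
  \sum_(xi <- F) (1 + gamma xi ^+ 2) `^ s * cabs (coef mu f xi) ^+ 2 <= M.

Lemma trig_approx (p M e : R) : 1 <= p -> p < 2 * alpha / (alpha - s) ->
  0 < M -> 0 < e ->
  exists F, [/\ uniq F, {in F, forall xi, dual xi} &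
    forall f, CL1 mu f -> Hs_bounded M f ->
      (Lpint mu p (fun x => (f x - trig F (coef mu f) x)%R) <= e%:E)%E].
Proof.
move=> p1 pa M0 e0; have p0 : 0 < p by rewrite (lt_le_trans _ p1).
(* For s = 0 the critical exponent is 2 and the block estimate at exponent 2 has ratio 1, without
   decay. The weight in the equicontinuity bound is then 1, the dual is finite, and [f] is almost
   everywhere its full Fourier sum. *)
have [s0|s0] := eqVneq s 0.
  have half0 : 0 < 2^-1 :> R by rewrite invr_gt0.
  have [U [oU U0 hU]] := equicont half0.
  have fin : finite_set (@dual R G).
    apply: (equicontinuous_dual_finite oU U0) => h Uh xi dxi.
    by have := hU h Uh xi dxi; rewrite s0 powRr0 divr1.
  pose F : seq (G -> R[i]) := finmap.enum_fset (fset_set (@dual R G)).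
  have memF xi : (xi \in F) <-> dual xi.
    by have := in_fset_set fin xi; rewrite /F => ->; rewrite inE.
  have uF : uniq F by exact: finmap.fset_uniq.
  have dF : {in F, forall xi, dual xi} by move=> xi /memF.
  exists F; split => // f f1 _.
  have t1 : CL1 mu (trig F (coef mu f)) by exact: CL1_trig.
  have z : {ae mu, forall x, f x - trig F (coef mu f) x = 0}.
    apply: (coef_eq0_ae Ghaus Gcompact Ghaar (CL1B f1 t1)) => xi dxi.
    by rewrite fcoefB// coef_trig// (memF xi).2// subrr.
  rewrite (@Lpint_ae _ _ mu p _ (fun=> 0)).
  - rewrite /Lpint integral0_eq ?lee_fin ?(ltW e0)// => x _.
    by rewrite cabs0 powR0// gt_eqF.
  - exact: (CL1_cmeas (CL1B f1 t1)).
  - exact: (cmeas_ccont (ccont_cst _ 0)).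
  - exact: z.
have sp : 0 < s by rewrite lt_neqAle eq_sym s0.
have as0 : 0 < alpha - s by rewrite subr_gt0.
(* Blocks are estimated for exponents at least 2, and 2 is below the critical exponent because s >
   0; smaller p follow by [Lpint_small]. *)
pose q := Num.max p 2.
have q2 : 2 <= q by rewrite le_max lexx orbT.
have pq : p <= q by rewrite le_max lexx.
have qa : q < 2 * alpha / (alpha - s).
  rewrite gt_max pa/= ltr_pdivlMr//; lra.
have [d d0 hd] := Lpint_small Gcompact Ghaar p0 pq e0.
have [F [uF dF hF]] := trig_approx_gt0 Ghaus Gcompact Ghaar sp s_alpha gamma_sum q2 qa M0 d0.
exists F; split => // f f1 fM; apply: hd; last exact: hF.
by exact: (cmeasB (CL1_cmeas f1) (cmeas_ccont (ccont_trig _ dF))).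
Qed.

End uniform_approx.

(** * Extraction of the subsequence *)

Section subsequence.
Variable R : realType.

Lemma ultra_limit (U : set_system nat) (v : nat -> R) (B : R) : UltraFilter U ->
  (forall n, `|v n| <= B) ->
  exists l, forall d, 0 < d -> U [set n | `|v n - l| <= d].
Proof.
move=> UU vB.
have vU : (v @ U) `[- B, B]%classic.
  rewrite /nbhs/= (_ : _ @^-1` _ = setT); first exact: filterT.
  by apply/seteqP; split => // n _; rewrite /= in_itv/= -ler_norml.
have [l [_ cl]] := @segment_compact R (- B) B (v @ U) _ vU.
exists l => d d0.
have [//|nU] := in_ultra_setVsetC [set n | `|v n - l| <= d] UU.
have far : (v @ U) [set x | d < `|x - l|].
  rewrite -[_ _]/(U [set n | d < `|v n - l|]).
  by apply: filterS nU => n nle; rewrite /= ltNge; apply/negP => h; apply: nle.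
have near : nbhs l [set x | `|x - l| <= d].
  have := nbhsx_ballx l d d0; apply: filterS => x.
  by rewrite /ball/= distrC => /ltW.
have [x [/= h1 h2]] := cl _ _ far near.
by rewrite ltNge h2 in h1.
Qed.

(** An ultrafilter refining [\oo] gives limits at all indices of [D] simultaneously, with no
    enumeration of [D]. The subsequence then has to meet only finitely many finite conditions at
    each stage. *)
Lemma common_subsequence (I : choiceType) (D : set I) (v : nat -> I -> R[i]) (B : R)
  (F : nat -> seq I) (d : nat -> R) :
  (forall n i, D i -> cabs (v n i) <= B) -> (forall j, {in F j, forall i, D i}) ->
  (forall j, 0 < d j) ->
  exists (c : I -> R[i]) (phi : nat -> nat),
    {homo phi : m n / (m < n)%N >-> (m < n)%N} /\
    forall j n, (j <= n)%N -> {in F j, forall i, cabs (v (phi n) i - c i) <= d j}.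
Proof.
move=> vB FD d0.
have [U [UU EU]] := ultraFilterLemma (eventually_filter : ProperFilter \oo).
have /choice[c hc] i : exists c : R[i], D i -> forall e, 0 < e ->
    U [set n | cabs (v n i - c) <= e].
  have [Di|nDi] := pselect (D i); last by exists 0.
  have [|l1 h1] := @ultra_limit U (fun n => complex.Re (v n i)) B UU.
    by move=> n; rewrite (le_trans (normRe_cabs _))// vB.
  have [|l2 h2] := @ultra_limit U (fun n => complex.Im (v n i)) B UU.
    by move=> n; rewrite (le_trans (normIm_cabs _))// vB.
  exists (Complex l1 l2) => _ e e0.
  have e2 : 0 < e / 2 by rewrite divr_gt0.
  apply: filterS2 (h1 _ e2) (h2 _ e2) => n /= r j.
  rewrite (le_trans (cabs_ReIm _))// Re_add Im_add Re_opp Im_opp/=.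
  by rewrite [leRHS]splitr lerD.
exists c.
pose A j := [set n | {in F j, forall i, cabs (v n i - c i) <= d j}].
have UA j : U (A j).
  have : forall s : seq I, {in s, forall i, D i} ->
      U [set n | {in s, forall i, cabs (v n i - c i) <= d j}].
    elim=> [_|i s IH sD]; first by apply: filterS filterT => n _ i.
    have Di : D i by apply: sD; rewrite inE eqxx.
    have /IH Us : {in s, forall i, D i} by move=> t ts; apply: sD; rewrite inE ts orbT.
    apply: filterS2 (hc i Di _ (d0 j)) Us => n /= hi hs t.
    by rewrite inE => /predU1P[->//|/hs].
  by apply; exact: FD.
have UAall j : U [set n | forall k, (k <= j)%N -> A k n].
  elim: j => [|j IH].
    by apply: filterS (UA 0%N) => n An k; rewrite leqn0 => /eqP ->.
  apply: filterS2 (UA j.+1) IH => n A1 A2 k.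
  by rewrite leq_eqVlt => /predU1P[->//|/A2].
(* [z.1] is the stage, whose conditions and all earlier ones are imposed; [z.2] is the previous
   value, to be exceeded. Sets of the ultrafilter meet every tail because of [EU]. *)
have /choice[next hnext] (z : nat * nat) : exists n, (z.2 < n)%N /\
    forall k, (k <= z.1)%N -> A k n.
  have Utail : U [set n | (z.2 < n)%N].
    by apply: EU; exists z.2.+1.
  by have [n [h1 h2]] := filter_ex (filterI Utail (UAall z.1)); exists n.
pose fix phi n := match n with 0 => next (0, 0)%N | m.+1 => next (m.+1, phi m) end.
exists phi; split.
  apply: homo_ltn.
    by move=> y x z; exact: ltn_trans.
  by move=> n; have [] := hnext (n.+1, phi n).
move=> j [|n] jn.
  by have [_ h] := hnext (0, 0)%N; exact: (h j jn).
by have [_ h] := hnext (n.+1, phi n); exact: (h j jn).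
Qed.

End subsequence.

(** * Consequences of a bound in H^s, and small trigonometric polynomials *)

Section Hs_facts.
Variables (R : realType) (G : topologicalZmodType).
Variable mu : {measure set (borel G) -> \bar R}.
Hypothesis Gcompact : compact [set: G].
Hypothesis Ghaar : haar_measure mu.

(** Squaring [fourier = mass * coef] gives two factors of mass, and [dual_weight] cancels one; the
    other is the divisor of [M]. *)
Lemma Hs_norm_bounded (gamma : (G -> R[i]) -> R) (s M : R) (f : G -> R[i]) :
  (Hs_norm2 mu gamma s f <= M%:E)%E -> Hs_bounded mu gamma s (M / mass mu) f.
Proof.
move=> fM F uF dF; have m0 := mass_gt0 Gcompact Ghaar.
rewrite ler_pdivlMr// -lee_fin; apply: le_trans fM.
apply: le_trans (sum_le_esum (fun xi => dual_weight mu * (1 + gamma xi ^+ 2) `^ s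
  * cabs (fourier mu f xi) ^+ 2) uF dF).
rewrite lee_fin le_eqVlt; apply/orP; left; apply/eqP.
rewrite mulr_suml; apply: eq_bigr => xi _.
rewrite (fourierE Gcompact Ghaar) cabsM cabsr ger0_norm ?(ltW m0)//.
have wm : dual_weight mu * mass mu = 1 by rewrite mulVf// gt_eqF.
transitivity (dual_weight mu * mass mu * ((1 + gamma xi ^+ 2) `^ s *
  cabs (coef mu f xi) ^+ 2 * mass mu)); last by ring.
by rewrite wm mul1r.
Qed.

Lemma Hs_bounded_coef (gamma : (G -> R[i]) -> R) (s M : R) (f xi : G -> R[i]) :
  0 <= s -> dual xi -> Hs_bounded mu gamma s M f -> cabs (coef mu f xi) <= 1 + M.
Proof.
move=> s0 dxi fM.
have := fM [:: xi] isT (_ : {in [:: xi], forall xi, dual xi}).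
rewrite big_seq1 => /(_ _) h.
have {}h : (1 + gamma xi ^+ 2) `^ s * cabs (coef mu f xi) ^+ 2 <= M.
  by apply: h => eta; rewrite inE => /eqP ->.
have w1 : 1 <= (1 + gamma xi ^+ 2) `^ s.
  have := @ge0_ler_powR R s s0 1 (1 + gamma xi ^+ 2).
  by rewrite powR1 !nnegrE; apply; rewrite ?addr_ge0 ?lerDl ?sqr_ge0.
have := sqr_ge0 (cabs (coef mu f xi) - 1); have := cabs_ge0 (coef mu f xi).
have : cabs (coef mu f xi) ^+ 2 <= M.
  by apply: le_trans h; rewrite ler_peMl ?sqr_ge0.
set t := cabs _; nra.
Qed.

Lemma Lpint_addlty (p : R) (f g : G -> R[i]) : 1 <= p -> cmeas f -> cmeas g ->
  (Lpint mu p f < +oo)%E -> (Lpint mu p g < +oo)%E ->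
  (Lpint mu p (fun x => (f x + g x)%R) < +oo)%E.
Proof.
move=> p1 mf mg ff gf; have p0 : 0 < p by rewrite (lt_le_trans _ p1).
have fin h : (Lpint mu p h < +oo)%E ->
    (Lpint mu p h <= (((fine (Lpint mu p h)) `^ p^-1) `^ p)%:E)%E.
  move=> hf; rewrite -powRrM mulVf ?gt_eqF// powRr1 ?fine_ge0 ?Lpint_ge0//.
  by rewrite fineK// ge0_fin_numE// Lpint_ge0.
apply: le_lt_trans (Lpint_minkowski p1 _ _ mf mg (fin _ ff) (fin _ gf)) _.
- exact: powR_ge0.
- exact: powR_ge0.
- exact: ltry.
Qed.

Lemma trigB (F : seq (G -> R[i])) c c' x :
  trig F c x - trig F c' x = trig F (fun xi => c xi - c' xi) x.
Proof. by rewrite /trig -sumrB; apply: eq_bigr => xi _; rewrite mulrBl. Qed.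

Lemma Lpint_trig_small (p e : R) (F : seq (G -> R[i])) : 0 < p -> 0 < e ->
  {in F, forall xi, dual xi} -> exists2 d : R, 0 < d &
    forall c, {in F, forall xi, cabs (c xi) <= d} -> (Lpint mu p (trig F c) <= e%:E)%E.
Proof.
move=> p0 e0 dF; have m0 := mass_gt0 Gcompact Ghaar.
(* [B] is the constant whose p-th power has integral [e]. Dividing it among [(size F).+1] terms
   bounds the polynomial uniformly by [B], also when [F] is empty. *)
pose B := (e / mass mu) `^ p^-1.
have B0 : 0 < B by apply: powR_gt0; exact: divr_gt0.
have n0 : 0 < (size F).+1%:R :> R by rewrite ltr0n.
exists (B / (size F).+1%:R); first exact: divr_gt0.
move=> c cd; apply: (le_trans (Lpint_bounded Gcompact Ghaar (M := B) (ltW p0) _ _)).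
- exact: (cmeas_ccont (ccont_trig _ dF)).
- move=> x; rewrite /trig (le_trans (cabs_sum _ _ _))//.
  apply: (@le_trans _ _ (\sum_(xi <- F) B / (size F).+1%:R)).
    rewrite big_seq [leRHS]big_seq; apply: ler_sum => xi xiF.
    by rewrite cabsM cabs_dual ?mulr1 ?cd//; exact: dF.
  rewrite big_const_seq count_predT iter_addr_0 -[leLHS]mulr_natr mulrAC ler_pdivrMr//.
  by rewrite ler_pM2l// ler_nat.
rewrite lee_fin /B -powRrM mulVf ?gt_eqF// powRr1 ?divfK ?gt_eqF//.
by rewrite divr_ge0// ltW.
Qed.

End Hs_facts.

Theorem theorem4 (R : realType) (G : topologicalZmodType)
  (mu : {measure set (borel G) -> \bar R})
  (gamma : (G -> R[i]) -> R) (s alpha : R) :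
  hausdorff_space G ->
  compact [set: G] ->
  haar_measure mu ->
  in_Gamma gamma ->
  0 <= s ->
  s < alpha ->
  (esum (@dual R G) (fun xi => (dual_weight mu
      * ((1 + gamma xi ^+ 2)^-1) `^ alpha)%:E) < +oo)%E ->
  (forall eps : R, 0 < eps ->
     exists U : set G, [/\ open U, U 0 &
       forall h, U h -> forall xi, @dual R G xi ->
         cabs (xi h - 1) / (1 + gamma xi ^+ 2) `^ s <= eps]) ->
  forall p : R, 1 <= p -> p < 2 * alpha / (alpha - s) ->
  forall f : nat -> G -> R[i],
    (forall n, in_Hs mu gamma s (f n)) ->
    (exists M : R, forall n, (Hs_norm2 mu gamma s (f n) <= M%:E)%E) ->
    exists phi : nat -> nat,
      {homo phi : m n / (m < n)%N >-> (m < n)%N} /\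
      exists g : G -> R[i], in_Lp mu p g /\
        (fun n => (\int[mu]_(x in [set: borel G])
                    ((cabs (f (phi n) x - g x)) `^ p)%:E)%E) @ \oo --> 0%E.
Proof.
move=> Ghaus Gcompact Ghaar _ s0 sa gsum equi p p1 pa f fHs [M0 fM0].
have p0 : 0 < p by rewrite (lt_le_trans _ p1).
have mf n : cmeas (f n) by have [[]] := fHs n.
have f1 n : CL1 mu (f n).
  apply: Lpint1_CL1 => //; apply: (Lpint_lty Gcompact Ghaar (q := 2)) => //.
    by rewrite ler1n.
  by have [[]] := fHs n.
pose M := `|M0 / mass mu| + 1.
have Mgt0 : 0 < M by rewrite ltr_wpDl.
have fM n : Hs_bounded mu gamma s M (f n).
  move=> F uF dF; apply: (le_trans (Hs_norm_bounded Gcompact Ghaar (fM0 n) uF dF)).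
  by rewrite ler_wpDr// ler_norm.
pose e j : R := j.+1%:R^-1.
have e0 j : 0 < e j by rewrite invr_gt0 ltr0n.
have /choice[F hF] j :=
  trig_approx Ghaus Gcompact Ghaar s0 sa gsum equi p1 pa Mgt0 (e0 j).
have dF j : {in F j, forall xi, dual xi} by have [] := hF j.
have fF j n : (Lpint mu p (fun x => (f n x - trig (F j) (coef mu (f n)) x)%R)
    <= (e j)%:E)%E.
  by have [_ _] := hF j; apply.
have /choice[d hd] j : exists d : R, 0 < d /\
    forall c, {in F j, forall xi, cabs (c xi) <= d} ->
      (Lpint mu p (trig (F j) c) <= (e j)%:E)%E.
  by have [d d0 hd] := Lpint_trig_small Gcompact Ghaar p0 (e0 j) (dF j); exists d.
have d2 j : 0 < d j / 2 by rewrite divr_gt0//; have [] := hd j.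
have [c [phi [phi_mono hphi]]] := @common_subsequence R _ (@dual R G)
  (fun n xi => coef mu (f n) xi) (1 + M) F (fun j => d j / 2)
  (fun n xi dxi => Hs_bounded_coef s0 dxi (fM n)) dF d2.
exists phi; split => //.
have mt j n : cmeas (trig (F j) (coef mu (f n))).
  exact: (cmeas_ccont (ccont_trig _ (dF j))).
(* Three errors of norm at most [e j ^ (1 / p)]: two approximations by frequencies in [F j], and the
   difference of the polynomials, whose coefficients are both within [d j / 2] of [c]. *)
have close j n m : (j <= n)%N -> (j <= m)%N ->
    (Lpint mu p (fun x => (f (phi n) x - f (phi m) x)%R) <= ((3 * e j `^ p^-1) `^ p)%:E)%E.
  move=> jn jm; set A := e j `^ p^-1.
  have A0 : 0 <= A by exact: powR_ge0.
  have Ap : A `^ p = e j by rewrite /A -powRrM mulVf ?gt_eqF// powRr1// ltW.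
  have -> : Lpint mu p (fun x => f (phi n) x - f (phi m) x) =
    Lpint mu p (fun x => (f (phi n) x - trig (F j) (coef mu (f (phi n))) x) +
      (trig (F j) (fun xi => coef mu (f (phi n)) xi - coef mu (f (phi m)) xi) x +
       (trig (F j) (coef mu (f (phi m))) x - f (phi m) x))).
    by apply: eq_integral => x _; congr ((cabs _ `^ p)%:E); rewrite -trigB; ring.
  have -> : 3 * A = A + (A + A) by ring.
  have mtt : cmeas (trig (F j) (fun xi => coef mu (f (phi n)) xi - coef mu (f (phi m)) xi)).
    exact: (cmeas_ccont (ccont_trig _ (dF j))).
  have AA0 : 0 <= A + A by exact: addr_ge0.
  apply: Lpint_minkowski => //.
  - exact: cmeasB.
  - by apply: cmeasD => //; exact: cmeasB.
  - by rewrite Ap.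
  apply: Lpint_minkowski => //.
  - exact: cmeasB.
  - rewrite Ap; apply: (hd j).2 => xi xiF.
    have -> : coef mu (f (phi n)) xi - coef mu (f (phi m)) xi =
      (coef mu (f (phi n)) xi - c xi) - (coef mu (f (phi m)) xi - c xi) by ring.
    rewrite (le_trans (cabsD _ _))// cabsN [leRHS]splitr.
    by rewrite lerD// hphi.
  - by rewrite Ap LpintB.
have cauchy_f r : 0 < r -> exists N, forall n m, (N <= n)%N -> (N <= m)%N ->
    (Lpint mu p (fun x => (f (phi n) x - f (phi m) x)%R) <= r%:E)%E.
  (* The bound of [close] equals [3 ^ p * e j], so [e j < r / 3 ^ p] suffices. *)
  move=> r0; have q0 : 0 < r / 3 `^ p by rewrite divr_gt0// powR_gt0.
  have [j hj] := ltr_add_invr q0; rewrite add0r in hj.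
  exists j => n m jn jm; apply: (le_trans (close _ _ _ jn jm)).
  rewrite lee_fin powRM// ?powR_ge0// -powRrM mulVf ?gt_eqF// powRr1 ?(ltW (e0 j))//.
  by rewrite mulrC -ler_pdivlMr ?powR_gt0// ltW.
have [g mg fg] := cauchy_Lpint_limit p1 (fun n => mf (phi n)) cauchy_f.
exists g; split.
  have [N /(_ N (leqnn N)) hN] := fg 1 ltr01.
  have fin : (Lpint mu p g < +oo)%E.
    (* Membership in H^s provides only L^2 directly; for larger p, integrability of [g] comes from a
       trigonometric polynomial close to [f (phi N)] in L^p. *)
    have -> : g = (fun x => (g x - f (phi N) x) + ((f (phi N) x -
        trig (F 0%N) (coef mu (f (phi N))) x) + trig (F 0%N) (coef mu (f (phi N))) x)).
      by apply/funext => x; ring.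
    have m1 := cmeasB mg (mf (phi N)); have m2 := cmeasB (mf (phi N)) (mt 0%N (phi N)).
    have m3 := mt 0%N (phi N).
    apply: Lpint_addlty => //; first exact: cmeasD.
      by rewrite LpintB; apply: le_lt_trans hN _; exact: ltry.
    apply: Lpint_addlty => //; first by apply: le_lt_trans (fF _ _) _; exact: ltry.
    have [B _ hB] := ccont_bounded Gcompact (ccont_trig (coef mu (f (phi N))) (dF 0%N)).
    apply: le_lt_trans (Lpint_bounded Gcompact Ghaar (ltW p0) m3 hB) _.
    exact: ltry.
  by have [r i] := mg; split.
have u0 n : (0 <= Lpint mu p (fun x => (f (phi n) x - g x)%R))%E by exact: Lpint_ge0.
have fin n (r : R) : (Lpint mu p (fun x => (f (phi n) x - g x)%R) <= r%:E)%E ->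
    Lpint mu p (fun x => (f (phi n) x - g x)%R) \is a fin_num.
  by move=> h; rewrite (ge0_fin_numE (u0 n)); exact: le_lt_trans h (ltry _).
apply/fine_cvgP; split.
  by have [N hN] := fg 1 ltr01; exists N => // n /= Nn; exact: fin (hN n Nn).
apply/cvgrPdist_le => r r0; have [N hN] := fg r r0; exists N => // n /= Nn.
rewrite sub0r normrN ger0_norm; last exact: fine_ge0 (u0 n).
by rewrite -lee_fin (fineK (fin n r (hN n Nn))); exact: hN.
Qed.
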